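(* Let $\tilde{\boldsymbol\beta}=\tilde{\boldsymbol\beta}^{(n)}$ be the adaptive-LASSO penalized logistic regression estimator computed from the aggregated noisy manual labels, i.e. a minimizer over $\boldsymbol\beta\in\mathbb{R}^d$ of $$L(\boldsymbol X,\boldsymbol S,\boldsymbol\beta)=-\sum_{i=1}^n\Big[S_i\,\boldsymbol\beta^\top\boldsymbol x_i-m\log\big(1+\exp(\boldsymbol\beta^\top\boldsymbol x_i)\big)\Big]+\lambda\sum_{j=1}^d w_j|\beta_j|,\qquad w_j=\frac{1}{|\beta'_j|^{\gamma}},$$ where $S_i$ is the number of votes for label $1$ among $m$ experts, generated by the Dirichlet-Multinomial model with overdispersion parameter $\alpha_0>0$ described in the context. Let $\tilde{\mathcal A}=\{j:\tilde\beta_j\neq 0\}$ and $\mathcal A=\{j:\beta_j^*\neq0\}$. Suppose that $\lambda=\lambda_n$ satisfies $\lambda/\sqrt n\to0$ and $\lambda n^{(\gamma-1)/2}\to\infty$ as $n\to\infty$, and that the following two assumptions hold. (A1) The Fisher information matrix $I(\boldsymbol\beta^* )=\mathbb E_{\boldsymbol x}\big[\boldsymbol x\boldsymbol x^\top p(\boldsymbol x,\boldsymbol\beta^* )(1-p(\boldsymbol x,\boldsymbol\beta^* ))\big]$ is finite and positive definite. (A2) With $\phi(t)=m\log(1+\exp(t))$, there is a sufficiently large open set $\mathcal O$ containing $\boldsymbol\beta^*$ and a function $M$ such that for all $\boldsymbol\beta\in\mathcal O$, $|\phi'''(\boldsymbol\beta^\top\boldsymbol x)|\le M(\boldsymbol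 x)<\infty$, and $\mathbb E[M(\boldsymbol x)|x_jx_kx_l|]<\infty$ for all $1\le j,k,l\le d$. Then: (1) (Consistency in variable selection) $\lim_{n\to\infty}\Pr(\tilde{\mathcal A}=\mathcal A)=1$. (2) (Asymptotic normality) $$\sqrt n\,\big(\tilde{\boldsymbol\beta}_{\mathcal A}-\boldsymbol\beta^*_{\mathcal A}\big)\xrightarrow{d}N\Big(\boldsymbol 0,\ \frac{m+\alpha_0}{m(1+\alpha_0)}\,I_{\mathcal A}^{-1}\Big).$$
   Context: The dimension $d$, the number of experts $m\ge1$, the overdispersion parameter $\alpha_0>0$, and the exponent $\gamma>0$ are fixed while $n\to\infty$. Logistic model: $p(\boldsymbol x,\boldsymbol\beta)=1/(1+\exp(-\boldsymbol\beta^\top\boldsymbol x))$ for $\boldsymbol x=(x_1,\dots,x_d)^\top$, and the true label $y\in\{0,1\}$ satisfies $\Pr(y=1\mid\boldsymbol x)=p(\boldsymbol x,\boldsymbol\beta^* )$, with true coefficient vector $\boldsymbol\beta^*\in\mathbb R^d$, which is sparse: $|\mathcal A|=s<d$. The feature vectors $\boldsymbol x_1,\dots,\boldsymbol x_n$ are i.i.d. copies of $\boldsymbol x$, and $\boldsymbol X$ is the matrix with rows $\boldsymbol x_i^\top$. Manual labels: write $\mathbf{Pr}=(\Pr_1,\Pr_2)$ with $\Pr_1=p(\boldsymbol x_i,\boldsymbol\beta^* )$, $\Pr_2=1-\Pr_1$. For each $i$, conditionally on $\boldsymbol x_i$ and independently over $i$, the vote counts $(S_i^{(1)},S_i^{(0)})$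 of $m$ experts (numbers of votes for labels $1$ and $0$) follow the Dirichlet-Multinomial$(m,\alpha_0\mathbf{Pr})$ distribution: first $\boldsymbol p_i=(p_i^{(1)},p_i^{(0)})\sim\mathrm{Dirichlet}(\alpha_0\mathbf{Pr})$, then $(S_i^{(1)},S_i^{(0)})\mid\boldsymbol p_i\sim\mathrm{Multinomial}(m,\boldsymbol p_i)$. Write $S_i=S_i^{(1)}$ and $\boldsymbol S=(S_1,\dots,S_n)^\top$. The weights use an initial estimator $\boldsymbol\beta'$ which is $\sqrt n$-consistent, i.e. $\|\boldsymbol\beta'-\boldsymbol\beta^*\|_2=O_P(n^{-1/2})$ (for example the ordinary unpenalized logistic regression estimator). For a vector, the subscript $\mathcal A$ denotes the subvector with indices in $\mathcal A$; $I_{\mathcal A}$ is the submatrix of $I(\boldsymbol\beta^* )$ with rows and columns in $\mathcal A$. $\xrightarrow{d}$ is convergence in distribution. *)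

(* Defs.v *)
From HB Require Import structures.
From mathcomp Require Import all_boot all_order all_algebra finmap.
From mathcomp Require Import all_classical all_reals all_analysis.

Set Implicit Arguments.
Unset Strict Implicit.
Unset Printing Implicit Defensive.

Import Order.TTheory GRing.Theory Num.Theory.
Import numFieldNormedType.Exports.

Local Open Scope classical_set_scope.
Local Open Scope ring_scope.

(** Random vectors: ['cV[R]_k] carries its usual topology but no sigma-algebra
    in the library; [borelV R k] is ['cV[R]_k] with the Borel sigma-algebra. *)
Definition borelV (R : realType) (k : nat) : Type :=
  g_sigma_algebraType (@open 'cV[R]_k).

Section vectors.
Context {R : realType} {d : nat}.
Implicit Types b v : 'cV[R]_d.

Definition dotv b v : R := (b^T *m v) ord0 ord0.

Definition norm2 b : R := Num.sqrt (\sum_(j < d) b j ord0 ^+ 2).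

Definition supp b : {set 'I_d} := [set j | b j ord0 != 0]%SET.

Definition subv (A : {set 'I_d}) b : 'cV[R]_#|A| :=
  rowsub (@enum_val _ (mem A)) b.

Definition submat (A : {set 'I_d}) (M : 'M[R]_d) : 'M[R]_#|A| :=
  mxsub (@enum_val _ (mem A)) (@enum_val _ (mem A)) M.

Definition posdefmx (M : 'M[R]_d) : Prop :=
  forall u : 'cV[R]_d, u != 0 -> 0 < dotv u (M *m u).

End vectors.

Section probability_notions.
Context {d : measure_display} {T : measurableType d} {R : realType}.
Variable P : probability T R.

Definition mutually_independent {d'} {U : measurableType d'}
    (Z : nat -> T -> U) : Prop :=
  forall (J : {fset nat}) (B : nat -> set U), (forall i, measurable (B i)) ->
  P (\bigcap_(i in [set` J]) (Z i @^-1` B i)) =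
  (\prod_(i <- J) P (Z i @^-1` B i))%E.

(** [Y n = O_P(r n)]. *)
Definition bigO_P (Y : nat -> T -> R) (r : nat -> R) : Prop :=
  forall eps : R, 0 < eps -> exists K : R, \forall n \near \oo,
    (P [set w | (K * `|r n| < `|Y n w|)%R] <= eps%:E)%E.

(** Weak convergence of the laws of the [Y n] to [nu]. *)
Definition cvg_in_distribution {k} (Y : nat -> T -> 'cV[R]_k)
    (nu : probability (borelV R k) R) : Prop :=
  forall f : 'cV[R]_k -> R, continuous f ->
    (exists K : R, forall v, `|f v| <= K) ->
  (\int[P]_w (f (Y n w))%:E)%E @[n --> \oo] --> (\int[nu]_v (f v)%:E)%E.

End probability_notions.

Section multivariate_normal.
Context {R : realType} {k : nat}.

Definition is_std_normal (nu : probability (borelV R k) R) : Prop :=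
  forall B : 'I_k -> set R, (forall j, measurable (B j)) ->
  nu [set v : 'cV[R]_k | forall j, B j (v j ord0)] =
  (\prod_(j < k) normal_prob 0 1 (B j))%E.

(** [nu] is the law of [mean + C Z] with [Z] standard normal and
    [C C^T = Sigma]; it depends on [mean] and [Sigma] only. *)
Definition is_normal (mean : 'cV[R]_k) (Sigma : 'M[R]_k)
    (nu : probability (borelV R k) R) : Prop :=
  exists C : 'M[R]_k, C *m C^T = Sigma /\
  exists g : probability (borelV R k) R, is_std_normal g /\
  forall B : set (borelV R k), measurable B ->
    nu B = g [set z : 'cV[R]_k | B (mean + C *m z)].

Definition cvg_to_normal {d} {T : measurableType d} (P : probability T R)
    (Y : nat -> T -> 'cV[R]_k) (mean : 'cV[R]_k) (Sigma : 'M[R]_k) : Prop :=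
  exists nu : probability (borelV R k) R,
    is_normal mean Sigma nu /\ cvg_in_distribution P Y nu.

End multivariate_normal.

Section vote_model.
Context {R : realType}.

Let mu := @lebesgue_measure R.

(** Two categories: [(p1, p0) ~ Dirichlet(a1, a0)] is parametrised by
    [p1 = t], [p0 = 1 - t], so that the Dirichlet density is taken with
    respect to the Lebesgue measure in [t].  The library's [beta_fun] and
    [beta_pdf] only cover integer parameters. *)
Definition dirichlet_fun (a1 a0 t : R) : R :=
  t `^ (a1 - 1) * (1 - t) `^ (a0 - 1).

Definition dirichlet_pdf (a1 a0 t : R) : R :=
  dirichlet_fun a1 a0 t / Rintegral mu `]0, 1[ (dirichlet_fun a1 a0).

Definition multinomial_pmf (m : nat) (p1 p0 : R) (k1 k0 : nat) : R :=
  if (k1 + k0 == m)%N then 'C(m, k1)%:R * p1 ^+ k1 * p0 ^+ k0 else 0.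

Definition dirichlet_multinomial_pmf (m : nat) (a1 a0 : R) (k1 k0 : nat) : R :=
  Rintegral mu `]0, 1[
    (fun t => multinomial_pmf m t (1 - t) k1 k0 * dirichlet_pdf a1 a0 t).

End vote_model.

Section logistic.
Context {R : realType} {d : nat}.
Implicit Types b v : 'cV[R]_d.

Definition logistic v b : R := (1 + expR (- dotv b v))^-1.

Definition phi (m : nat) (t : R) : R := m%:R * ln (1 + expR t).

Variable Q : probability (borelV R d) R.

Definition fisher_integrand b (j k : 'I_d) v : R :=
  v j ord0 * v k ord0 * (logistic v b * (1 - logistic v b)).

Definition fisher b : 'M[R]_d :=
  \matrix_(j, k) Rintegral Q setT (fisher_integrand b j k).

Definition fisher_assumption b : Prop :=
  (forall j k, Q.-integrable setT
     (EFin \o (fisher_integrand b j k : borelV R d -> R))) /\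
  posdefmx (fisher b).

Definition third_derivative_assumption (m : nat) b : Prop :=
  exists (O : set 'cV[R]_d) (M : 'cV[R]_d -> R),
    [/\ open O, O b,
        forall b' v, O b' ->
          `|(phi m)^`(3)%classic (dotv b' v)| <= M v &
        forall j k l : 'I_d, Q.-integrable setT
          (EFin \o ((fun v : 'cV[R]_d =>
             M v * `|v j ord0 * v k ord0 * v l ord0|) : borelV R d -> R))].

End logistic.

Section estimator.
Context {R : realType} {d : nat}.

(** Extended real valued: the weight is [+oo] when [b' j = 0]. *)
Definition adaptive_weight (gamma : R) (b' : 'cV[R]_d) (j : 'I_d) : \bar R :=
  ((`|b' j ord0| `^ gamma)%:E^-1)%E.

(** With [+oo * 0 = 0], an infinite weight forces the coordinate to be 0 in
    any minimizer (for [0 < lambda]). *)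
Definition loss (n m : nat) (lambda gamma : R) (b' : 'cV[R]_d)
    (x : nat -> 'cV[R]_d) (S : nat -> nat) (b : 'cV[R]_d) : \bar R :=
  ((- \sum_(i < n) ((S i)%:R * dotv b (x i) - phi m (dotv b (x i))))%:E +
   lambda%:E * \sum_(j < d) (adaptive_weight gamma b' j * `|b j ord0|%:E))%E.

Definition is_adaptive_lasso (n m : nat) (lambda gamma : R) (b' : 'cV[R]_d)
    (x : nat -> 'cV[R]_d) (S : nat -> nat) (bt : 'cV[R]_d) : Prop :=
  forall b, (loss n m lambda gamma b' x S bt <= loss n m lambda gamma b' x S b)%E.

End estimator.

(* Main.v *)
Require Import Defs.
From HB Require Import structures.
From mathcomp Require Import all_boot all_order all_algebra finmap.
From mathcomp Require Import all_classical all_reals all_analysis.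
From mathcomp Require Import measurable_realfun ring lra.

Import Order.TTheory GRing.Theory Num.Theory.
Import numFieldNormedType.Exports.

Local Open Scope classical_set_scope.
Local Open Scope ring_scope.

Set Implicit Arguments.
Unset Strict Implicit.
Unset Printing Implicit Defensive.

(** Put [u = sqrt n *: (b - bstar)].  As a function of [u], the increment of the
    negative log-likelihood is convex, and on bounded sets it is close, in
    probability, to [u^T J u / 2 - W_n^T u], where [J = m I(bstar)] and [W_n] is
    the scaled score: this is a Taylor expansion with the law of large numbers
    for the second order term and (A2) for the third order one.  The penalty is
    negligible on the support of [bstar], because [lambda / sqrt n] tends to 0,
    while off the support its slope tends to infinity, because
    [lambda n^((gamma - 1) / 2)] does.  Convexity then confines the minimizer to
    a bounded set, the steep slope kills its coordinates off the support, and
    comparison with the minimizer [J_A^{-1} W_A] of the quadratic form on the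
    support shows that both differ by o(1) in probability.

    A vote count has conditional variance [m (m + alpha0) / (1 + alpha0) p (1 - p)]
    so [W_n] is asymptotically normal with covariance
    [m (m + alpha0) / (1 + alpha0) I(bstar)].  This is proved with
    characteristic functions, and tight sequences whose characteristic functions
    converge are shown to converge weakly by approximating a bounded continuous
    function with trigonometric polynomials. *)

(** * Integration *)

(** Outside finitely many bad events per sample size (a large score coordinate, an inaccurate entry
    of the empirical information, a large cubic remainder, a distant initial estimator) the argument
    is deterministic and applies to whichever minimizer is given. The constants are fixed in the
    order [K] (bound on the score), [C] (radius confining the minimizer, large enough for the
    quadratic term to beat the linear one), [eta] and [eta'] (allowed errors), and only then [n].
    The moment conditions on the features are all weighted: (A1) bounds [x x^T] only after
    multiplication by [p (1 - p)]. The conditional variance of a vote count is a multiple of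
    [p (1 - p)], so the score is square integrable precisely because the Fisher information is
    finite. The final covariance is a sandwich: since [J = m I], placing the score covariance on the
    support between two copies of the inverse of [J_A] divides [m (m + alpha0) / (1 + alpha0)] by
    [m ^ 2]. Characteristic functions are kept real, as pairs of a cosine and a sine integral, so
    each statement about them has two halves proved together. *)

Section integration.
Context d (T : measurableType d) (R : realType) (mu : {measure set T -> \bar R}).
Variable (D : set T).
Hypothesis mD : measurable D.

Lemma integrable_dominated (f g : T -> R) :
  measurable_fun D f -> mu.-integrable D (EFin \o g) ->
  (forall x, D x -> `|f x| <= g x) -> mu.-integrable D (EFin \o f).
Proof.
move=> mf ig fg; apply: (le_integrable mD _ _ ig).
- exact/measurable_EFinP.
- by move=> x Dx /=; rewrite lee_fin (le_trans (fg x Dx))// ler_norm.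
Qed.

Lemma dominated_convergence_Rintegral (f_ : nat -> T -> R) (f g : T -> R) :
  (forall n, measurable_fun D (f_ n)) ->
  (forall x, D x -> f_ n x @[n --> \oo] --> f x) ->
  mu.-integrable D (EFin \o g) ->
  (forall n x, D x -> `|f_ n x| <= g x) ->
  mu.-integrable D (EFin \o f) /\
  Rintegral mu D (f_ n) @[n --> \oo] --> Rintegral mu D f.
Proof.
move=> mf cf ig fg.
have mf' : measurable_fun D f by exact: (measurable_fun_cvg mf).
have [||||A _ B] := @dominated_convergence _ _ _ mu D mD (fun n => EFin \o f_ n) (EFin \o f) (EFin \o g) _ _ _ ig.
- by move=> n; exact/measurable_EFinP.
- exact/measurable_EFinP.
- apply: aeW => x Dx; apply: cvg_comp; [exact: cf|exact: cvg_refl].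
- by apply: aeW => x n Dx /=; rewrite lee_fin fg.
split => //.
apply: fine_cvg; rewrite fineK//.
exact: integrable_fin_num.
Qed.

Lemma Rintegral_sum (I : Type) (s : seq I) (p : pred I) (h : I -> T -> R) :
  (forall i, p i -> mu.-integrable D (EFin \o h i)) ->
  mu.-integrable D (EFin \o (fun x => \sum_(i <- s | p i) h i x)) /\
  Rintegral mu D (fun x => \sum_(i <- s | p i) h i x) =
  \sum_(i <- s | p i) Rintegral mu D (h i).
Proof.
move=> ih; elim: s => [|i s [IH1 IH2]].
  split.
    have -> : EFin \o (fun x : T => \sum_(i <- [::] | p i) h i x) = cst 0%E.
      by apply/funext => x /=; rewrite big_nil.
    exact: integrable0.
  rewrite big_nil (_ : (fun x => _) = cst 0) ?Rintegral_cst ?mul0r//.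
  by apply/funext => x; rewrite big_nil.
rewrite big_cons; case: ifPn => pi; last first.
  by under eq_fun do rewrite big_cons (negbTE pi).
have -> : (fun x => \sum_(j <- i :: s | p j) h j x) =
   (fun x => h i x + \sum_(j <- s | p j) h j x).
  by apply/funext => x; rewrite big_cons pi.
split; last by rewrite RintegralD// ?IH2//; exact: ih.
rewrite (_ : EFin \o _ = (EFin \o h i) \+ (EFin \o (fun x => \sum_(j <- s | p j) h j x)%R))%E//.
by apply: integrableD => //; exact: ih.
Qed.

Lemma integrable_EFinD (f g : T -> R) :
  mu.-integrable D (EFin \o f) -> mu.-integrable D (EFin \o g) ->
  mu.-integrable D (EFin \o (fun x => f x + g x)).
Proof. by move=> fi gi; exact: (integrableD mD fi gi). Qed.

Lemma integrable_EFinB (f g : T -> R) :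
  mu.-integrable D (EFin \o f) -> mu.-integrable D (EFin \o g) ->
  mu.-integrable D (EFin \o (fun x => f x - g x)).
Proof. by move=> fi gi; exact: (integrableB mD fi gi). Qed.

Lemma integrable_EFinZ c (f : T -> R) : mu.-integrable D (EFin \o f) ->
  mu.-integrable D (EFin \o (fun x => c * f x)).
Proof. by move=> fi; exact: (integrableZl mD c fi). Qed.

(** Monotone convergence carries the uniform bound [C] over to the integral of the limit, which is
    therefore finite. *)
Lemma integrable_nondecreasing (g : nat -> T -> R) (f : T -> R) (C : R) :
  (forall n, measurable_fun D (g n)) -> (forall n x, D x -> 0 <= g n x) ->
  (forall n x, D x -> g n x <= g n.+1 x) ->
  (forall x, D x -> g n x @[n --> \oo] --> f x) ->
  (forall n, (\int[mu]_(x in D) (g n x)%:E <= C%:E)%E) ->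
  mu.-integrable D (EFin \o f).
Proof.
move=> mg g0 gS gf gC; pose h n x := (g n x)%:E.
have mh n : measurable_fun D (h n) by exact/measurable_EFinP.
have h0 n x : D x -> (0 <= h n x)%E by move=> Dx; rewrite lee_fin g0.
have ndh x : D x -> nondecreasing_seq (h ^~ x).
  by move=> Dx; apply/nondecreasing_seqP => n; rewrite lee_fin gS.
have hE x : D x -> limn (h ^~ x) = (f x)%:E.
  move=> Dx; apply: cvg_lim => //; apply: cvg_EFin; first exact: nearW.
  exact: gf.
have f0 x : D x -> 0 <= f x.
  move=> Dx; rewrite -(cvg_lim (@Rhausdorff R) (gf x Dx)); apply: limr_ge.
    by apply/cvg_ex; exists (f x); exact: gf.
  by apply: nearW => n; exact: g0.
have mf : measurable_fun D f by exact: measurable_fun_cvg mg gf.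
have mc := @monotone_convergence _ _ _ mu D mD h mh h0 ndh.
apply/integrableP; split; first exact/measurable_EFinP.
have -> : (\int[mu]_(x in D) `|(EFin \o f) x| = \int[mu]_(x in D) limn (h ^~ x))%E.
  by apply: eq_integral => x /set_mem Dx; rewrite hE//= ger0_norm// f0.
rewrite mc; apply: (@le_lt_trans _ _ C%:E); last exact: ltry.
apply: lime_le; last exact: nearW.
apply: ereal_nondecreasing_is_cvgn => m n mn.
by apply: ge0_le_integral => // x Dx; [exact: h0|exact: (ndh x Dx m n mn)].
Qed.

End integration.

(** * Improper integrals by exhaustion with compact intervals *)

Section improper_FTC.
Context (R : realType).
Local Notation mu := (@lebesgue_measure R).

(** The indicator keeps the domain [D] fixed, so that an exhaustion becomes a sequence of functions
    on [D] to which the convergence theorems apply. *)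
Lemma integral_itv_FTC (D : set R) (a b : R) (F f : R -> R) :
  a < b -> `[a, b] `<=` D -> {in D, continuous f} ->
  (forall x, D x -> is_derive x 1 F (f x)) ->
  (\int[mu]_(x in D) (f x * \1_(`[a, b]%classic) x)%:E = (F b - F a)%:E)%E.
Proof.
move=> ab abD cf dF.
have -> : (\int[mu]_(x in D) (f x * \1_(`[a, b]%classic) x)%:E =
           \int[mu]_(x in `[a, b]) (f x)%:E)%E.
  rewrite integral_mkcond [RHS]integral_mkcond; congr integral.
  apply/funext => x; rewrite /patch; case: ifPn => xD.
    by rewrite indicE; case: ifPn => _; rewrite ?mulr1 ?mulr0.
  case: ifPn => // xab; exfalso; move/negP: xD; apply.
  by move: xab; rewrite !inE; exact: abD.
have cF x : D x -> {for x, continuous F}.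
  move=> Dx; apply: differentiable_continuous; apply/derivable1_diffP.
  by case: (dF x Dx).
have inD x : x \in `]a, b[ -> D x.
  by move=> xab; apply: abD; rewrite /=; apply: subset_itv_oo_cc.
rewrite (@continuous_FTC2 _ f F)//.
- apply: continuous_in_subspaceT => x; rewrite inE => /abD Dx.
  by apply: cf; rewrite inE.
- have aD : D a by apply: abD; rewrite /= in_itv/= lexx ltW.
  have bD : D b by apply: abD; rewrite /= in_itv/= lexx ltW.
  split.
  + by move=> x /inD Dx; case: (dF x Dx).
  + by apply: cvg_at_right_filter; exact: cF.
  + by apply: cvg_at_left_filter; exact: cF.
- by move=> x /inD Dx; rewrite derive1E; have [_ ->] := dF x Dx.
Qed.

(* The fundamental theorem of calculus on an exhaustion of [D] by compact
   intervals, for a nonnegative integrand (which is then integrable) and for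
   an integrable one. *)
Lemma ge0_integrable_exhaustion (D : set R) (a b : nat -> R) (F f : R -> R) (C : R) :
  measurable D -> (forall n, a n < b n) ->
  (forall n, `[a n, b n] `<=` D) ->
  (forall n, `[a n, b n] `<=` `[a n.+1, b n.+1]) ->
  (forall x, D x -> \forall n \near \oo, x \in `[a n, b n]) ->
  {in D, continuous f} -> measurable_fun D f -> (forall x, D x -> 0 <= f x) ->
  (forall x, D x -> is_derive x 1 F (f x)) ->
  (forall n, F (b n) - F (a n) <= C) ->
  mu.-integrable D (EFin \o f).
Proof.
move=> mD ab abD nest Dab cf mf f0 dF FC.
apply: (@integrable_nondecreasing _ _ _ mu D mD (fun n x => f x * \1_(`[a n, b n]%classic) x) f C).
- by move=> n; apply: measurable_funM => //; exact: measurable_indic.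
- by move=> n x Dx; rewrite mulr_ge0// ?f0// indicE.
- move=> n x Dx; rewrite ler_wpM2l ?f0// !indicE.
  have [xn|_] := boolP (x \in _); last by rewrite ler0n.
  by rewrite (mem_set (nest n x (set_mem xn))).
- move=> x Dx; apply: cvg_near_cst; have := Dab x Dx.
  by apply: filterS => n xn; rewrite indicE mem_setE xn mulr1.
- by move=> n; rewrite (integral_itv_FTC (ab n) (abD n) cf dF) lee_fin.
Qed.

Lemma Rintegral_exhaustion (D : set R) (a b : nat -> R) (F f : R -> R) (l : R) :
  measurable D -> (forall n, a n < b n) ->
  (forall n, `[a n, b n] `<=` D) ->
  (forall x, D x -> \forall n \near \oo, x \in `[a n, b n]) ->
  {in D, continuous f} ->
  (forall x, D x -> is_derive x 1 F (f x)) ->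
  mu.-integrable D (EFin \o f) ->
  F (b n) - F (a n) @[n --> \oo] --> l ->
  Rintegral mu D f = l.
Proof.
move=> mD ab abD Dab cf dF intf Fl.
have key n : Rintegral mu D (fun x => f x * \1_(`[a n, b n]%classic) x) = F (b n) - F (a n).
  by rewrite /Rintegral (integral_itv_FTC (ab n) (abD n) cf dF).
have mf : measurable_fun D f by apply/measurable_EFinP; case/integrableP: intf.
have [||||_ H] := @dominated_convergence_Rintegral _ _ _ mu D mD
  (fun n x => f x * \1_(`[a n, b n]%classic) x) f (fun x => `|f x|).
- by move=> n; apply: measurable_funM => //; exact: measurable_indic.
- move=> x Dx; apply: cvg_near_cst; have := Dab x Dx.
  by apply: filterS => n xn; rewrite indicE mem_setE xn mulr1.
- exact: integrable_norm.
- move=> n x Dx; rewrite normrM indicE ler_piMr//.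
  by case: (_ \in _); rewrite ?normr1 ?normr0.
rewrite -(cvg_lim (@Rhausdorff R) Fl); apply: esym; apply: (cvg_lim (@Rhausdorff R)).
by move: H; under eq_fun do rewrite key.
Qed.

End improper_FTC.

(** * Bounded measurable functions and functionals vanishing on indicators *)

Section bounded_measurable.
Context d (T : measurableType d) (R : realType).
Implicit Types f g : T -> R.

Definition bmfun f := measurable_fun setT f /\ exists K : R, forall x, `|f x| <= K.

Lemma bmfun_cst (c : R) : bmfun (cst c).
Proof. by split; [exact: measurable_cst|exists `|c|]. Qed.

Lemma bmfunM f g : bmfun f -> bmfun g -> bmfun (fun x => f x * g x).
Proof.
move=> [mf [K fK]] [mg [L gL]]; split; first exact: measurable_funM.
by exists (K * L) => x; rewrite normrM ler_pM.
Qed.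

Lemma bmfunD f g : bmfun f -> bmfun g -> bmfun (fun x => f x + g x).
Proof.
move=> [mf [K fK]] [mg [L gL]]; split; first exact: measurable_funD.
by exists (K + L) => x; rewrite (le_trans (ler_normD _ _))// lerD.
Qed.

Lemma bmfunZ c f : bmfun f -> bmfun (fun x => c * f x).
Proof. by move=> bf; apply: bmfunM => //; exact: bmfun_cst. Qed.

Lemma bmfunB f g : bmfun f -> bmfun g -> bmfun (fun x => f x - g x).
Proof.
move=> bf bg; have := bmfunD bf (bmfunZ (-1) bg).
by under eq_fun do rewrite mulN1r.
Qed.

Lemma bmfun_indic (A : set T) : measurable A -> bmfun \1_A.
Proof.
move=> mA; split; first exact: measurable_indic.
by exists 1 => x; rewrite indicE; case: (_ \in _); rewrite ?normr1 ?normr0.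
Qed.

Lemma bmfun_prod (I : Type) (s : seq I) (p : pred I) (h : I -> T -> R) :
  (forall i, bmfun (h i)) -> bmfun (fun x => \prod_(i <- s | p i) h i x).
Proof.
move=> bh; elim: s => [|i s IH].
  by under eq_fun do rewrite big_nil; exact: bmfun_cst.
under eq_fun do rewrite big_cons.
by case: (p i) => //; exact: bmfunM.
Qed.

Lemma bmfun_integrable (P : probability T R) f :
  bmfun f -> P.-integrable setT (EFin \o f).
Proof.
move=> [mf [K fK]]; apply: (@integrable_dominated _ _ _ _ _ _ _ (cst K)) => //.
by apply: finite_measure_integrable_cst.
Qed.

Lemma Rintegral_probability_cst (P : probability T R) (c : R) :
  \int[P]_x (cst c) x = c.
Proof.
rewrite Rintegral_cst// [X in fine X](_ : _ = 1%E) ?mulr1//.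
exact: probability_setT.
Qed.

Lemma bmfun_Rintegral_le (P : probability T R) f (K : R) :
  measurable_fun setT f -> (forall x, `|f x| <= K) -> `|\int[P]_x f x| <= K.
Proof.
move=> mf fK; have ifP : P.-integrable setT (EFin \o f).
  by apply: bmfun_integrable; split => //; exists K.
apply: (le_trans (le_normr_Rintegral _ _)) => //.
have : \int[P]_x `|f x| <= \int[P]_x (cst K) x.
  apply: le_Rintegral => //; first exact: integrable_norm.
  exact: finite_measure_integrable_cst.
by rewrite Rintegral_probability_cst.
Qed.

(* Halving: [f = (\1_A + f') / 2] with [A = {f >= 1/2}] and [f'] again valued
   in [0, 1], so a bounded functional killing the indicators kills [f]. *)
Lemma bmfun_functional_eq0 (Phi : (T -> R) -> R) (C : R) :
  (forall a b f g, bmfun f -> bmfun g ->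
    Phi (fun x => a * f x + b * g x) = a * Phi f + b * Phi g) ->
  (forall f, bmfun f -> (forall x, 0 <= f x <= 1) -> `|Phi f| <= C) ->
  (forall A, measurable A -> Phi \1_A = 0) ->
  forall f, bmfun f -> Phi f = 0.
Proof.
move=> lin bnd ind.
have half n : forall f, bmfun f -> (forall x, 0 <= f x <= 1) ->
    `|Phi f| * 2 ^+ n <= C.
  elim: n => [|n IH] f bf f01; first by rewrite expr0 mulr1 bnd.
  pose A := f @^-1` `[2^-1, +oo[.
  have mA : measurable A by rewrite /A -[X in measurable X]setTI; apply: bf.1.
  pose f' := fun x => 2 * f x + (- 1) * \1_A x.
  have bf' : bmfun f'.
    by apply: bmfunD; apply: bmfunZ => //; exact: bmfun_indic.
  have f'01 x : 0 <= f' x <= 1.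
    rewrite /f' indicE; have := f01 x.
    have [|] := boolP (x \in A).
      by rewrite inE /A/= in_itv/= andbT => h /andP[? ?]; lra.
    move=> /negP; rewrite inE /A/= in_itv/= andbT => /negP.
    by rewrite -ltNge => h /andP[? ?]; lra.
  have := IH _ bf' f'01; rewrite /f' lin//; last exact: bmfun_indic.
  by rewrite ind// mulr0 addr0 normrM ger0_norm// exprS mulrA [_ * 2]mulrC.
have f010 f : bmfun f -> (forall x, 0 <= f x <= 1) -> Phi f = 0.
  move=> bf f01; apply/eqP; rewrite -normr_le0 leNgt; apply/negP => h.
  have : \forall n \near \oo, C < `|Phi f| * 2 ^+ n.
    near=> n; rewrite -ltr_pdivrMl//.
    have : C * `|Phi f|^-1 < n%:R.
      by near: n; exact: nbhs_infty_gtr.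
    move=> hn; rewrite mulrC (lt_le_trans hn)//.
    by rewrite -natrX ler_nat ltnW// ltn_expl.
  case=> n _ /(_ n (leqnn n)) /=; rewrite ltNge => /negP; apply.
  exact: half.
have fK f : bmfun f -> Phi f = 0.
  move=> bf; have [mf [K fK]] := bf.
  pose L := K + 1; have K0 (x : T) : 0 <= K by apply: (le_trans _ (fK x)).
  (* That [K] is nonnegative follows only from a point of [T]; on an empty [T], every function is
     the indicator of the empty set. *)
  have [[x0 _]|T0] := pselect (exists x : T, True); last first.
    have -> : f = \1_set0.
      by apply/funext => x; exfalso; apply: T0; exists x.
    exact: ind.
  have {}K0 : 0 <= K := K0 x0.
  (* An affine change of values brings [f] into [0, 1]; [L = K + 1] keeps the divisor nonzero when
     [K = 0]. *)
  pose g := fun x => (2 * L)^-1 * f x + 2^-1 * (cst 1 x).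
  have bg : bmfun g by apply: bmfunD; apply: bmfunZ => //; exact: bmfun_cst.
  have -> : f = fun x => (2 * L) * g x + (- L) * (\1_setT x).
    apply/funext => x; rewrite /g indicT/=; field.
    by rewrite /L gt_eqF//; lra.
  rewrite lin//; last exact: bmfun_indic.
  rewrite ind// mulr0 addr0 f010 ?mulr0// => x.
  rewrite /g /=.
  have L0 : 0 < 2 * L by rewrite /L; lra.
  have := fK x; rewrite ler_norml => /andP[h1 h2].
  have e : (2 * L)^-1 * f x + 2^-1 * 1 = (f x + L) / (2 * L).
    by field; rewrite /L gt_eqF//; lra.
  rewrite e divr_ge0//=; [|by rewrite /L; lra|by lra].
  by rewrite ler_pdivrMr// /L; lra.
by [].
Unshelve. all: by end_near. Qed.

End bounded_measurable.

(** * Central limit theorem for characteristic functions *)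

Lemma bmfun_cos (R : realType) : bmfun (@cos R).
Proof.
by split; [exact: (continuous_measurable_fun (@continuous_cos R))|exists 1 => w; exact: cos_max].
Qed.

Lemma bmfun_sin (R : realType) : bmfun (@sin R).
Proof.
by split; [exact: (continuous_measurable_fun (@continuous_sin R))|exists 1 => w; exact: sin_max].
Qed.

Section independence.
Context d (T : measurableType d) (R : realType) (P : probability T R).

Definition independent_upto (eta : nat -> T -> R) (n : nat) : Prop :=
  forall B : nat -> set R, (forall i, measurable (B i)) ->
  P (\bigcap_(i in `I_n) (eta i @^-1` B i)) =
  (\prod_(i < n) P (eta i @^-1` B i))%E.

Variables (eta : nat -> T -> R) (n : nat).
Hypothesis meta : forall i, measurable_fun setT (eta i).
Hypothesis ind : independent_upto eta n.

Lemma bmfun_comp (g : R -> R) i : bmfun g -> bmfun (g \o eta i).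
Proof.
by move=> [mg [K gK]]; split; [exact: measurableT_comp|exists K => x /=].
Qed.

(** Indicators are replaced by bounded functions one factor at a time. When the factors after [j]
    are indicators and those before [j] are arbitrary, the defect of the product formula is a
    bounded linear functional of the factor [j], and it vanishes on indicators by induction. *)
Lemma Rintegral_prod_independent (g : nat -> R -> R) :
  (forall i, bmfun (g i)) ->
  \int[P]_w (\prod_(i < n) g i (eta i w)) =
  \prod_(i < n) \int[P]_w g i (eta i w).
Proof.
move=> bg.
suff H j : (j <= n)%N -> forall g, (forall i, bmfun (g i)) ->
    (forall i, (j <= i < n)%N -> exists2 A, measurable A & g i = \1_A) ->
    \int[P]_w (\prod_(i < n) g i (eta i w)) =
    \prod_(i < n) \int[P]_w g i (eta i w).
  apply: (H n) => // i; rewrite ltnNge => /andP[->] //.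
elim: j => [|j IH] jn {bg}g bg gA.
  have [B] : exists B : nat -> set R, forall i, measurable (B i) /\
      ((i < n)%N -> g i = \1_(B i)).
    have /choice[B HB] : forall i, exists A, measurable A /\ ((i < n)%N -> g i = \1_A).
      move=> i; have [lin|] := boolP (i < n)%N.
        by have [A mA gi] := gA i lin; exists A.
      by exists setT.
    by exists B.
  move=> HB.
  have ei (i : 'I_n) : \int[P]_w g i (eta i w) = fine (P (eta i @^-1` B i)).
    rewrite (HB i).2// /Rintegral; congr fine.
    rewrite -(setIT (_ @^-1` _)) -integral_indic//.
      by rewrite -[X in measurable X]setTI; apply: meta => //; exact: (HB i).1.
  under [in RHS]eq_bigr do rewrite ei.
  have -> : (fun w => \prod_(i < n) g i (eta i w)) =
      \1_(\bigcap_(i in `I_n) (eta i @^-1` B i)).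
    apply/funext => w; rewrite indicE.
    have [/set_mem h|/negP h] := boolP (w \in _).
      rewrite big1// => i _; rewrite (HB i).2// indicE mem_set//.
      exact: (h i (ltn_ord i)).
    have : exists i : 'I_n, ~ B i (eta i w).
      apply: contrapT => h'; apply: h; rewrite inE => i /= iN.
      by apply: contrapT => nB; apply: h'; exists (Ordinal iN).
    move=> [i nB]; rewrite (bigD1 i)//= (HB i).2// indicE memNset// mul0r//.
  rewrite /Rintegral integral_indic//; last first.
    apply: bigcap_measurableType => // i _.
    by rewrite -[X in measurable X]setTI; apply: meta => //; exact: (HB i).1.
  rewrite setIT; apply: (etrans (congr1 fine (ind (fun i => (HB i).1)))).
  rewrite -[RHS]/(fine (\prod_(i < n) fine (P (eta i @^-1` B i)))%:E).
  congr fine; rewrite -prodEFin; apply: eq_bigr => i _.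
  rewrite fineK// fin_num_measure//.
  by rewrite -[X in measurable X]setTI; apply: meta => //; exact: (HB i).1.
pose jo : 'I_n := Ordinal jn.
pose H w := \prod_(i < n | i != jo) g i (eta i w).
pose c := \prod_(i < n | i != jo) \int[P]_w g i (eta i w).
have bH : bmfun H.
  by apply: bmfun_prod => i; exact: (bmfun_comp i (bg i)).
pose Phi h := \int[P]_w (h (eta j w) * H w) - (\int[P]_w h (eta j w)) * c.
suff: Phi (g j) = 0.
  move/eqP; rewrite subr_eq0 => /eqP; rewrite (bigD1 jo)//= => <-.
  by congr Rintegral; apply/funext => w; rewrite (bigD1 jo).
have ib h : bmfun h -> P.-integrable setT (EFin \o (fun w => h (eta j w))).
  by move=> bh; exact: (bmfun_integrable _ (bmfun_comp j bh)).
have ibH h : bmfun h -> P.-integrable setT (EFin \o (fun w => h (eta j w) * H w)).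
  move=> bh; apply: (@bmfun_integrable _ _ _ _ (fun w => h (eta j w) * H w)).
  by apply: bmfunM => //; exact: (bmfun_comp j bh).
have [mH [K HK]] := bH.
apply: (@bmfun_functional_eq0 _ _ _ Phi (K + `|c|)); last exact: bg.
- move=> a b f f' bf bf'; rewrite /Phi.
  have -> : (fun w => (a * f (eta j w) + b * f' (eta j w)) * H w) =
    (fun w => a * (f (eta j w) * H w) + b * (f' (eta j w) * H w)).
    by apply/funext => w; ring.
  have iZ r h : P.-integrable setT (EFin \o h) -> P.-integrable setT (EFin \o (fun w => r * h w)).
    by move=> ih; exact: (@integrableZl _ _ _ _ _ measurableT r _ ih).
  rewrite RintegralD//; [|exact: iZ (ibH _ bf)|exact: iZ (ibH _ bf')].
  rewrite RintegralD//; [|exact: iZ (ib _ bf)|exact: iZ (ib _ bf')].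
  rewrite !RintegralZl//; try exact: ib; try exact: ibH.
  ring.
- move=> f bf f01; rewrite /Phi (le_trans (ler_normB _ _))// lerD//.
    apply: bmfun_Rintegral_le.
      by apply: measurable_funM => //; exact: (bmfun_comp j bf).1.
    move=> w; rewrite normrM; have := f01 (eta j w) => /andP[f0 f1].
    by rewrite ger0_norm// (le_trans _ (HK w))// ler_piMl.
  rewrite normrM ler_piMl//; apply: bmfun_Rintegral_le.
    exact: (bmfun_comp j bf).1.
  by move=> w; have := f01 (eta j w) => /andP[f0 f1]; rewrite ger0_norm.
- move=> A mA; pose g' i := if i == j then \1_A else g i.
  have bg' i : bmfun (g' i).
    by rewrite /g'; case: ifP => // _; exact: bmfun_indic.
  have gA' i : (j <= i < n)%N -> exists2 A, measurable A & g' i = \1_A.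
    move=> /andP[ji iN]; rewrite /g'; have [_|ij] := eqVneq i j; first by exists A.
    by apply: gA; rewrite iN andbT ltn_neqAle eq_sym ij.
  have := IH (ltnW jn) g' bg' gA'.
  rewrite [in RHS](bigD1 jo)//= /g' eqxx => E.
  rewrite /Phi; apply/eqP; rewrite subr_eq0; apply/eqP.
  transitivity (\int[P]_w \prod_(i < n) (if i == j :> nat then \1_A else g i) (eta i w)).
    congr Rintegral; apply/funext => w; rewrite (bigD1 jo)//= eqxx; congr (_ * _).
    by apply: eq_bigr => i ij; rewrite ifN.
  rewrite E; congr (_ * _).
  by apply: eq_bigr => i ij; rewrite ifN.
Qed.

Let A j w : R := \sum_(i < j) eta i w.

Let bmfun_cosA j : bmfun (fun w => cos (A j w)).
Proof.
split; last by exists 1 => w; exact: cos_max.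
apply: measurableT_comp; first exact: (continuous_measurable_fun (@continuous_cos R)).
by apply: measurable_sum => i; exact: meta.
Qed.

Let bmfun_sinA j : bmfun (fun w => sin (A j w)).
Proof.
split; last by exists 1 => w; exact: sin_max.
apply: measurableT_comp; first exact: (continuous_measurable_fun (@continuous_sin R)).
by apply: measurable_sum => i; exact: meta.
Qed.

(** Taking the factors after [j] equal to 1 extracts the case of a single factor from the statement
    about tails. That statement enters as a hypothesis because the induction proving it already uses
    this extraction. *)
Let head_independent j : (j < n)%N ->
  (forall g : nat -> R -> R, (forall i, bmfun (g i)) ->
    \int[P]_w (cos (A j w) * \prod_(j <= i < n) g i (eta i w)) =
      (\int[P]_w cos (A j w)) * \prod_(j <= i < n) \int[P]_w g i (eta i w) /\
    \int[P]_w (sin (A j w) * \prod_(j <= i < n) g i (eta i w)) =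
      (\int[P]_w sin (A j w)) * \prod_(j <= i < n) \int[P]_w g i (eta i w)) ->
  forall h : R -> R, bmfun h ->
    \int[P]_w (cos (A j w) * h (eta j w)) =
      (\int[P]_w cos (A j w)) * \int[P]_w h (eta j w) /\
    \int[P]_w (sin (A j w) * h (eta j w)) =
      (\int[P]_w sin (A j w)) * \int[P]_w h (eta j w).
Proof.
move=> jn H h bh; pose g i := if i == j then h else cst 1.
have bg i : bmfun (g i) by rewrite /g; case: ifP => // _; exact: bmfun_cst.
have p1 w : \prod_(j <= i < n) g i (eta i w) = h (eta j w).
  rewrite big_ltn// /g eqxx big_nat_cond big1 ?mulr1// => i /andP[/andP[ji _] _].
  by rewrite gtn_eqF.
have p2 : \prod_(j <= i < n) \int[P]_w g i (eta i w) = \int[P]_w h (eta j w).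
  rewrite big_ltn// /g eqxx big_nat_cond big1 ?mulr1// => i /andP[/andP[ji _] _].
  by rewrite gtn_eqF// Rintegral_probability_cst.
have := H g bg; rewrite p2.
have E (f : _ -> R) : (fun w => f w * \prod_(j <= i < n) g i (eta i w)) =
   (fun w => f w * h (eta j w)) by apply/funext => w; rewrite p1.
by rewrite !E.
Qed.

(** The product formula concerns functions of single variables, and the cosine of a partial sum is
    not a product of such functions. The addition formulas split it into two of them at the price of
    introducing sines, so both functions go through the induction together. *)
Let tail_independent j (g : nat -> R -> R) : (j <= n)%N -> (forall i, bmfun (g i)) ->
  \int[P]_w (cos (A j w) * \prod_(j <= i < n) g i (eta i w)) =
    (\int[P]_w cos (A j w)) * \prod_(j <= i < n) \int[P]_w g i (eta i w) /\
  \int[P]_w (sin (A j w) * \prod_(j <= i < n) g i (eta i w)) =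
    (\int[P]_w sin (A j w)) * \prod_(j <= i < n) \int[P]_w g i (eta i w).
Proof.
have iP f : bmfun f -> P.-integrable setT (EFin \o f) by exact: bmfun_integrable.
have iPZ f r : bmfun f -> P.-integrable setT (EFin \o (fun w => f w * r)).
  by move=> bf; apply: iP; apply: bmfunM bf (bmfun_cst _ r).
have btail k (g' : nat -> R -> R) : (forall i, bmfun (g' i)) ->
    bmfun (fun w => \prod_(k <= i < n) g' i (eta i w)).
  by move=> bg'; apply: bmfun_prod => i; exact: bmfun_comp.
elim: j g => [|j IH] g jn bg.
  have A0 w : A 0 w = 0 by rewrite /A big_ord0.
  have -> : (fun w => cos (A 0 w)) = cst 1.
    by apply/funext => w; rewrite A0 cos0.
  have -> : (fun w => sin (A 0 w)) = cst 0.
    by apply/funext => w; rewrite A0 sin0.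
  have -> : (fun w => cos (A 0 w) * \prod_(0 <= i < n) g i (eta i w)) =
      (fun w => \prod_(i < n) g i (eta i w)).
    by apply/funext => w; rewrite A0 cos0 mul1r big_mkord.
  have -> : (fun w => sin (A 0 w) * \prod_(0 <= i < n) g i (eta i w)) = cst 0.
    by apply/funext => w; rewrite A0 sin0 mul0r.
  rewrite !big_mkord Rintegral_prod_independent//.
  by rewrite !Rintegral_probability_cst !mul0r !mul1r.
have slot h : bmfun h -> forall i, bmfun ((fun i => if i == j then h else g i) i).
  by move=> bh i /=; case: ifP.
have prodE (h : R -> R) (v : nat -> (R -> R) -> R) :
    \prod_(j <= i < n) v i (if i == j then h else g i) =
    v j h * \prod_(j.+1 <= i < n) v i (g i).
  rewrite big_ltn// eqxx; congr (_ * _); apply: eq_big_nat => i /andP[ji _].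
  by rewrite gtn_eqF.
(* A cosine or a sine is put in slot [j] of the tail, from where the addition formulas absorb it
   into the partial sum. *)
have [cc sc] := IH _ (ltnW jn) (slot _ (bmfun_cos R)).
have [cs ss] := IH _ (ltnW jn) (slot _ (bmfun_sin R)).
have pE h w := prodE h (fun i f => f (eta i w)).
have pI h := prodE h (fun i f => \int[P]_w f (eta i w)).
have intE (f h : _ -> R) : (fun w => f w * \prod_(j <= i < n) (if i == j then h else g i) (eta i w)) =
    (fun w => f w * h (eta j w) * \prod_(j.+1 <= i < n) g i (eta i w)).
  by apply/funext => w; rewrite pE mulrA.
move: cc sc cs ss; rewrite !intE !pI !mulrA => cc sc cs ss.
have ASE w : A j.+1 w = A j w + eta j w by rewrite /A big_ord_recr.
have bc := bmfun_comp j (bmfun_cos R); have bs := bmfun_comp j (bmfun_sin R).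
have base := head_independent jn (fun g => IH g (ltnW jn)).
have [bcc bsc] := base _ (bmfun_cos R); have [bcs bss] := base _ (bmfun_sin R).
have bcA := bmfun_cosA j; have bsA := bmfun_sinA j; have bt := btail j.+1 g bg.
have -> : (fun w => cos (A j.+1 w) * \prod_(j.+1 <= i < n) g i (eta i w)) = (fun w =>
   cos (A j w) * cos (eta j w) * \prod_(j.+1 <= i < n) g i (eta i w) -
   sin (A j w) * sin (eta j w) * \prod_(j.+1 <= i < n) g i (eta i w)).
  by apply/funext => w; rewrite ASE cosD mulrBl.
have -> : (fun w => sin (A j.+1 w) * \prod_(j.+1 <= i < n) g i (eta i w)) = (fun w =>
   sin (A j w) * cos (eta j w) * \prod_(j.+1 <= i < n) g i (eta i w) +
   cos (A j w) * sin (eta j w) * \prod_(j.+1 <= i < n) g i (eta i w)).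
  by apply/funext => w; rewrite ASE sinD mulrDl.
have -> : (fun w => cos (A j.+1 w)) = (fun w =>
   cos (A j w) * cos (eta j w) - sin (A j w) * sin (eta j w)).
  by apply/funext => w; rewrite ASE cosD.
have -> : (fun w => sin (A j.+1 w)) = (fun w =>
   sin (A j w) * cos (eta j w) + cos (A j w) * sin (eta j w)).
  by apply/funext => w; rewrite ASE sinD.
rewrite !RintegralB// ?RintegralD//; try (by apply: iP; do ?apply: bmfunM).
by rewrite cc ss sc cs bcc bss bsc bcs; split; ring.
Qed.

(** Real and imaginary parts of the multiplicativity of characteristic functions under independent
    sums. *)
Lemma cf_sum_recl j : (j < n)%N ->
  \int[P]_w cos (\sum_(i < j.+1) eta i w) =
    (\int[P]_w cos (\sum_(i < j) eta i w)) * (\int[P]_w cos (eta j w)) -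
    (\int[P]_w sin (\sum_(i < j) eta i w)) * (\int[P]_w sin (eta j w)) /\
  \int[P]_w sin (\sum_(i < j.+1) eta i w) =
    (\int[P]_w sin (\sum_(i < j) eta i w)) * (\int[P]_w cos (eta j w)) +
    (\int[P]_w cos (\sum_(i < j) eta i w)) * (\int[P]_w sin (eta j w)).
Proof.
move=> jn.
have iP f : bmfun f -> P.-integrable setT (EFin \o f) by exact: bmfun_integrable.
have base := head_independent jn (fun g => tail_independent (ltnW jn)).
have [bcc bsc] := base _ (bmfun_cos R); have [bcs bss] := base _ (bmfun_sin R).
have bc := bmfun_comp j (bmfun_cos R); have bs := bmfun_comp j (bmfun_sin R).
have bcA := bmfun_cosA j; have bsA := bmfun_sinA j.
have ASE w : \sum_(i < j.+1) eta i w = A j w + eta j w by rewrite /A big_ord_recr.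
have -> : (fun w => cos (\sum_(i < j.+1) eta i w)) = (fun w =>
   cos (A j w) * cos (eta j w) - sin (A j w) * sin (eta j w)).
  by apply/funext => w; rewrite ASE cosD.
have -> : (fun w => sin (\sum_(i < j.+1) eta i w)) = (fun w =>
   sin (A j w) * cos (eta j w) + cos (A j w) * sin (eta j w)).
  by apply/funext => w; rewrite ASE sinD.
rewrite RintegralB ?RintegralD//; try (by apply: iP; do ?apply: bmfunM).
by rewrite bcc bss bsc bcs.
Qed.

End independence.

(** * Taylor estimates for sine, cosine and exponential *)

Section calculus.
Context (R : realType).
Implicit Types (x y t h c : R).

(** The derivative is bounded only on the segment from [t] to [t + h], which is parametrized by
    [0, 1] so that [h] may have either sign. Iterating this bound gives the Taylor estimates, with
    constants that are not optimal. *)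
Lemma mvt_bound (F f : R -> R) t h c :
  (forall x, is_derive x 1 F (f x)) ->
  (forall s : R, 0 <= s <= 1 -> `|f (t + s * h)| <= c) ->
  `|F (t + h) - F t| <= c * `|h|.
Proof.
move=> dF fc.
have dG (s : R) : is_derive s 1 (fun s => F (t + s * h)) (f (t + s * h) * h).
  have d1 : is_derive s 1 (fun s => t + s * h) h.
    by apply: is_derive_eq; rewrite /GRing.scale/= !(mulr0, mulr1, add0r, addr0, mul1r).
  exact: (@is_derive1_comp _ F (fun s => t + s * h) s _ _ (dF _) d1).
have [s s01 e] : exists2 s, s \in `[(0:R), 1] &
    (fun s => F (t + s * h)) 1 - (fun s => F (t + s * h)) 0 = f (t + s * h) * h * (1 - 0).
  apply: (@MVT_segment R (fun s => F (t + s * h)) (fun s => f (t + s * h) * h)) => //.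
  apply: derivable_within_continuous => x _.
  by case: (dG x).
move: e; rewrite /= mul1r mul0r addr0 subr0 mulr1 => ->.
by rewrite normrM ler_wpM2r// fc// -in_itv.
Qed.

Lemma sin_bound x : `|sin x| <= `|x|.
Proof.
have := @mvt_bound (@sin R) (@cos R) 0 x 1 _ _.
by rewrite add0r sin0 subr0 mul1r; apply => s _; exact: cos_max.
Qed.

Lemma cosB1_bound x : `|cos x - 1| <= `|x|.
Proof.
have := @mvt_bound (@cos R) (fun y => - sin y) 0 x 1 _ _.
rewrite add0r cos0 mul1r; apply => s _; rewrite normrN; exact: sin_max.
Qed.

Let seg_norm s x : 0 <= s <= 1 -> `|s * x| <= `|x|.
Proof. by move=> /andP[s0 s1]; rewrite normrM ger0_norm// ler_piMl. Qed.

Lemma cosB1_bound2 x : `|cos x - 1| <= x ^+ 2.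
Proof.
have := @mvt_bound (@cos R) (fun y => - sin y) 0 x `|x| _ _.
rewrite add0r cos0 -expr2 real_normK ?num_real//; apply => s s01.
rewrite normrN add0r (le_trans (sin_bound _))// seg_norm//.
Qed.

Lemma is_derive_sinB x : is_derive x 1 (fun y => sin y - y) (cos x - 1).
Proof. by apply: is_derive_eq. Qed.

Lemma sinB_bound2 x : `|sin x - x| <= x ^+ 2.
Proof.
have := @mvt_bound (fun y => sin y - y) (fun y => cos y - 1) 0 x `|x| is_derive_sinB _.
rewrite add0r sin0 !subr0 -expr2 real_normK ?num_real//; apply => s s01.
by rewrite add0r (le_trans (cosB1_bound _))// seg_norm//.
Qed.

Lemma sinB_bound3 x : `|sin x - x| <= `|x| ^+ 3.
Proof.
have := @mvt_bound (fun y => sin y - y) (fun y => cos y - 1) 0 x (`|x| ^+ 2) is_derive_sinB _.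
rewrite add0r sin0 !subr0 -exprSr; apply => s s01.
rewrite add0r (le_trans (cosB1_bound2 _))// -[leLHS]real_normK ?num_real//.
by rewrite lerXn2r ?nnegrE// seg_norm//.
Qed.

Lemma cos_taylor3 x : `|cos x - 1 + x ^+ 2 / 2| <= `|x| ^+ 3.
Proof.
have d y : is_derive y 1 (fun y => cos y - 1 + y ^+ 2 / 2) (y - sin y).
  by apply: is_derive_eq; rewrite /GRing.scale/=; field.
have := @mvt_bound (fun y => cos y - 1 + y ^+ 2 / 2) (fun y => y - sin y) 0 x (`|x| ^+ 2) d _.
rewrite add0r cos0 subrr expr0n/= mul0r add0r subr0 -exprSr; apply => s s01.
rewrite add0r distrC (le_trans (sinB_bound2 _))// -[leLHS]real_normK ?num_real//.
by rewrite lerXn2r ?nnegrE// seg_norm//.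
Qed.

(** From [expR (- a) * (1 + a) <= 1], since [1 / (1 + a) - 1 + a = a ^+ 2 / (1 + a)]. *)
Lemma expRN_taylor2 (a : R) : 0 <= a -> `|expR (- a) - 1 + a| <= a ^+ 2.
Proof.
move=> a0; have h1 := expR_ge1Dx (- a).
rewrite ger0_norm; last lra.
have h2 := expR_ge1Dx a; have e0 := expR_gt0 (- a).
have h3 : expR (- a) * (1 + a) <= 1.
  have e1 : expR (- a) * expR a = 1 by rewrite -expRD addNr expR0.
  by rewrite -[leRHS]e1 ler_wpM2l// ltW.
rewrite -(ler_pM2r (_ : 0 < 1 + a)); last lra.
have : 0 <= a ^+ 3 by rewrite exprn_ge0.
by rewrite exprS expr2; nra.
Qed.

End calculus.

Lemma sqrtn_gt (R : realType) (M : R) : \forall n \near \oo, M < Num.sqrt n%:R.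
Proof.
near=> n.
have h : `|M| ^+ 2 < n%:R by near: n; exact: nbhs_infty_gtr.
rewrite (le_lt_trans (ler_norm M))// -[ltLHS]sqrtr_sqr ?normr_id//.
by rewrite real_normK ?num_real// in h; rewrite ltr_sqrt// (le_lt_trans _ h)// sqr_ge0.
Unshelve. all: by end_near. Qed.

Lemma rsqrtn_cvg0 (R : realType) : (Num.sqrt n%:R)^-1 @[n --> \oo] --> (0 : R).
Proof.
apply/cvgrPdist_lt => e e0; near=> n.
have h : e^-1 < Num.sqrt n%:R :> R by near: n; exact: sqrtn_gt.
rewrite sub0r normrN ger0_norm ?invr_ge0 ?sqrtr_ge0// -[ltRHS]invrK.
by rewrite ltf_pV2 ?posrE ?invr_gt0// (lt_trans _ h)// invr_gt0.
Unshelve. all: by end_near. Qed.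

Section central_limit.
Context d (T : measurableType d) (R : realType) (P : probability T R).
Variable X : nat -> T -> R.
Hypothesis mX : forall i, measurable_fun setT (X i).
Hypothesis indX : forall n, independent_upto P X n.
Hypothesis cosX : forall i t,
  \int[P]_w cos (t * X i w) = \int[P]_w cos (t * X 0%N w).
Hypothesis sinX : forall i t,
  \int[P]_w sin (t * X i w) = \int[P]_w sin (t * X 0%N w).
Hypothesis iX : P.-integrable setT (EFin \o X 0).
Hypothesis iX2 : P.-integrable setT (EFin \o (fun w => X 0 w ^+ 2)).
Hypothesis X_mean0 : \int[P]_w X 0 w = 0.

Let s2 := \int[P]_w (X 0 w ^+ 2).
Let rt (n : nat) : R := (Num.sqrt n%:R)^-1.

Let nrt2 n : (0 < n)%N -> n%:R * rt n ^+ 2 = 1.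
Proof.
by move=> n0; rewrite /rt exprVn sqr_sqrtr ?ler0n// mulfV// pnatr_eq0 -lt0n.
Qed.

Let rt_ge0 n : 0 <= rt n. Proof. by rewrite /rt invr_ge0 sqrtr_ge0. Qed.

Let nrt3 n x : (0 < n)%N -> n%:R * `|rt n * x| ^+ 3 = rt n * `|x| ^+ 3.
Proof.
move=> n0; rewrite normrM (ger0_norm (rt_ge0 n)).
by transitivity (n%:R * rt n ^+ 2 * (rt n * `|x| ^+ 3)); [ring|rewrite nrt2 ?mul1r].
Qed.

Let rt_cvg0 : rt n @[n --> \oo] --> 0.
Proof. exact: rsqrtn_cvg0. Qed.

Let cvg_rt_small c e : 0 < e -> \forall n \near \oo, rt n * c <= e.
Proof.
move=> e0; have : rt n * c @[n --> \oo] --> 0.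
  by rewrite -[X in _ --> X](mul0r c); apply: cvgMl.
by move=> /cvgr_le; exact.
Qed.

Let mcomp (f : R -> R) t i : continuous f -> measurable_fun setT (fun w => f (t * X i w)).
Proof.
move=> cf; apply: measurableT_comp; first exact: continuous_measurable_fun.
exact: measurable_funM.
Qed.

Let ntrig t i : P.-integrable setT (EFin \o (fun w => cos (t * X i w))) /\
  P.-integrable setT (EFin \o (fun w => sin (t * X i w))).
Proof.
split; apply: bmfun_integrable; split.
- exact: mcomp (@continuous_cos R).
- by exists 1 => w; exact: cos_max.
- exact: mcomp (@continuous_sin R).
- by exists 1 => w; exact: sin_max.
Qed.

(** The pointwise limit is read off the Taylor expansion of order three, while the cruder quadratic
    bound on the cosine makes [X 0 w ^+ 2] a dominating function for all [n] at once. *)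
Let cos_cvg : n%:R * (1 - \int[P]_w cos (rt n * X 0 w)) @[n --> \oo] --> s2 / 2.
Proof.
have [||||_] := @dominated_convergence_Rintegral _ T R P setT measurableT
  (fun n w => n%:R * (1 - cos (rt n * X 0 w))) (fun w => X 0 w ^+ 2 / 2)
  (fun w => X 0 w ^+ 2).
- move=> n; apply: measurable_funM => //; apply: measurable_funB => //.
  exact: mcomp (@continuous_cos R).
- move=> w _; apply/cvgrPdist_le => e e0; near=> n.
  have n0 : (0 < n)%N by near: n; exact: nbhs_infty_gt.
  have := cos_taylor3 (rt n * X 0 w).
  have -> : X 0 w ^+ 2 / 2 - n%:R * (1 - cos (rt n * X 0 w)) =
      n%:R * (cos (rt n * X 0 w) - 1 + (rt n * X 0 w) ^+ 2 / 2).
    by rewrite -[in LHS](mul1r (X 0 w ^+ 2)) -[in X in X * _](nrt2 n0); field.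
  move=> h; rewrite normrM ger0_norm// (le_trans (ler_wpM2l _ h))// nrt3//.
  near: n; exact: cvg_rt_small.
- exact: iX2.
- move=> n w _; rewrite normrM ger0_norm//.
  have [->|n0] := posnP n; first by rewrite mul0r sqr_ge0.
  have -> : X 0 w ^+ 2 = n%:R * (rt n * X 0 w) ^+ 2 by rewrite exprMn mulrA nrt2 ?mul1r.
  rewrite ler_wpM2l// distrC.
  exact: cosB1_bound2.
move=> h; have -> : s2 / 2 = \int[P]_w (X 0 w ^+ 2 / 2).
  by rewrite RintegralZr.
apply: cvg_trans h; apply: near_eq_cvg; apply: nearW => n.
have [ic _] := ntrig (rt n) 0.
have i1 : P.-integrable setT (EFin \o (fun w : T => 1 : R)).
  exact: bmfun_integrable (bmfun_cst _ 1).
rewrite RintegralZl//; last first.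
  exact: integrable_EFinB.
by rewrite RintegralB// Rintegral_probability_cst.
Unshelve. all: by end_near. Qed.

(** Subtracting [rt n * X 0 w], whose integral is 0, removes the first order term; the quadratic
    bound then dominates and the cubic one gives the limit. *)
Let sin_cvg : n%:R * \int[P]_w sin (rt n * X 0 w) @[n --> \oo] --> 0.
Proof.
have [||||_] := @dominated_convergence_Rintegral _ T R P setT measurableT
  (fun n w => n%:R * (sin (rt n * X 0 w) - rt n * X 0 w)) (fun w => 0)
  (fun w => X 0 w ^+ 2).
- move=> n; apply: measurable_funM => //; apply: measurable_funB => //.
    exact: mcomp (@continuous_sin R).
  exact: measurable_funM.
- move=> w _; apply/cvgrPdist_le => e e0; near=> n.
  have n0 : (0 < n)%N by near: n; exact: nbhs_infty_gt.
  have h := sinB_bound3 (rt n * X 0 w).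
  rewrite sub0r normrN normrM ger0_norm// (le_trans (ler_wpM2l _ h))// nrt3//.
  near: n; exact: cvg_rt_small.
- exact: iX2.
- move=> n w _; rewrite normrM ger0_norm//.
  have [->|n0] := posnP n; first by rewrite mul0r sqr_ge0.
  have -> : X 0 w ^+ 2 = n%:R * (rt n * X 0 w) ^+ 2 by rewrite exprMn mulrA nrt2 ?mul1r.
  rewrite ler_wpM2l//.
  exact: sinB_bound2.
rewrite Rintegral_probability_cst.
apply: cvg_trans; apply: near_eq_cvg; apply: nearW => n.
have [_ ic] := ntrig (rt n) 0.
have i1 : P.-integrable setT (EFin \o (fun w => rt n * X 0 w)).
  exact: integrable_EFinZ.
rewrite RintegralZl//; last first.
  exact: integrable_EFinB.
by rewrite RintegralB// RintegralZl// X_mean0 mulr0 subr0.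
Unshelve. all: by end_near. Qed.

(** Telescoping comparison of a product of [n] characteristic functions with [q ^+ n], where [q] is
    the [n]-th root of the Gaussian value: each factor of modulus at most 1 that is exchanged costs
    at most [dl]. *)
Let cfdist n : (0 < n)%N -> `|\int[P]_w cos (rt n * \sum_(i < n) X i w) - expR (- (s2 / 2))|
    <= n%:R * (`|\int[P]_w cos (rt n * X 0 w) - expR (- (s2 / 2 / n%:R))| +
       `|\int[P]_w sin (rt n * X 0 w)|) /\
  `|\int[P]_w sin (rt n * \sum_(i < n) X i w)|
    <= n%:R * (`|\int[P]_w cos (rt n * X 0 w) - expR (- (s2 / 2 / n%:R))| +
       `|\int[P]_w sin (rt n * X 0 w)|).
Proof.
move=> n0; pose eta i w := rt n * X i w.
have meta i : measurable_fun setT (eta i) by exact: measurable_funM.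
have inde : independent_upto P eta n.
  move=> B mB; apply: (@indX n (fun i => (fun x => rt n * x) @^-1` B i)) => i.
  by rewrite -[X in measurable X]setTI; exact: measurable_funM.
have s20 : 0 <= s2 by apply: Rintegral_ge0 => w _; exact: sqr_ge0.
pose q := expR (- (s2 / 2 / n%:R)).
have q0 : 0 <= q by exact: expR_ge0.
have q1 : q <= 1 by rewrite -expR0 ler_expR oppr_le0 !divr_ge0.
pose C := \int[P]_w cos (rt n * X 0 w); pose S := \int[P]_w sin (rt n * X 0 w).
pose dl := `|C - q| + `|S|.
have Aj j : measurable_fun setT (fun w => \sum_(i < j) eta i w) by exact: measurable_sum.
have cb j : `|\int[P]_w cos (\sum_(i < j) eta i w)| <= 1.
  apply: bmfun_Rintegral_le => [|w]; last exact: cos_max.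
  apply: measurableT_comp; last exact: Aj.
  exact: (continuous_measurable_fun (@continuous_cos R)).
have sb j : `|\int[P]_w sin (\sum_(i < j) eta i w)| <= 1.
  apply: bmfun_Rintegral_le => [|w]; last exact: sin_max.
  apply: measurableT_comp; last exact: Aj.
  exact: (continuous_measurable_fun (@continuous_sin R)).
have key j : (j <= n)%N ->
    `|\int[P]_w cos (\sum_(i < j) eta i w) - q ^+ j| <= j%:R * dl /\
    `|\int[P]_w sin (\sum_(i < j) eta i w)| <= j%:R * dl.
  elim: j => [|j IH] jn.
    have -> : (fun w => cos (\sum_(i < 0) eta i w)) = cst 1.
      by apply/funext => w; rewrite big_ord0 cos0.
    have -> : (fun w => sin (\sum_(i < 0) eta i w)) = cst 0.
      by apply/funext => w; rewrite big_ord0 sin0.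
    by rewrite !Rintegral_probability_cst expr0 subrr normr0 mul0r.
  have [-> ->] := cf_sum_recl meta inde jn.
  have -> : \int[P]_w cos (eta j w) = C by exact: cosX.
  have -> : \int[P]_w sin (eta j w) = S by exact: sinX.
  have [IHc IHs] := IH (ltnW jn); have := cb j; have := sb j.
  move: IHc IHs; set c := \int[P]_w cos _; set s := \int[P]_w sin _ => IHc IHs s1 c1.
  have cq : `|c * (C - q)| <= `|C - q| by rewrite normrM ler_piMl.
  have sS : `|s * S| <= `|S| by rewrite normrM ler_piMl.
  have sq : `|s * (C - q)| <= `|C - q| by rewrite normrM ler_piMl.
  have cS : `|c * S| <= `|S| by rewrite normrM ler_piMl.
  have qc : `|q * (c - q ^+ j)| <= j%:R * dl.
    by rewrite normrM (ger0_norm q0) (le_trans _ IHc)// ler_piMl.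
  have qs : `|q * s| <= j%:R * dl.
    by rewrite normrM (ger0_norm q0) (le_trans _ IHs)// ler_piMl.
  rewrite -natr1 mulrDl mul1r {2 4}/dl; split.
    have -> : c * C - s * S - q ^+ j.+1 = q * (c - q ^+ j) + (c * (C - q) - s * S).
      by rewrite exprS; ring.
    rewrite (le_trans (ler_normD _ _))// lerD//.
    by rewrite (le_trans (ler_normB _ _))// lerD.
  have -> : s * C + c * S = q * s + (s * (C - q) + c * S) by ring.
  rewrite (le_trans (ler_normD _ _))// lerD//.
  by rewrite (le_trans (ler_normD _ _))// lerD.
have [] := key n (leqnn n); rewrite -/C -/S -/q -/dl.
have E w : \sum_(i < n) eta i w = rt n * \sum_(i < n) X i w by rewrite mulr_sumr.
have -> : (fun w => cos (\sum_(i < n) eta i w)) = (fun w => cos (rt n * \sum_(i < n) X i w)).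
  by apply/funext => w; rewrite E.
have -> : (fun w => sin (\sum_(i < n) eta i w)) = (fun w => sin (rt n * \sum_(i < n) X i w)).
  by apply/funext => w; rewrite E.
rewrite /q -expRM_natl mulrN mulrCA mulfV ?mulr1//.
by rewrite pnatr_eq0 -lt0n.
Qed.

(** The sum of [n] exchange errors vanishes because the cosine integral and [q] have the same first
    order term [1 - s2 / (2 n)]. Identical distribution enters only through the characteristic
    functions of the summands. *)
Lemma central_limit_cf :
  \int[P]_w cos (rt n * \sum_(i < n) X i w) @[n --> \oo] --> expR (- (s2 / 2)) /\
  \int[P]_w sin (rt n * \sum_(i < n) X i w) @[n --> \oo] --> 0.
Proof.
have s20 : 0 <= s2 by apply: Rintegral_ge0 => w _; exact: sqr_ge0.
have small e : 0 < e -> \forall n \near \oo, (0 < n)%N /\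
    n%:R * (`|\int[P]_w cos (rt n * X 0 w) - expR (- (s2 / 2 / n%:R))| +
       `|\int[P]_w sin (rt n * X 0 w)|) <= e.
  move=> e0; have e3 : 0 < e / 3 by rewrite divr_gt0.
  near=> n; have n0 : (0 < n)%N by near: n; exact: nbhs_infty_gt.
  have nR : 0 < n%:R :> R by rewrite ltr0n.
  split => //.
  have h1 : `|s2 / 2 - n%:R * (1 - \int[P]_w cos (rt n * X 0 w))| <= e / 3.
    by near: n; move/cvgrPdist_le : cos_cvg => /(_ _ e3).
  have h2 : `|0 - n%:R * \int[P]_w sin (rt n * X 0 w)| <= e / 3.
    by near: n; move/cvgrPdist_le : sin_cvg => /(_ _ e3).
  have h3 : (s2 / 2) ^+ 2 / n%:R <= e / 3.
    rewrite ler_pdivrMr// [e / 3 * _]mulrC -ler_pdivrMr// ltW//.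
    by near: n; exact: nbhs_infty_gtr.
  rewrite sub0r normrN normrM (ger0_norm (ltW nR)) in h2.
  rewrite mulrDr; move: h1 h2; set C := \int[P]_w cos _; set S := \int[P]_w sin _ => h1 h2.
  pose a := s2 / 2 / n%:R.
  have a0 : 0 <= a by rewrite !divr_ge0.
  have h4 := expRN_taylor2 a0.
  (* Both quantities are compared with [1 - a]. *)
  have h5 : n%:R * `|C - expR (- a)| <= e / 3 + e / 3.
    have -> : n%:R * `|C - expR (- a)| =
        `|(s2 / 2 - n%:R * (1 - C)) - n%:R * (expR (- a) - 1 + a)|.
      rewrite -[X in X * _](ger0_norm (ltW nR)) -normrM; congr `|_|.
      by rewrite /a; field; rewrite gt_eqF.
    rewrite (le_trans (ler_normB _ _))// lerD// normrM (ger0_norm (ltW nR)).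
    rewrite (le_trans (ler_wpM2l (ltW nR) h4))// (le_trans _ h3)//.
    rewrite le_eqVlt; apply/orP; left; apply/eqP; rewrite /a; field.
    by rewrite gt_eqF.
  rewrite -/a; move: h2 h5; lra.
split; apply/cvgrPdist_le => e e0; near=> n.
- have [n0 h] : (0 < n)%N /\
    n%:R * (`|\int[P]_w cos (rt n * X 0 w) - expR (- (s2 / 2 / n%:R))| +
       `|\int[P]_w sin (rt n * X 0 w)|) <= e by near: n; exact: small.
  by rewrite distrC (le_trans (cfdist n0).1).
- have [n0 h] : (0 < n)%N /\
    n%:R * (`|\int[P]_w cos (rt n * X 0 w) - expR (- (s2 / 2 / n%:R))| +
       `|\int[P]_w sin (rt n * X 0 w)|) <= e by near: n; exact: small.
  by rewrite sub0r normrN (le_trans (cfdist n0).2).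
Unshelve. all: by end_near. Qed.

End central_limit.

(** * Weak law of large numbers *)

Section same_law.
Context d d' d'' (T : measurableType d) (T' : measurableType d') (U : measurableType d'').
Context (R : realType) (P : {measure set T -> \bar R}) (Q : {measure set T' -> \bar R}).
Variables (X : T -> U) (Y : T' -> U).
Hypotheses (mX : measurable_fun setT X) (mY : measurable_fun setT Y).
Hypothesis XY : forall B, measurable B -> P (X @^-1` B) = Q (Y @^-1` B).

Lemma ge0_integral_same_law (f : U -> \bar R) : measurable_fun setT f ->
  (forall x, 0 <= f x)%E ->
  (\int[P]_w f (X w) = \int[Q]_w f (Y w))%E.
Proof.
move=> mf f0.
have := @ge0_integral_pushforward _ _ _ _ _ X mX P setT f measurableT mf (fun x _ => f0 x).
rewrite preimage_setT /comp => <-.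
have := @ge0_integral_pushforward _ _ _ _ _ Y mY Q setT f measurableT mf (fun x _ => f0 x).
rewrite preimage_setT /comp => <-.
by apply: eq_measure_integral => A mA _; exact: XY.
Qed.

Lemma integrable_same_law (f : U -> R) : measurable_fun setT f ->
  Q.-integrable setT (EFin \o (f \o Y)) ->
  P.-integrable setT (EFin \o (f \o X)) /\
  Rintegral P setT (f \o X) = Rintegral Q setT (f \o Y).
Proof.
move=> mf iY; have [_ iYy] := integrableP _ _ _ iY.
have mfX : measurable_fun setT (f \o X) by exact: measurableT_comp.
have iX : P.-integrable setT (EFin \o (f \o X)).
  apply/integrableP; split; first exact/measurable_EFinP.
  rewrite (@ge0_integral_same_law (fun x => `|(f x)%:E|)%E)//.
  apply: measurableT_comp => //; exact/measurable_EFinP.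
split => //; rewrite /Rintegral; congr fine.
have mfE : measurable_fun setT (EFin \o f) by exact/measurable_EFinP.
have := @integral_pushforward _ _ _ _ _ X mX P setT (EFin \o f) mfE iX measurableT.
rewrite preimage_setT => <-.
have := @integral_pushforward _ _ _ _ _ Y mY Q setT (EFin \o f) mfE iY measurableT.
rewrite preimage_setT => <-.
by apply: eq_measure_integral => A mA _; exact: XY.
Qed.

End same_law.

Section law_of_large_numbers.
Context d (T : measurableType d) (R : realType) (P : probability T R).

Definition iid (X : nat -> T -> R) : Prop :=
  [/\ forall i, measurable_fun setT (X i),
      forall n, independent_upto P X n &
      forall i B, measurable B -> P (X i @^-1` B) = P (X 0 @^-1` B)].

Lemma iid_comp (X : nat -> T -> R) (f : R -> R) : measurable_fun setT f ->
  iid X -> iid (fun i w => f (X i w)).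
Proof.
move=> mf [mX indX lawX].
have mfB B : measurable B -> measurable (f @^-1` B).
  by move=> mB; rewrite -[X in measurable X]setTI; exact: mf.
split => [i|n B mB|i B mB].
- exact: measurableT_comp.
- by apply: (@indX n (fun i => f @^-1` B i)) => i; exact: mfB.
- by apply: (lawX i (f @^-1` B)); exact: mfB.
Qed.

Section iid.
Variable X : nat -> T -> R.
Hypothesis iidX : iid X.

Let mX i : measurable_fun setT (X i). Proof. by case: iidX. Qed.

Lemma iid_integrable (f : R -> R) i : measurable_fun setT f ->
  P.-integrable setT (EFin \o (fun w => f (X 0 w))) ->
  P.-integrable setT (EFin \o (fun w => f (X i w))) /\
  \int[P]_w f (X i w) = \int[P]_w f (X 0 w).
Proof.
move=> mf if0; case: iidX => _ _ lawX.
have := @integrable_same_law _ _ _ _ _ _ R P P (X i) (X 0) (mX i) (mX 0) (lawX i) f mf if0.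
by [].
Qed.

Lemma pairwise_Rintegral (f g : R -> R) i j : bmfun f -> bmfun g -> i != j ->
  \int[P]_w (f (X i w) * g (X j w)) =
  (\int[P]_w f (X i w)) * \int[P]_w g (X j w).
Proof.
move=> bf bg ij; pose h k := if k == i then f else if k == j then g else cst 1.
pose n := (maxn i j).+1.
have lin : (i < n)%N by rewrite ltnS leq_maxl.
have ljn : (j < n)%N by rewrite ltnS leq_maxr.
have bh k : bmfun (h k).
  by rewrite /h; case: ifP => // _; case: ifP => // _; exact: bmfun_cst.
have [_ indX _] := iidX.
have E (v : nat -> (R -> R) -> R) : (forall k, v k (cst 1) = 1) ->
    \prod_(k < n) v k (h k) = v i f * v j g.
  move=> v1; rewrite (bigD1 (Ordinal lin))//= (bigD1 (Ordinal ljn))/=; last first.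
    by rewrite -val_eqE/= eq_sym.
  rewrite /h eqxx [j == i]eq_sym (negbTE ij) eqxx big1 ?mulr1// => k /andP[k1 k2].
  by rewrite -!val_eqE/= in k1 k2; rewrite (negbTE k1) (negbTE k2).
have := Rintegral_prod_independent mX (indX n) bh.
rewrite (E (fun k f => \int[P]_w f (X k w))); last first.
  by move=> k; exact: Rintegral_probability_cst.
move=> <-; congr Rintegral; apply/funext => w.
by rewrite (E (fun k f => f (X k w))).
Qed.

Definition trunc (K : nat) (x : R) : R := x * \1_[set y : R | `|y| <= K%:R] x.

Lemma trunc_bmfun K : bmfun (trunc K).
Proof.
split.
  apply: measurable_funM => //; apply: measurable_indic.
  have -> : [set y : R | `|y| <= K%:R] = Num.norm @^-1` `]-oo, K%:R].
    by apply/seteqP; split => y /=; rewrite in_itv.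
  by rewrite -[X in measurable X]setTI; exact: normr_measurable.
exists K%:R => x; rewrite /trunc indicE.
have [|_] := boolP (x \in _); last by rewrite mulr0 normr0.
by rewrite inE/= mulr1.
Qed.

Lemma trunc_le K x : `|trunc K x| <= `|x|.
Proof.
rewrite /trunc normrM indicE ler_piMr//.
by case: (_ \in _); rewrite ?normr1 ?normr0.
Qed.

Lemma trunc_cvg x : trunc K x @[K --> \oo] --> x.
Proof.
apply: cvg_near_cst; near=> K; rewrite /trunc indicE mem_set ?mulr1//=.
by near: K; exact: nbhs_infty_ger.
Unshelve. all: by end_near. Qed.

Lemma trunc_Rintegral_cvg : P.-integrable setT (EFin \o X 0) ->
  \int[P]_w trunc K (X 0 w) @[K --> \oo] --> \int[P]_w X 0 w /\
  \int[P]_w `|X 0 w - trunc K (X 0 w)| @[K --> \oo] --> 0.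
Proof.
move=> iX.
have mt K : measurable_fun setT (fun w => trunc K (X 0 w)).
  exact: measurableT_comp (trunc_bmfun K).1 (mX 0).
split.
  apply: (proj2 (@dominated_convergence_Rintegral _ _ _ P setT measurableT
    (fun K w => trunc K (X 0 w)) (X 0) (fun w => `|X 0 w|) mt _ _ _)).
  - by move=> w _; exact: trunc_cvg.
  - exact: integrable_norm.
  - by move=> K w _; exact: trunc_le.
have := @dominated_convergence_Rintegral _ _ _ P setT measurableT
    (fun K w => `|X 0 w - trunc K (X 0 w)|) (fun w => 0) (fun w => 2 * `|X 0 w|).
case.
- move=> K; apply: measurableT_comp => //; exact: measurable_funB.
- move=> w _; rewrite -[X in _ --> X](@normr0 _ R) -(subrr (X 0 w)).
  by apply: cvg_norm; apply: cvgB; [exact: cvg_cst|exact: trunc_cvg].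
- by apply: integrable_EFinZ => //; exact: integrable_norm.
- move=> K w _; rewrite normr_id (le_trans (ler_normB _ _))//.
  by rewrite mulr_natl mulr2n lerD// trunc_le.
- by move=> _; rewrite Rintegral_probability_cst.
Qed.

Section square_integrable.
Hypothesis iX2 : P.-integrable setT (EFin \o (fun w => X 0 w ^+ 2)).
Hypothesis X_mean0 : \int[P]_w X 0 w = 0.

Lemma integrable_of_sqr (Y : T -> R) : measurable_fun setT Y ->
  P.-integrable setT (EFin \o (fun w => Y w ^+ 2)) ->
  P.-integrable setT (EFin \o Y).
Proof.
move=> mY iY2; apply: (@integrable_dominated _ _ _ P _ measurableT _ (fun w => 1 + Y w ^+ 2)) => //.
  apply: integrable_EFinD => //.
  exact: (bmfun_integrable P (bmfun_cst _ 1)).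
move=> w _; have : 0 <= (`|Y w| - 1) ^+ 2 by exact: sqr_ge0.
have -> : Y w ^+ 2 = `|Y w| ^+ 2 by rewrite real_normK// num_real.
by have : 0 <= `|Y w| by []; nra.
Qed.

Let iX : P.-integrable setT (EFin \o X 0).
Proof. exact: integrable_of_sqr. Qed.

Let sqr_int i : P.-integrable setT (EFin \o (fun w => X i w ^+ 2)) /\
  \int[P]_w X i w ^+ 2 = \int[P]_w X 0 w ^+ 2.
Proof. exact: (@iid_integrable (fun x => x ^+ 2)). Qed.

Let prod_int i j : P.-integrable setT (EFin \o (fun w => X i w * X j w)).
Proof.
apply: (@integrable_dominated _ _ _ P _ measurableT _ (fun w => X i w ^+ 2 + X j w ^+ 2)).
- exact: measurable_funM.
- by apply: integrable_EFinD => //; exact: (sqr_int _).1.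
- move=> w _; rewrite normrM.
  have : 0 <= (`|X i w| - `|X j w|) ^+ 2 by exact: sqr_ge0.
  rewrite -[X i w ^+ 2]real_normK ?num_real// -[X j w ^+ 2]real_normK ?num_real//.
  have : 0 <= `|X i w| by []. have : 0 <= `|X j w| by [].
  by nra.
Qed.

(** The product formula is available for bounded functions, so both variables are truncated at the
    same level, and the level is sent to infinity under the domination by [X i * X j]. *)
Lemma iid_uncorrelated i j : i != j -> \int[P]_w (X i w * X j w) = 0.
Proof.
move=> ij.
have c1 : \int[P]_w (trunc K (X i w) * trunc K (X j w)) @[K --> \oo] --> \int[P]_w (X i w * X j w).
  apply: (proj2 (@dominated_convergence_Rintegral _ _ _ P setT measurableT
    (fun K w => trunc K (X i w) * trunc K (X j w)) (fun w => X i w * X j w)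
    (fun w => `|X i w * X j w|) _ _ _ _)).
  - move=> K; apply: measurable_funM.
      exact: measurableT_comp (trunc_bmfun K).1 (mX i).
    exact: measurableT_comp (trunc_bmfun K).1 (mX j).
  - by move=> w _; apply: cvgM; exact: trunc_cvg.
  - exact: integrable_norm (prod_int i j).
  - by move=> K w _; rewrite normrM [leRHS]normrM ler_pM//; exact: trunc_le.
have c2 : \int[P]_w (trunc K (X i w) * trunc K (X j w)) @[K --> \oo] --> 0.
  have tE K k : \int[P]_w trunc K (X k w) = \int[P]_w trunc K (X 0 w).
    apply: (iid_integrable k (trunc_bmfun K).1 _).2.
    apply: bmfun_integrable; have [mt [c tc]] := trunc_bmfun K.
    by split; [exact: measurableT_comp mt (mX 0)|exists c => w].
  have E K : \int[P]_w (trunc K (X i w) * trunc K (X j w)) =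
      (\int[P]_w trunc K (X 0 w)) * \int[P]_w trunc K (X 0 w).
    by rewrite pairwise_Rintegral ?tE//; exact: trunc_bmfun.
  rewrite (_ : (fun K => _) = (fun K => (\int[P]_w trunc K (X 0 w)) * \int[P]_w trunc K (X 0 w))).
    have [h _] := trunc_Rintegral_cvg iX.
    rewrite (_ : 0 = (\int[P]_w X 0 w) * \int[P]_w X 0 w); last by rewrite X_mean0 mulr0.
    exact: cvgM.
  by apply/funext => K; exact: E.
rewrite -(cvg_lim (@Rhausdorff R) c2); apply: esym.
exact: (cvg_lim (@Rhausdorff R) c1).
Qed.

Lemma Rintegral_sqr_sum n :
  P.-integrable setT (EFin \o (fun w => (\sum_(i < n) X i w) ^+ 2)) /\
  \int[P]_w (\sum_(i < n) X i w) ^+ 2 = n%:R * \int[P]_w X 0 w ^+ 2.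
Proof.
elim: n => [|n [IH1 IH2]].
  have -> : (fun w => (\sum_(i < 0) X i w) ^+ 2) = cst 0.
    by apply/funext => w; rewrite big_ord0 expr0n.
  rewrite Rintegral_probability_cst mul0r; split => //.
  exact: (bmfun_integrable P (bmfun_cst _ 0)).
have -> : (fun w => (\sum_(i < n.+1) X i w) ^+ 2) = (fun w =>
    (\sum_(i < n) X i w) ^+ 2 + (2 * (\sum_(i < n) X i w * X n w) + X n w ^+ 2)).
  by apply/funext => w; rewrite big_ord_recr/= -mulr_suml; ring.
have [i1 e1] := @Rintegral_sum _ _ _ P setT measurableT _ (index_enum 'I_n) xpredT
  (fun i w => X i w * X n w) (fun i _ => prod_int i n).
have [i2 e2] := sqr_int n.
have i3 := integrable_EFinZ measurableT 2 i1.
have i4 := integrable_EFinD measurableT i3 i2.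
split; first exact: integrable_EFinD.
rewrite RintegralD// IH2 RintegralD// RintegralZl// e1 big1 ?mulr0 ?add0r ?e2.
  by rewrite -natr1 mulrDl mul1r.
by move=> i _; rewrite iid_uncorrelated// ltn_eqF.
Qed.

End square_integrable.
End iid.
End law_of_large_numbers.

Section weak_law.
Context d (T : measurableType d) (R : realType) (P : probability T R).

Lemma measurable_norm_gt (Z : T -> R) (a : R) : measurable_fun setT Z ->
  measurable [set w | a < `|Z w|].
Proof.
move=> mZ; have -> : [set w | a < `|Z w|] = (fun w => `|Z w|) @^-1` `]a, +oo[.
  by apply/seteqP; split => w; rewrite /= in_itv/= andbT.
by rewrite -[X in measurable X]setTI; apply: measurableT_comp.
Qed.

Lemma probability_finite_union (I : finType) (F : I -> set T) (e : R) :
  (forall i, measurable (F i)) -> (forall i, (P (F i) <= e%:E)%E) ->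
  measurable [set w | exists i, F i w] /\
  (P [set w | exists i, F i w] <= (#|I|%:R * e)%:E)%E.
Proof.
move=> mF PF; have -> : [set w | exists i, F i w] = \big[setU/set0]_(i <- enum I) F i.
  rewrite -bigcup_seq; apply/seteqP; split => w.
    by move=> [i Fi]; exists i => //=; rewrite mem_enum.
  by move=> [i _ Fi]; exists i.
split; first exact: bigsetU_measurable.
rewrite cardE; elim: (enum I) => [|i s IH].
  by rewrite big_nil measure0 mul0r.
have mU : measurable (\big[setU/set0]_(i <- s) F i) by exact: bigsetU_measurable.
rewrite big_cons (le_trans (measureU2 _ (mF i) mU))//.
rewrite -[size (i :: s)]/(size s).+1 -natr1 mulrDl mul1r [_ * e + e]addrC EFinD.
by apply: leeD; [exact: PF|exact: IH].
Qed.

Lemma markov_Rintegral (Z : T -> R) (a : R) : 0 < a ->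
  P.-integrable setT (EFin \o Z) ->
  (P [set w | (a < `|Z w|)%R] <= (a^-1 * \int[P]_w `|Z w|)%:E)%E.
Proof.
move=> a0 iZ; set A := [set w | _].
have mZ : measurable_fun setT Z by apply/measurable_EFinP; case/integrableP: iZ.
have mA : measurable A by exact: measurable_norm_gt.
have PA : P A = (\int[P]_w \1_A w)%:E.
  rewrite /Rintegral integral_indic// setIT fineK//.
  exact: fin_num_measure.
have iN := integrable_norm iZ.
rewrite PA lee_fin -RintegralZl//; apply: le_Rintegral => //.
- by apply: bmfun_integrable; exact: bmfun_indic.
- exact: integrable_EFinZ.
- move=> w _; rewrite indicE; have [|_] := boolP (w \in A).
    by rewrite inE /A/= => aZ; rewrite ler_pdivlMl// mulr1 ltW.
  by rewrite mulr_ge0// invr_ge0 ltW.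
Qed.

(** Khinchin's law in mean, under a first moment. The truncated and centred variables have a
    variance of order [1 / n] after averaging, and what truncation removes is small in mean
    uniformly in [n]. *)
Lemma weak_law_of_large_numbers (X : nat -> T -> R) : iid P X ->
  P.-integrable setT (EFin \o X 0) ->
  \int[P]_w `|n%:R^-1 * \sum_(i < n) X i w - \int[P]_w X 0 w|
    @[n --> \oo] --> 0.
Proof.
move=> iidX iX; set mu := \int[P]_w X 0 w.
have [mX _ _] := iidX.
have iXi i : P.-integrable setT (EFin \o X i) by exact: (iid_integrable iidX i (f := id) _ iX).1.
have i1 : P.-integrable setT (EFin \o (fun w : T => 1 : R)).
  exact: (bmfun_integrable P (bmfun_cst _ 1)).
have icst (c : R) : P.-integrable setT (EFin \o (fun w : T => c)).
  exact: (bmfun_integrable P (bmfun_cst _ c)).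
have isum (Z : nat -> T -> R) n : (forall i, P.-integrable setT (EFin \o Z i)) ->
    P.-integrable setT (EFin \o (fun w => \sum_(i < n) Z i w)).
  by move=> iZ; exact: (@Rintegral_sum _ _ _ P setT measurableT _ (index_enum 'I_n) xpredT (fun i => Z i) (fun i _ => iZ i)).1.
have [tc tn] := trunc_Rintegral_cvg iidX iX.
apply/cvgrPdist_le => e e0.
have e8 : 0 < e / 8 by rewrite divr_gt0.
have [K [K1 K2]] : exists K, `|mu - \int[P]_w trunc K (X 0 w)| <= e / 8 /\
    \int[P]_w `|X 0 w - trunc K (X 0 w)| <= e / 8.
  near \oo => K; exists K; split.
    by near: K; move/cvgrPdist_le : tc => /(_ _ e8).
  have : `|0 - \int[P]_w `|X 0 w - trunc K (X 0 w)| | <= e / 8.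
    by near: K; move/cvgrPdist_le : tn => /(_ _ e8).
  by rewrite sub0r normrN; apply: le_trans; exact: ler_norm.
pose t := \int[P]_w trunc K (X 0 w).
pose Y i w := trunc K (X i w) - t.
have [mt [C tC]] := trunc_bmfun R K.
have iidY : iid P Y.
  by apply: (@iid_comp _ _ _ P X (fun x => trunc K x - t)) => //; exact: measurable_funB.
have bY : bmfun (Y 0).
  apply: bmfunB; last exact: bmfun_cst.
  by split; [exact: measurableT_comp|exists C => w; exact: tC].
have iY2 : P.-integrable setT (EFin \o (fun w => Y 0 w ^+ 2)).
  by apply: bmfun_integrable; exact: bmfunM.
have btX : bmfun (fun w => trunc K (X 0 w)).
  by split; [exact: measurableT_comp|exists C => w; exact: tC].
have Y0 : \int[P]_w Y 0 w = 0.
  by rewrite /Y RintegralB// ?Rintegral_probability_cst ?subrr//; exact: bmfun_integrable.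
have vS n := Rintegral_sqr_sum iidY iY2 Y0 n.
set v := \int[P]_w Y 0 w ^+ 2 in vS.
near=> n; have n0 : (0 < n)%N by near: n; exact: nbhs_infty_gt.
have nR : 0 < n%:R :> R by rewrite ltr0n.
rewrite sub0r normrN ger0_norm; last by apply: Rintegral_ge0.
have iD i : P.-integrable setT (EFin \o (fun w => `|X i w - trunc K (X i w)|)) /\
   \int[P]_w `|X i w - trunc K (X i w)| = \int[P]_w `|X 0 w - trunc K (X 0 w)|.
  apply: (@iid_integrable _ _ _ _ _ iidX (fun x => `|x - trunc K x|)).
    by apply: measurableT_comp => //; exact: measurable_funB.
  apply: integrable_norm; apply: integrable_EFinB => //.
  exact: bmfun_integrable.
pose D w := n%:R^-1 * \sum_(i < n) `|X i w - trunc K (X i w)|.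
(* The inequality [z <= z ^+ 2 / c + c] with [c = e / 8] passes from second moments to first
   ones. *)
pose S w := (e / 8)^-1 * (n%:R^-1 ^+ 2 * (\sum_(i < n) Y i w) ^+ 2).
have iDD : P.-integrable setT (EFin \o D).
  by apply: integrable_EFinZ => //; apply: (isum (fun i w => `|X i w - trunc K (X i w)|)) => i; exact: (iD i).1.
have iS : P.-integrable setT (EFin \o S).
  by do 2 apply: integrable_EFinZ => //; exact: (vS n).1.
have bound w : `|n%:R^-1 * \sum_(i < n) X i w - mu| <= D w + S w + (e / 8 + e / 8).
  have -> : n%:R^-1 * \sum_(i < n) X i w - mu =
      n%:R^-1 * (\sum_(i < n) (X i w - trunc K (X i w))) +
      n%:R^-1 * (\sum_(i < n) Y i w) - (mu - t).
    rewrite /Y !sumrB sumr_const card_ord -[t *+ n]mulr_natl; field.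
    by rewrite gt_eqF.
  have a1 : `|n%:R^-1 * (\sum_(i < n) (X i w - trunc K (X i w)))| <= D w.
    rewrite normrM ger0_norm ?invr_ge0// ler_wpM2l ?invr_ge0//.
    exact: ler_norm_sum.
  have a2 : `|n%:R^-1 * (\sum_(i < n) Y i w)| <= S w + e / 8.
    rewrite /S -exprMn; set z := _ * _; rewrite -[z ^+ 2]real_normK ?num_real//.
    have z0 : 0 <= `|z| by [].
    rewrite -(ler_pM2l e8) mulrDr mulrA mulfV ?gt_eqF// mul1r.
    by move: e8 z0; set c := e / 8; move: (`|z|) => u c0 u0; nra.
  move: a1 a2; set x := _ * _; set y := _ * \sum_(i < n) Y i w => a1 a2.
  apply: (le_trans (ler_normB _ _)); have := ler_normD x y.
  by move: a1 a2 K1; rewrite -/t; lra.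
have i2 : P.-integrable setT (EFin \o (fun w => D w + S w)) by exact: integrable_EFinD.
have i3 : P.-integrable setT (EFin \o (fun w => D w + S w + (e / 8 + e / 8))).
  exact: integrable_EFinD.
have iM : P.-integrable setT (EFin \o (fun w => `|n%:R^-1 * \sum_(i < n) X i w - mu|)).
  apply: integrable_norm; apply: integrable_EFinB => //.
  by apply: integrable_EFinZ => //; exact: isum.
apply: (le_trans (le_Rintegral measurableT iM i3 (fun w _ => bound w))).
rewrite RintegralD// RintegralD// Rintegral_probability_cst.
have -> : \int[P]_w D w = \int[P]_w `|X 0 w - trunc K (X 0 w)|.
  rewrite /D RintegralZl//; last by apply: (isum (fun i w => `|X i w - trunc K (X i w)|)) => i; exact: (iD i).1.
  rewrite (@Rintegral_sum _ _ _ P setT measurableT _ (index_enum 'I_n) xpredT (fun i w => `|X i w - trunc K (X i w)|) (fun i _ => (iD i).1)).2.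
  rewrite (eq_bigr (fun=> \int[P]_w `|X 0 w - trunc K (X 0 w)|)) => [|i _]; last exact: (iD i).2.
  by rewrite sumr_const card_ord -[X in _ * X]mulr_natl mulrA mulVf ?mul1r ?gt_eqF.
have -> : \int[P]_w S w = (e / 8)^-1 * v / n%:R.
  rewrite /S RintegralZl//; last by apply: integrable_EFinZ => //; exact: (vS n).1.
  rewrite RintegralZl//; last exact: (vS n).1.
  by rewrite (vS n).2; field; rewrite !gt_eqF.
have h : (e / 8)^-1 * v / n%:R <= e / 8.
  rewrite ler_pdivrMr// [e / 8 * _]mulrC -ler_pdivrMr// ltW//.
  by near: n; exact: nbhs_infty_gtr.
have e2 (x : R) : 0 < x -> x / 8 + x / 8 + (x / 8 + x / 8) <= x by move=> x0; lra.
exact: (le_trans (lerD (lerD K2 h) (lexx _)) (e2 e e0)).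
Unshelve. all: by end_near. Qed.

End weak_law.

(** * Characteristic functions of normal laws *)

Section borel_vectors.
Context (R : realType) (k : nat).

(** The sigma-algebra is generated by all open sets, so this is a matter of second countability: an
    open set is the union of the countably many balls with rational centre and radius [1 / (n + 1)]
    that it contains. *)
Lemma measurable_borelV d (T : measurableType d) (f : T -> borelV R k) :
  (forall j, measurable_fun setT (fun w => (f w : 'cV[R]_k) j ord0)) ->
  measurable_fun setT f.
Proof.
move=> mf; apply: (@measurability _ _ _ _ setT f (@open 'cV[R]_k)) => //.
move=> _ [U oU <-]; rewrite setTI.
pose F (p : 'cV[rat]_k * nat) : set T :=
  if asbool (ball (map_mx ratr p.1 : 'cV[R]_k) p.2.+1%:R^-1 `<=` U) then
    \bigcap_(j in @setT 'I_k)
      [set w | `|ratr (p.1 j ord0) - (f w : 'cV[R]_k) j ord0| < p.2.+1%:R^-1]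
  else set0.
have -> : f @^-1` U = \bigcup_p F p.
  apply/seteqP; split => w.
    move=> /= Ufw; have := open_nbhs_nbhs (conj oU Ufw).
    move=> /nbhs_ballP[e /= e0 eU].
    near \oo => n.
    (* The ball around a rational centre that lies within its radius of [f w] is contained in the
       ball of twice that radius around [f w]. *)
    have ne : 2 * n.+1%:R^-1 < e.
      rewrite ltr_pdivrMr// -ltr_pdivrMl// mulrC.
      rewrite (@lt_trans _ _ n%:R)//; last by rewrite ltr_nat.
      by near: n; exact: nbhs_infty_gtr.
    have n0 : 0 < n.+1%:R^-1 :> R by rewrite invr_gt0.
    have yn (y : R) : y - n.+1%:R^-1 < y + n.+1%:R^-1 by move: n0; set c := _^-1; move=> n0; lra.
    have /choice[q qP] : forall j, exists q : rat,
        `|ratr q - (f w : 'cV[R]_k) j ord0| < n.+1%:R^-1.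
      move=> j; set y := (f w : 'cV[R]_k) j ord0.
      have [q] := @rat_in_itvoo R (y - n.+1%:R^-1) (y + n.+1%:R^-1) (yn y).
      by rewrite in_itv/= => /andP[q1 q2]; exists q; rewrite ltr_norml ltrBrDl q1 ltrBlDr addrC q2.
    exists (\col_j q j, n) => //; rewrite /F; case: asboolP => [_|] /=.
      by move=> j _ /=; rewrite mxE; exact: qP.
    case => v [_ qv]; apply: eU; split => // i j.
    have := qv i j; have := qP i; rewrite !mxE !ord1 /ball/= => h1 h2.
    rewrite -[_ - _](subrKA (ratr (q i))) (le_lt_trans (ler_normD _ _))//.
    rewrite (lt_trans _ ne)// mulr_natl mulr2n ltrD// distrC//.
  move=> [[q n] _]; rewrite /F; case: asboolP => //= qU h; apply: qU.
  split; first by rewrite invr_gt0.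
  by move=> i j; rewrite !mxE !ord1; exact: h.
apply: countable_bigcupT_measurable => // -[q n]; rewrite /F; case: asboolP => // _.
apply: fin_bigcap_measurable => // j _.
have -> : [set w | `|ratr (q j ord0) - (f w : 'cV[R]_k) j ord0| < n.+1%:R^-1] =
   (fun w => `|ratr (q j ord0) - (f w : 'cV[R]_k) j ord0|) @^-1` `]-oo, n.+1%:R^-1[.
  by apply/seteqP; split => w /=; rewrite in_itv.
rewrite -[X in measurable X]setTI; apply: measurableT_comp => //.
exact: measurable_funB.
Unshelve. all: by end_near. Qed.

Lemma continuous_measurable_borelV (f : 'cV[R]_k -> R) :
  continuous f -> measurable_fun (setT : set (borelV R k)) f.
Proof.
move=> /continuousP cf; apply: (measurability _ (RGenOpens.measurableE R)).
move=> _ [_ [a [b ->] <-]]; rewrite setTI; apply: sub_sigma_algebra.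
exact/cf/interval_open.
Qed.

Lemma measurable_coord (j : 'I_k) :
  measurable_fun (setT : set (borelV R k)) (fun v : 'cV[R]_k => v j ord0).
Proof. by apply: continuous_measurable_borelV; exact: coord_continuous. Qed.

Lemma dotvE (b v : 'cV[R]_k) : dotv b v = \sum_(j < k) b j ord0 * v j ord0.
Proof. by rewrite /dotv mxE; apply: eq_bigr => j _; rewrite mxE. Qed.

Lemma continuous_dotv (b : 'cV[R]_k) : continuous (dotv b).
Proof.
have -> : dotv b = fun v : 'cV[R]_k => \sum_(j < k) b j ord0 * v j ord0.
  by apply/funext => v; exact: dotvE.
apply: continuous_big => [|j _ v]; first exact: add_continuous.
apply: (@continuousM _ _ (cst (b j ord0)) (fun v : 'cV[R]_k => v j ord0)).
  exact: cst_continuous.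
exact: coord_continuous.
Qed.

Lemma measurable_dotv (b : 'cV[R]_k) : measurable_fun (setT : set (borelV R k)) (dotv b).
Proof. by apply: continuous_measurable_borelV; exact: continuous_dotv. Qed.

End borel_vectors.

Lemma measurable_mulmx (R : realType) k l (C : 'M[R]_(l, k)) (c : 'cV[R]_l) :
  measurable_fun (setT : set (borelV R k)) ((fun z : 'cV[R]_k => c + C *m z) : borelV R k -> borelV R l).
Proof.
apply: measurable_borelV => i.
have -> : (fun z : borelV R k => ((c + C *m z) : 'cV[R]_l) i ord0) =
    fun z : borelV R k => c i ord0 + \sum_j C i j * (z : 'cV[R]_k) j ord0.
  by apply/funext => z; rewrite !mxE.
apply: measurable_funD => //; apply: measurable_sum => j.
by apply: measurable_funM => //; exact: measurable_coord.
Qed.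

Lemma le_1Dsqr2 (R : realFieldType) (y : R) : y <= 1 + y ^+ 2 / 2.
Proof.
have : 0 <= (y - 1) ^+ 2 by exact: sqr_ge0.
rewrite sqrrB1; lra.
Qed.

Section normal_cf.
Context (R : realType).
Local Notation mu := (@lebesgue_measure R).
Local Notation N := (@normal_prob R 0 1).
Local Notation pdf := (@normal_pdf R 0 1).

Lemma normal_pdf01E (x : R) : pdf x = normal_peak 1 * expR (- x ^+ 2 / 2).
Proof.
by rewrite /normal_pdf oner_eq0/= /normal_fun subr0 expr1n mulr2n.
Qed.

Lemma is_derive_normal_pdf (x : R) : is_derive x 1 pdf (- x * pdf x).
Proof.
have -> : pdf = fun x => normal_peak 1 * expR (- x ^+ 2 / 2).
  by apply/funext => y; exact: normal_pdf01E.
apply: is_derive_eq; rewrite /GRing.scale/=.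
by field.
Qed.

(** Of the exponent [x ^ 2 / 2], the part [3 x ^ 2 / 8] absorbs the factor [x], and the remaining
    [x ^ 2 / 8] is the exponent of the normal density with standard deviation 2. *)
Lemma integrable_id_normal_pdf : mu.-integrable setT (EFin \o (fun x => x * pdf x)).
Proof.
apply: (@integrable_dominated _ _ _ mu _ measurableT _
  (fun x => 2 * (normal_peak 1 / normal_peak 2) * normal_pdf 0 2 x)).
- by apply: measurable_funM => //; exact: measurable_normal_pdf.
- apply: integrable_EFinZ => //; exact: integrable_normal_pdf.
- move=> x _; have p1 := @normal_peak_ge0 R 1.
  have p2 : 0 < @normal_peak R 2 by rewrite normal_peak_gt0.
  rewrite normal_pdf01E /normal_pdf pnatr_eq0/= /normal_fun subr0.
  have -> : 2 * (normal_peak 1 / normal_peak 2) * (normal_peak 2 * expR (- x ^+ 2 / (2 ^+ 2 *+ 2))) =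
     normal_peak 1 * (2 * expR (- x ^+ 2 / (2 ^+ 2 *+ 2))).
    by field; rewrite gt_eqF.
  rewrite normrM normrM (ger0_norm p1) (ger0_norm (expR_ge0 _)) mulrCA ler_wpM2l//.
  have -> : - x ^+ 2 / 2 = - x ^+ 2 / (2 ^+ 2 *+ 2) - 3 * x ^+ 2 / 8 by field.
  rewrite expRD mulrCA [leRHS]mulrC ler_wpM2l ?expR_ge0//.
  rewrite expRN ler_pdivrMr ?expR_gt0//.
  have := expR_ge1Dx (3 * x ^+ 2 / 8); rewrite -[x ^+ 2]real_normK ?num_real//.
  have : 0 <= `|x| by []; move: (`|x|) => y; nra.
Qed.

(** The difference of the two sides is a bounded linear functional of [f], and on indicators it
    vanishes by the definition of [normal_prob]. *)
Lemma Rintegral_normal_prob (f : R -> R) : bmfun f ->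
  \int[N]_x f x = \int[mu]_x (f x * pdf x).
Proof.
have mpdf : measurable_fun setT pdf by exact: measurable_normal_pdf.
have ipdf : mu.-integrable setT (EFin \o pdf) by exact: integrable_normal_pdf.
have ib h : bmfun h -> mu.-integrable setT (EFin \o (fun x => h x * pdf x)).
  move=> [mh [K hK]]; apply: (@integrable_dominated _ _ _ mu _ measurableT _ (fun x => K * pdf x)).
  - exact: measurable_funM.
  - exact: integrable_EFinZ.
  - by move=> x _; rewrite normrM (ger0_norm (normal_pdf_ge0 _ _ _)) ler_wpM2r// normal_pdf_ge0.
have iN h : bmfun h -> N.-integrable setT (EFin \o h) by exact: bmfun_integrable.
have intpdf : \int[mu]_x pdf x = 1 by rewrite /Rintegral integral_normal_pdf.
move=> bf; apply/eqP; rewrite -subr_eq0; apply/eqP.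
pose Phi h := \int[N]_x h x - \int[mu]_x (h x * pdf x).
apply: (@bmfun_functional_eq0 _ _ R Phi (1 + 1) _ _ _ f bf) => {f bf}.
- move=> a b f g bf bg; rewrite /Phi.
  have -> : (fun x => (a * f x + b * g x) * pdf x) =
      (fun x => a * (f x * pdf x) + b * (g x * pdf x)).
    by apply/funext => x; ring.
  rewrite RintegralD//; [|exact: integrable_EFinZ (iN _ bf)|exact: integrable_EFinZ (iN _ bg)].
  rewrite RintegralD//; [|exact: integrable_EFinZ (ib _ bf)|exact: integrable_EFinZ (ib _ bg)].
  rewrite !RintegralZl//; try exact: ib; try exact: iN.
  ring.
- move=> f bf f01; rewrite /Phi.
  have h1 : `|\int[N]_x f x| <= 1.
    apply: bmfun_Rintegral_le; first exact: bf.1.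
    by move=> x; have /andP[f0 f1] := f01 x; rewrite ger0_norm.
  have h2 : `|\int[mu]_x (f x * pdf x)| <= 1.
    rewrite (le_trans (le_normr_Rintegral _ (ib _ bf)))// -[leRHS]intpdf.
    apply: le_Rintegral => //; first exact: (integrable_norm (ib _ bf)).
    move=> x _; have /andP[f0 f1] := f01 x.
    by rewrite normrM (ger0_norm (normal_pdf_ge0 _ _ _)) ger0_norm// ler_piMl// normal_pdf_ge0.
  by rewrite (le_trans (ler_normB _ _))// lerD.
- move=> A mA; rewrite /Phi; apply/eqP; rewrite subr_eq0; apply/eqP.
  have -> : (fun x => \1_A x * pdf x) = pdf \_ A.
    apply/funext => x; rewrite indicE patchE.
    by case: (x \in A); rewrite ?mul1r ?mul0r.
  rewrite -Rintegral_mkcond /Rintegral; congr fine.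
  by rewrite integral_indic// setIT.
Qed.

(** The phase [c] treats both halves of the characteristic function at once: [c = 0] gives the
    cosine and [c = - (pi / 2)] the sine. *)
Let cs t c (y : R) := cos (t * y + c).
Let sn t c (y : R) := sin (t * y + c).

Let ccs t c : continuous (cs t c).
Proof.
move=> y; apply: continuous_comp; last exact: continuous_cos.
by apply: cvgD; [apply: cvgM; [exact: cvg_cst|exact: cvg_id]|exact: cvg_cst].
Qed.

Let csn t c : continuous (sn t c).
Proof.
move=> y; apply: continuous_comp; last exact: continuous_sin.
by apply: cvgD; [apply: cvgM; [exact: cvg_cst|exact: cvg_id]|exact: cvg_cst].
Qed.

Let int_bounded (f g : R -> R) : measurable_fun setT f -> (forall y, `|f y| <= 1) ->
  mu.-integrable setT (EFin \o g) -> mu.-integrable setT (EFin \o (fun y => f y * g y)).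
Proof.
move=> mf f1 ig; apply: (@integrable_dominated _ _ _ mu _ measurableT _ (fun y => `|g y|)).
- by apply: measurable_funM => //; apply/measurable_EFinP; case/integrableP: ig.
- exact: integrable_norm.
- by move=> y _; rewrite normrM ler_piMl.
Qed.

Let ipdf : mu.-integrable setT (EFin \o pdf).
Proof. exact: integrable_normal_pdf. Qed.

Let pdf_cvg0 (f : R -> R) (a : nat -> R) : (forall x, `|f x| <= 1) ->
  (forall n, `|a n| = n.+1%:R) -> f (a n) * pdf (a n) @[n --> \oo] --> 0.
Proof.
move=> f1 an; apply/cvgrPdist_le => e e0; near=> n.
have p0 : 0 <= @normal_peak R 1 by exact: normal_peak_ge0.
rewrite sub0r normrN normrM (ger0_norm (normal_pdf_ge0 _ _ _)).
rewrite (le_trans (ler_wpM2r (normal_pdf_ge0 _ _ _) (f1 _)))// mul1r.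
rewrite normal_pdf01E -[_ ^+ 2]real_normK ?num_real// an mulNr expRN.
have n1 : 0 < n.+1%:R :> R by rewrite ltr0n.
rewrite ler_pdivrMr ?expR_gt0// -ler_pdivrMl//.
have h : e^-1 * normal_peak 1 <= n.+1%:R.
  rewrite (@le_trans _ _ n%:R) ?ler_nat// ltW//.
  by near: n; exact: nbhs_infty_gtr.
rewrite (le_trans h)//; have := expR_ge1Dx (n.+1%:R ^+ 2 / 2 : R).
apply: le_trans.
exact: le_1Dsqr2.
Unshelve. all: by end_near. Qed.

(** Integration by parts: [- y * pdf y] is the derivative of the density, and the boundary terms at
    [- (n + 1)] and [n + 1] tend to 0. *)
Let cospdf_ibp t c :
  \int[mu]_y (sn t c y * (y * pdf y)) = t * \int[mu]_y (cs t c y * pdf y).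
Proof.
have i1 : mu.-integrable setT (EFin \o (fun y => sn t c y * (y * pdf y))).
  apply: int_bounded; last exact: integrable_id_normal_pdf.
    exact: continuous_measurable_fun.
  by move=> y; exact: sin_max.
have i2 : mu.-integrable setT (EFin \o (fun y => cs t c y * pdf y)).
  apply: int_bounded => //; first exact: continuous_measurable_fun.
  by move=> y; exact: cos_max.
apply/eqP; rewrite -subr_eq0; apply/eqP.
rewrite -RintegralZl// -RintegralB//; last exact: integrable_EFinZ.
have dsn (y : R) : is_derive y 1 (sn t c) (cs t c y * t).
  have d1 : is_derive y 1 (fun y => t * y + c) t.
    by apply: is_derive_eq; rewrite /GRing.scale/=; ring.
  exact: (@is_derive1_comp _ (@sin R) (fun y => t * y + c) y _ _ _ d1).
apply: (@Rintegral_exhaustion _ setT (fun n => - n.+1%:R) (fun n => n.+1%:R)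
   (fun y => - (sn t c y * pdf y))) => //.
- by move=> n; rewrite -subr_gt0 opprK addr_gt0.
- move=> y _; near=> n; rewrite in_itv/= -ler_norml.
  by rewrite (@le_trans _ _ n%:R) ?ler_nat//; near: n; exact: nbhs_infty_ger.
- move=> y _; apply: cvgB; apply: cvgM; (try exact: ccs); (try exact: csn).
  + by apply: cvgM; [exact: cvg_id|exact: continuous_normal_pdf].
  + exact: cvg_cst.
  + by apply: cvgM; [exact: ccs|exact: continuous_normal_pdf].
- move=> y _; have := is_derive_normal_pdf y; have := dsn y => d1 d2.
  by apply: is_derive_eq; rewrite /GRing.scale/=; ring.
- by apply: integrable_EFinB => //; exact: integrable_EFinZ.
- rewrite -[X in _ --> X](subrr (0 : R)); apply: cvgB.
    rewrite -[X in _ --> X]oppr0; apply: cvgN; apply: pdf_cvg0 => [x|n].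
      exact: sin_max.
    by rewrite ger0_norm.
  rewrite -[X in _ --> X]oppr0; apply: cvgN; apply: pdf_cvg0 => [x|n].
    exact: sin_max.
  by rewrite normrN ger0_norm.
Unshelve. all: by end_near. Qed.

(* Integration by parts gives [phi' = - t phi] for the characteristic function
   [phi], hence [phi t * expR (t ^+ 2 / 2)] is constant. *)
Let phase_cf t c : \int[mu]_y (cs t c y * pdf y) = cos c * expR (- t ^+ 2 / 2).
Proof.
pose phi t := \int[mu]_y (cs t c y * pdf y).
have iphi t' : mu.-integrable setT (EFin \o (fun y => cs t' c y * pdf y)).
  apply: int_bounded => //; first exact: continuous_measurable_fun.
  by move=> y; exact: cos_max.
have dphi (t0 : R) : is_derive t0 1 phi (- t0 * phi t0).
  have d1 (x y : R) : is_derive x 1 (fun x => cs x c y * pdf y) (- sn x c y * (y * pdf y)).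
    have d1 : is_derive x 1 (fun x => x * y + c) y.
      by apply: is_derive_eq; rewrite /GRing.scale/=; ring.
    have d2 := @is_derive1_comp _ (@cos R) (fun x => x * y + c) x _ _ _ d1.
    have d3 : is_derive x 1 (fun x => cs x c y) (- sn x c y * y) by exact: d2.
    by apply: is_derive_eq; rewrite /GRing.scale/=; ring.
  have pE x y : partial1of2 (fun x y => cs x c y * pdf y) x y = - sn x c y * (y * pdf y).
    by rewrite partial1of2E; case: (d1 x y).
  have tI : `]t0 - 1, t0 + 1[%classic t0 by rewrite /= in_itv/=; apply/andP; split; lra.
  have iG : mu.-integrable setT (EFin \o (fun y => `|y * pdf y|)).
    exact: integrable_norm integrable_id_normal_pdf.
  have bG x y : `|partial1of2 (fun x y => cs x c y * pdf y) x y| <= `|y * pdf y|.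
    by rewrite pE normrM normrN ler_piMl// sin_max.
  have dd := @derivable_under_integral R _ _ mu (fun x y => cs x c y * pdf y) setT
    measurableT t0 _ _ tI (fun x _ => iphi x) (fun x y _ _ => @ex_derive _ _ _ _ _ _ _ (d1 x y))
    (fun y => `|y * pdf y|) (fun y => normr_ge0 _) iG (fun x y _ _ => bG x y).
  have de := @differentiation_under_integral R _ _ mu (fun x y => cs x c y * pdf y) setT
    measurableT t0 _ _ tI (fun x _ => iphi x) (fun x y _ _ => @ex_derive _ _ _ _ _ _ _ (d1 x y))
    (fun y => `|y * pdf y|) (fun y => normr_ge0 _) iG (fun x y _ _ => bG x y).
  apply: DeriveDef; first exact: dd.
  rewrite -derive1E de mulNr -cospdf_ibp.
  under eq_Rintegral do rewrite pE.
  transitivity (\int[mu]_y (- 1 * (sn t0 c y * (y * pdf y)))).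
    by congr Rintegral; apply/funext => y; ring.
  rewrite RintegralZl ?mulN1r//; apply: int_bounded; last exact: integrable_id_normal_pdf.
    exact: continuous_measurable_fun.
  by move=> y; exact: sin_max.
pose G t := phi t * expR (t ^+ 2 / 2).
have dG (x : R) : is_derive x 1 G 0.
  have d1 : is_derive x 1 (fun x => x ^+ 2 / 2) x.
    by apply: is_derive_eq; rewrite /GRing.scale/=; field.
  have d2 := @is_derive1_comp _ (@expR R) (fun x => x ^+ 2 / 2) x _ _ _ d1.
  have d3 : is_derive x 1 (fun x => expR (x ^+ 2 / 2)) (expR (x ^+ 2 / 2) * x) by exact: d2.
  have d4 := dphi x.
  by apply: is_derive_eq; rewrite /GRing.scale/=; ring.
have : `|G (0 + t) - G 0| <= 0 * `|t|.
  by apply: (@mvt_bound R G (fun=> 0)) => s _; rewrite normr0.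
rewrite mul0r add0r normr_le0 subr_eq0 => /eqP GE.
have phi0 : phi 0 = cos c.
  rewrite /phi.
  have -> : (fun y => cs 0 c y * pdf y) = (fun y => cos c * pdf y).
    by apply/funext => y; rewrite /cs mul0r add0r.
  by rewrite RintegralZl// /Rintegral integral_normal_pdf mulr1.
move: GE; rewrite /G phi0 expr0n/= mul0r expR0 mulr1 => <-.
by rewrite -mulrA -expRD -mulrDl subrr mul0r expR0 mulr1.
Qed.

Lemma normal_cf t : \int[N]_x cos (t * x) = expR (- t ^+ 2 / 2) /\
  \int[N]_x sin (t * x) = 0.
Proof.
split.
  rewrite Rintegral_normal_prob; last first.
    split; last by exists 1 => x; exact: cos_max.
    apply: measurableT_comp; last exact: measurable_funM.
    exact: (continuous_measurable_fun (@continuous_cos R)).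
  have := phase_cf t 0; rewrite cos0 mul1r => <-.
  by congr Rintegral; apply/funext => y; rewrite /cs addr0.
rewrite Rintegral_normal_prob; last first.
  split; last by exists 1 => x; exact: sin_max.
  apply: measurableT_comp; last exact: measurable_funM.
  exact: (continuous_measurable_fun (@continuous_sin R)).
have h0 := phase_cf t (- (pi / 2)); rewrite cosN cos_pihalf mul0r in h0; rewrite -[RHS]h0.
congr Rintegral; apply/funext => y; rewrite /cs -[in RHS]cosN opprD opprK.
by rewrite cosDpihalf sinN opprK.
Qed.

End normal_cf.

Lemma pushforward_probability d d' (T : measurableType d) (U : measurableType d')
    (R : realType) (P : probability T R) (f : T -> U) : measurable_fun setT f ->
  exists nu : probability U R, forall B, nu B = P (f @^-1` B).
Proof.
move=> mf; pose X : {mfun T >-> U} := mfun_Sub (mem_set mf).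
by exists (distribution P X).
Qed.

Section standard_normal.
Context (R : realType).
Local Notation N := (@normal_prob R 0 1).

Lemma exists_std_normal k : exists g : probability (borelV R k) R, is_std_normal g.
Proof.
elim: k => [|k [g gN]].
  exists (@dirac _ (borelV R 0) (0 : 'cV[R]_0) R) => B mB.
  rewrite big_ord0 /= diracE mem_set//=.
  by case.
pose f (p : R * borelV R k) : borelV R k.+1 :=
  \col_(i < k.+1) if unlift ord0 i is Some j then (p.2 : 'cV[R]_k) j ord0 else p.1.
have mf : measurable_fun setT f.
  apply: measurable_borelV => j.
  under eq_fun do rewrite mxE.
  case: unliftP => [i _|_]; last exact: measurable_fst.
  by apply: (measurableT_comp (measurable_coord i)); exact: measurable_snd.
have [nu nuE] := pushforward_probability ((N \x g)%E : probability _ R) mf.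
exists nu => B mB; rewrite nuE.
have -> : f @^-1` [set v : 'cV[R]_k.+1 | forall j, B j (v j ord0)] =
    B ord0 `*` [set v : 'cV[R]_k | forall j, B (lift ord0 j) (v j ord0)].
  apply/seteqP; split => -[t v] /=.
    move=> H; split; first by have := H ord0; rewrite mxE unlift_none.
    by move=> j; have := H (lift ord0 j); rewrite mxE liftK.
  by move=> [H0 H] j; rewrite mxE; case: unliftP => [i ->|->].
have mA : measurable ([set v : 'cV[R]_k | forall j, B (lift ord0 j) (v j ord0)] : set (borelV R k)).
  rewrite (_ : [set v | _] = \bigcap_(j in @setT 'I_k) ((fun v : 'cV[R]_k => v j ord0) @^-1` B (lift ord0 j))).
    apply: fin_bigcap_measurable => // j _.
    by rewrite -[X in measurable X]setTI; exact: measurable_coord.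
  by apply/seteqP; split => v /= H j; [move=> _|]; exact: H.
rewrite big_ord_recl -(gN _ (fun j => mB (lift ord0 j))).
by apply: product_measure1E => //; exact: mB.
Qed.

Section std_normal_cf.
Context (k : nat) (g : probability (borelV R k) R).
Hypothesis gN : is_std_normal g.

Lemma std_normal_coord (j : 'I_k) (B : set R) : measurable B ->
  g [set v : 'cV[R]_k | B (v j ord0)] = N B.
Proof.
move=> mB; have := gN (B := fun i => if i == j then B else setT).
rewrite (bigD1 j)//= eqxx big1 ?mule1; last first.
  by move=> i /negbTE ->; exact: probability_setT.
move=> <-; last by move=> i; case: ifP.
congr (g _); apply/seteqP; split => v /= H.
  by move=> i; case: eqVneq => // ->.
by have := H j; rewrite eqxx.
Qed.

Lemma std_normal_cf (a : 'cV[R]_k) :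
  \int[g]_v cos (dotv a (v : 'cV[R]_k)) = expR (- dotv a a / 2) /\
  \int[g]_v sin (dotv a (v : 'cV[R]_k)) = 0.
Proof.
(* The weighted coordinates, continued by 0 to a sequence indexed by [nat], the format of
   [independent_upto]. *)
pose eta (i : nat) (v : borelV R k) : R :=
  if insub i is Some j then a j ord0 * (v : 'cV[R]_k) j ord0 else 0.
have etaE (j : 'I_k) : eta j = fun v => a j ord0 * (v : 'cV[R]_k) j ord0.
  by apply/funext => v; rewrite /eta valK.
have meta i : measurable_fun setT (eta i).
  have [ik|ki] := ltnP i k.
    rewrite (etaE (Ordinal ik)); apply: measurable_funM => //.
    exact: measurable_coord.
  have -> : eta i = cst 0 by apply/funext => v; rewrite /eta insubF// ltnNge ki.
  exact: measurable_cst.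
have mZ c (B : set R) : measurable B -> measurable ((fun x => c * x) @^-1` B).
  by move=> mB; rewrite -[X in measurable X]setTI; exact: measurable_funM.
have inde : independent_upto g eta k.
  move=> B mB.
  have := gN (B := fun j : 'I_k => (fun x => a j ord0 * x) @^-1` B j).
  have -> : [set v : 'cV[R]_k | forall j, ((fun x => a j ord0 * x) @^-1` B j) (v j ord0)] =
      \bigcap_(i in `I_k) (eta i @^-1` B i).
    apply/seteqP; split => v /= H.
      by move=> i /= ik; rewrite (etaE (Ordinal ik)); exact: (H (Ordinal ik)).
    by move=> j; have := H j (ltn_ord j); rewrite /= etaE.
  move=> ->; last by move=> j; exact: mZ.
  apply: eq_bigr => j _; rewrite -(std_normal_coord j) ?etaE//.
  exact: mZ.
have cfj (h : R -> R) (j : 'I_k) : bmfun h ->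
    \int[g]_v h (eta j v) = \int[N]_x h (a j ord0 * x).
  move=> [mh [K hK]]; rewrite etaE.
  have mah : measurable_fun setT (fun x => h (a j ord0 * x)).
    by apply: measurableT_comp => //; exact: measurable_funM.
  have [] := @integrable_same_law _ _ _ _ _ _ R g N (fun v : 'cV[R]_k => v j ord0)
    id (measurable_coord j) (@measurable_id _ _ _) _ _ mah.
  - by move=> B mB; exact: std_normal_coord.
  - by apply: bmfun_integrable; split => //; exists K => x /=.
  - by move=> _; exact.
have H i : (i <= k)%N ->
    \int[g]_v cos (\sum_(j < i) eta j v) =
      expR (- (\sum_(j < k | (j < i)%N) a j ord0 ^+ 2) / 2) /\
    \int[g]_v sin (\sum_(j < i) eta j v) = 0.
  elim: i => [|i IH] ik.
    have -> : (fun v => cos (\sum_(j < 0) eta j v)) = cst 1.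
      by apply/funext => w; rewrite big_ord0 cos0.
    have -> : (fun v => sin (\sum_(j < 0) eta j v)) = cst 0.
      by apply/funext => w; rewrite big_ord0 sin0.
    by rewrite !Rintegral_probability_cst big1// oppr0 mul0r expR0.
  have [-> ->] := cf_sum_recl meta inde ik.
  have [-> ->] := IH (ltnW ik).
  pose j := Ordinal ik.
  have [c1 s1] := normal_cf (a j ord0).
  rewrite (cfj _ j (bmfun_cos R)) (cfj _ j (bmfun_sin R)) c1 s1.
  rewrite !(mul0r, mulr0) subr0 addr0; split => //.
  rewrite -expRD [in RHS](bigD1 j) ?leqnn//= -mulrDl; congr (expR (_ / 2)).
  rewrite opprD addrC; congr (_ - _); apply: eq_bigl => l.
  by rewrite ltnS -val_eqE/= ltn_neqAle andbC.
have [] := H k (leqnn k).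
have E v : \sum_(j < k) eta j v = dotv a (v : 'cV[R]_k).
  by rewrite dotvE; apply: eq_bigr => j _; rewrite etaE.
have -> : (fun v => cos (\sum_(j < k) eta j v)) = (fun v => cos (dotv a v)).
  by apply/funext => v; rewrite E.
have -> : (fun v => sin (\sum_(j < k) eta j v)) = (fun v => sin (dotv a v)).
  by apply/funext => v; rewrite E.
move=> -> ->; split => //; congr (expR (- _ / 2)).
rewrite dotvE; apply: eq_big => [j|j _]; first exact: ltn_ord.
by rewrite expr2.
Qed.

End std_normal_cf.

Lemma exists_normal k (C : 'M[R]_k) : exists nu : probability (borelV R k) R,
  is_normal 0 (C *m C^T) nu /\ forall t : 'cV[R]_k,
    \int[nu]_v cos (dotv t (v : 'cV[R]_k)) = expR (- dotv t (C *m C^T *m t) / 2) /\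
    \int[nu]_v sin (dotv t (v : 'cV[R]_k)) = 0.
Proof.
have [g gN] := exists_std_normal k.
pose f := (fun z : 'cV[R]_k => 0 + C *m z) : borelV R k -> borelV R k.
have mf : measurable_fun setT f by exact: measurable_mulmx.
have [nu nuE] := pushforward_probability g mf.
exists nu; split.
  exists C; split => //; exists g; split => // B _; exact: nuE.
move=> t; have [c s] := std_normal_cf gN (C^T *m t).
have E z : dotv t (f z) = dotv (C^T *m t) z.
  by rewrite /f add0r /dotv trmx_mul trmxK !mulmxA.
have tr (h : R -> R) : bmfun h ->
    \int[nu]_v h (dotv t (v : 'cV[R]_k)) = \int[g]_v h (dotv (C^T *m t) (v : 'cV[R]_k)).
  move=> [mh [K hK]].
  have mh' : measurable_fun (setT : set (borelV R k)) (fun v : 'cV[R]_k => h (dotv t v)).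
    by apply: measurableT_comp => //; exact: measurable_dotv.
  have [] := @integrable_same_law _ _ _ _ _ _ R nu g id f (@measurable_id _ _ _) mf _ _ mh'.
  - by move=> B mB; exact: nuE.
  - apply: bmfun_integrable; split; first exact: measurableT_comp.
    by exists K => x /=.
  - by move=> _ ->; congr Rintegral; apply/funext => z /=; rewrite E.
rewrite (tr _ (bmfun_cos R)) (tr _ (bmfun_sin R)) c s; split => //.
by congr (expR (- _ / 2)); rewrite /dotv trmx_mul trmxK !mulmxA.
Qed.

End standard_normal.

(** * Weak convergence from characteristic functions *)

Section binomial_moments.
Context (R : comPzRingType).
Implicit Types (t : R) (f : nat -> R).

(** The resulting polynomial identities in [t] serve twice: for Bernstein polynomials evaluated at a
    trigonometric function, and for votes, where [t] is integrated against a Dirichlet density. *)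
Definition binomial_mean n t f : R :=
  \sum_(i < n.+1) f i * ('C(n, i)%:R * t ^+ i * (1 - t) ^+ (n - i)).

(** Pascal's rule, that is, conditioning on the outcome of one of the [n.+1] trials; the moments
    follow by induction on [n]. *)
Lemma binomial_meanS n t f :
  binomial_mean n.+1 t f =
  t * binomial_mean n t (fun i => f i.+1) + (1 - t) * binomial_mean n t f.
Proof.
rewrite /binomial_mean big_ord_recl/= bin0 expr0 subn0 mulr1 mul1r.
under eq_bigr do rewrite /bump/= add1n binS natrD mulrDl mulrDl mulrDr subSS.
rewrite big_split/= addrA [RHS]addrC; congr (_ + _); last first.
  by rewrite mulr_sumr; apply: eq_bigr => i _; rewrite exprS; ring.
rewrite [in RHS]big_ord_recl/= bin0 expr0 subn0 mulr1 mul1r mulrDr; congr (_ + _).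
  by rewrite exprS; ring.
rewrite big_ord_recr/= bin_small// !(mul0r, mulr0) addr0 mulr_sumr.
apply: eq_bigr => i _; rewrite /bump/= add1n.
have -> : (n - i = (n - i.+1).+1)%N by rewrite subnSK.
by rewrite [(1 - t) ^+ _.+1]exprS; ring.
Qed.

Lemma binomial_mean1 n t : binomial_mean n t (fun=> 1) = 1.
Proof.
elim: n => [|n IH]; last by rewrite binomial_meanS IH; ring.
by rewrite /binomial_mean big_ord_recl big_ord0 bin0 !expr0; ring.
Qed.

Lemma binomial_meanD n t f g :
  binomial_mean n t (fun i => f i + g i) = binomial_mean n t f + binomial_mean n t g.
Proof.
by rewrite /binomial_mean; under eq_bigr do rewrite mulrDl; rewrite big_split.
Qed.

Lemma binomial_meanZ n t c f :
  binomial_mean n t (fun i => c * f i) = c * binomial_mean n t f.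
Proof.
by rewrite /binomial_mean mulr_sumr; apply: eq_bigr => i _; rewrite -mulrA.
Qed.

Lemma binomial_mean_id n t : binomial_mean n t (fun i => i%:R) = n%:R * t.
Proof.
elim: n => [|n IH].
  by rewrite /binomial_mean big_ord_recl big_ord0 !mul0r addr0.
rewrite binomial_meanS.
have -> : binomial_mean n t (fun i => i.+1%:R) = binomial_mean n t (fun i => i%:R) + 1.
  rewrite -[X in _ + X](binomial_mean1 n t) -binomial_meanD.
  by apply: eq_bigr => i _; rewrite natr1.
by rewrite IH -natr1; ring.
Qed.

Lemma binomial_mean_sqr n t : binomial_mean n t (fun i => i%:R ^+ 2) =
  n%:R * t * (1 - t) + (n%:R * t) ^+ 2.
Proof.
elim: n => [|n IH].
  by rewrite /binomial_mean big_ord_recl big_ord0 mulr0n expr0n /= !mul0r expr0n addr0.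
rewrite binomial_meanS.
have -> : binomial_mean n t (fun i => i.+1%:R ^+ 2) =
   binomial_mean n t (fun i => i%:R ^+ 2) + (2 * (n%:R * t) + 1).
  rewrite -(binomial_mean_id n t) -binomial_meanZ -[X in _ + (_ + X)](binomial_mean1 n t) -!binomial_meanD.
  by apply: eq_bigr => i _; congr (_ * _); rewrite -(natr1 i); ring.
by rewrite IH -(natr1 n); ring.
Qed.

End binomial_moments.

(** * Trigonometric polynomials as a dense class of test functions *)

Section trigonometric_polynomials.
Context (R : realType) (k : nat).

(** The constructors span linearly the functions whose integrals are known from characteristic
    functions, so convergence of integrals is an immediate induction. Products are recovered in
    [trigpolyM] from the product-to-sum formulas. *)
Inductive trigpoly : ('cV[R]_k -> R) -> Prop :=
| trigpoly_cst c : trigpoly (fun=> c)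
| trigpoly_cos b : trigpoly (fun v => cos (dotv b v))
| trigpoly_sin b : trigpoly (fun v => sin (dotv b v))
| trigpolyD f g : trigpoly f -> trigpoly g -> trigpoly (fun v => f v + g v)
| trigpolyZ c f : trigpoly f -> trigpoly (fun v => c * f v).

Lemma trigpoly_ext f g : trigpoly f -> f =1 g -> trigpoly g.
Proof. by move=> tf /funext <-. Qed.

Let dotvD (a b v : 'cV[R]_k) : dotv (a + b) v = dotv a v + dotv b v.
Proof.
by rewrite !dotvE -big_split; apply: eq_bigr => j _; rewrite mxE mulrDl.
Qed.

Let dotvN (b v : 'cV[R]_k) : dotv (- b) v = - dotv b v.
Proof.
by rewrite !dotvE -sumrN; apply: eq_bigr => j _; rewrite mxE mulNr.
Qed.

Let trigpoly_cos_mul b f : trigpoly f -> trigpoly (fun v => cos (dotv b v) * f v).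
Proof.
elim=> [c|a|a|g h _ IHg _ IHh|c g _ IH].
- by apply: (trigpoly_ext (trigpolyZ c (trigpoly_cos b))) => v; rewrite mulrC.
- apply: (trigpoly_ext (trigpolyZ 2^-1 (trigpolyD (trigpoly_cos (b + a)) (trigpoly_cos (b - a))))) => v.
  by rewrite !dotvD dotvN !cosD sinN cosN; field.
- apply: (trigpoly_ext (trigpolyZ 2^-1 (trigpolyD (trigpoly_sin (a + b)) (trigpoly_sin (a - b))))) => v.
  by rewrite !dotvD dotvN !sinD sinN cosN; field.
- by apply: (trigpoly_ext (trigpolyD IHg IHh)) => v; rewrite mulrDr.
- by apply: (trigpoly_ext (trigpolyZ c IH)) => v; rewrite mulrCA.
Qed.

Let trigpoly_sin_mul b f : trigpoly f -> trigpoly (fun v => sin (dotv b v) * f v).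
Proof.
elim=> [c|a|a|g h _ IHg _ IHh|c g _ IH].
- by apply: (trigpoly_ext (trigpolyZ c (trigpoly_sin b))) => v; rewrite mulrC.
- apply: (trigpoly_ext (trigpolyZ 2^-1 (trigpolyD (trigpoly_sin (b + a)) (trigpoly_sin (b - a))))) => v.
  by rewrite !dotvD dotvN !sinD sinN cosN; field.
- apply: (trigpoly_ext (trigpolyZ 2^-1 (trigpolyD (trigpoly_cos (b - a)) (trigpolyZ (-1) (trigpoly_cos (b + a)))))) => v.
  by rewrite !dotvD dotvN !cosD sinN cosN; field.
- by apply: (trigpoly_ext (trigpolyD IHg IHh)) => v; rewrite mulrDr.
- by apply: (trigpoly_ext (trigpolyZ c IH)) => v; rewrite mulrCA.
Qed.

Lemma trigpolyM f g : trigpoly f -> trigpoly g -> trigpoly (fun v => f v * g v).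
Proof.
move=> tf tg; elim: tf => [c|a|a|f1 f2 _ IH1 _ IH2|c f1 _ IH].
- exact: trigpolyZ.
- exact: trigpoly_cos_mul.
- exact: trigpoly_sin_mul.
- by apply: (trigpoly_ext (trigpolyD IH1 IH2)) => v; rewrite mulrDl.
- by apply: (trigpoly_ext (trigpolyZ c IH)) => v; rewrite mulrA.
Qed.

Lemma trigpolyX f n : trigpoly f -> trigpoly (fun v => f v ^+ n).
Proof.
move=> tf; elim: n => [|n IH]; first exact: trigpoly_cst.
by apply: (trigpoly_ext (trigpolyM tf IH)) => v; rewrite exprS.
Qed.

Lemma trigpoly_sum (I : Type) (s : seq I) (F : I -> 'cV[R]_k -> R) :
  (forall i, trigpoly (F i)) -> trigpoly (fun v => \sum_(i <- s) F i v).
Proof.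
move=> tF; elim: s => [|i s IH].
  by apply: (trigpoly_ext (trigpoly_cst 0)) => v; rewrite big_nil.
by apply: (trigpoly_ext (trigpolyD (tF i) IH)) => v; rewrite big_cons.
Qed.

Lemma trigpoly_prod (I : Type) (s : seq I) (F : I -> 'cV[R]_k -> R) :
  (forall i, trigpoly (F i)) -> trigpoly (fun v => \prod_(i <- s) F i v).
Proof.
move=> tF; elim: s => [|i s IH].
  by apply: (trigpoly_ext (trigpoly_cst 1)) => v; rewrite big_nil.
by apply: (trigpoly_ext (trigpolyM (tF i) IH)) => v; rewrite big_cons.
Qed.

Lemma trigpoly_bounded f : trigpoly f -> exists K, forall v, `|f v| <= K.
Proof.
elim=> [c|b|b|g h _ [K gK] _ [L hL]|c g _ [K gK]].
- by exists `|c|.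
- by exists 1 => v; exact: cos_max.
- by exists 1 => v; exact: sin_max.
- by exists (K + L) => v; rewrite (le_trans (ler_normD _ _))// lerD.
- by exists (`|c| * K) => v; rewrite normrM ler_wpM2l.
Qed.

Lemma trigpoly_measurable f : trigpoly f -> measurable_fun (setT : set (borelV R k)) f.
Proof.
elim=> [c|b|b|g h _ mg _ mh|c g _ mg].
- exact: measurable_cst.
- exact: (measurableT_comp (bmfun_cos R).1 (measurable_dotv b)).
- exact: (measurableT_comp (bmfun_sin R).1 (measurable_dotv b)).
- exact: measurable_funD.
- exact: measurable_funM.
Qed.

End trigonometric_polynomials.

Section bernstein.
Context (R : realType) (k N : nat).
Hypothesis N_gt0 : (0 < N)%N.
Implicit Type s : 'I_k -> R.

Let B (i : nat) (t : R) : R := 'C(N, i)%:R * t ^+ i * (1 - t) ^+ (N - i).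

(** The probability that [k] independent binomial counts with success probabilities [s j] take the
    values [i j]. *)
Definition bernstein_weight s (i : {ffun 'I_k -> 'I_N.+1}) : R :=
  \prod_j ('C(N, i j)%:R * s j ^+ i j * (1 - s j) ^+ (N - i j)).

Lemma bernstein_weight_ge0 s i : (forall j, 0 <= s j <= 1) ->
  0 <= bernstein_weight s i.
Proof.
move=> s01; apply: prodr_ge0 => j _; have /andP[s0 s1] := s01 j.
by rewrite !mulr_ge0// exprn_ge0// subr_ge0.
Qed.

Lemma sum_bernstein_weight s : \sum_(i : {ffun 'I_k -> 'I_N.+1}) bernstein_weight s i = 1.
Proof.
rewrite /bernstein_weight -(bigA_distr_bigA (fun j (i : 'I_N.+1) => B i (s j))) big1// => j _.
rewrite -[RHS](binomial_mean1 N (s j)).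
by apply: eq_bigr => i _; rewrite mul1r.
Qed.

(** The variance of the frequency in coordinate [j]; the sums over the other coordinates are total
    masses, equal to 1. *)
Lemma bernstein_weight_var s (j : 'I_k) :
  \sum_(i : {ffun 'I_k -> 'I_N.+1}) ((i j)%:R / N%:R - s j) ^+ 2 * bernstein_weight s i =
  s j * (1 - s j) / N%:R.
Proof.
have N0 : N%:R != 0 :> R by rewrite pnatr_eq0 -lt0n.
pose h (l : 'I_k) (i : 'I_N.+1) : R :=
  (if l == j then (i%:R / N%:R - s j) ^+ 2 else 1) * B i (s l).
transitivity (\sum_(i : {ffun 'I_k -> 'I_N.+1}) \prod_l h l (i l)).
  apply: eq_bigr => i _; rewrite /h big_split/=; congr (_ * _).
  by rewrite -big_mkcond big_pred1_eq.
rewrite -(bigA_distr_bigA h) (bigD1 j)//= [X in _ * X]big1 ?mulr1; last first.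
  move=> l /negbTE lj; rewrite /h lj.
  rewrite -[RHS](binomial_mean1 N (s l)).
  by apply: eq_bigr => i _; rewrite mul1r.
rewrite /h eqxx; set t := s j.
transitivity (binomial_mean N t (fun i => N%:R ^- 2 * i%:R ^+ 2 + ((- 2 * t / N%:R) * i%:R + t ^+ 2 * 1))).
  by apply: eq_bigr => i _; congr (_ * _); field.
rewrite binomial_meanD binomial_meanZ binomial_mean_sqr.
rewrite binomial_meanD binomial_meanZ binomial_mean_id binomial_meanZ binomial_mean1.
by field.
Qed.

End bernstein.

Section approximation.
Context (R : realType) (k : nat).

Let continuous_col (h : R -> R) (r : 'rV[R]_k) :
  (forall j, {for r ord0 j, continuous h}) ->
  {for r, continuous (fun r : 'rV[R]_k => \col_j h (r ord0 j) : 'cV[R]_k)}.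
Proof.
move=> ch A /nbhs_ballP[e /= e0 eA].
have H : \forall r' \near r, forall j, ball (h (r ord0 j)) e (h ((r' : 'rV[R]_k) ord0 j)).
  apply: (@filter_forall _ _ (fun j (r' : 'rV[R]_k) => ball (h (r ord0 j)) e (h (r' ord0 j))) _ (nbhs_filter r)) => j.
  have : h ((r' : 'rV[R]_k) ord0 j) @[r' --> r] --> h (r ord0 j).
    by apply: (@continuous_comp _ _ _ (fun r : 'rV[R]_k => r ord0 j)); [exact: coord_continuous|exact: ch].
  by move=> /cvg_ballP; exact.
apply: filterS H => r' H; apply: eA; split => // i j.
by rewrite !mxE; exact: H.
Qed.

(* [g] is the Bernstein polynomial of [f] in the variables [(1 + sin (v_j / M)) / 2],
   which is a trigonometric polynomial bounded by [K] everywhere, not only on the box. *)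
Lemma trigpoly_approx (f : 'cV[R]_k -> R) (K L e : R) :
  continuous f -> (forall v, `|f v| <= K) -> 0 < L -> 0 < e ->
  exists g, [/\ trigpoly g, forall v, `|g v| <= K &
    forall v : 'cV[R]_k, (forall j, `|v j ord0| <= L) -> `|f v - g v| <= e].
Proof.
move=> cf fK L0 e0.
have K0 : 0 <= K by apply: le_trans (fK 0).
have pi0 : 0 < pi :> R by exact: pi_gt0.
(* With this scale the box corresponds to angles of absolute value at most [pi / 4], where the sine
   is invertible and stays below [a < 1], away from the endpoints of [asin]. *)
pose M := 4 * L / pi.
have M0 : 0 < M by rewrite /M divr_gt0// mulr_gt0.
pose a : R := sin (pi / 4).
have a1 : a < 1.
  rewrite -[ltRHS]sin_pihalf; rewrite ltr_sin// ?in_itv/=; try (apply/andP; split); lra.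
pose F (r : 'rV[R]_k) := f (\col_j (M * asin (r ord0 j))).
have cF (r : 'rV[R]_k) : (forall j, `|r ord0 j| <= a) -> {for r, continuous F}.
  move=> ra; apply: continuous_comp; last exact: cf.
  apply: (@continuous_col (fun x => M * asin x)) => j.
  apply: cvgM; first exact: cvg_cst.
  apply: continuous_asin; rewrite -ltr_norml.
  exact: le_lt_trans (ra j) a1.
(* Uniform continuity in which only [r] is confined to the compact cube: [r'] will be a node of the
   Bernstein grid, which fills all of [-1, 1] in each coordinate. *)
have [dl dl0 Fdl] : exists2 dl : R, 0 < dl & forall r r' : 'rV[R]_k,
    (forall j, `|r ord0 j| <= a) -> (forall j, `|r ord0 j - r' ord0 j| < dl) ->
    `|F r - F r'| <= e / 2.
  pose C := [set v : 'rV[R]_k | forall i, `[- a, a]%classic (v ord0 i)].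
  have cC : compact C by apply: (@rV_compact R k (fun=> `[- a, a]%classic)) => _; exact: segment_compact.
  move/compact_near_coveringP : cC.
  move=> /(_ R (0 : R)^'+ (fun dl r => forall r' : 'rV[R]_k,
    (forall j, `|r ord0 j - r' ord0 j| < dl) -> `|F r - F r'| <= e / 2) _).
  case.
    move=> r rC.
    have e4 : 0 < e / 4 by rewrite divr_gt0.
    have /cvg_ballP/(_ _ e4) : {for r, continuous F}.
      by apply: cF => j; have := rC j; rewrite /= in_itv/= -ler_norml.
    move=> /nbhs_ballP[eta /= eta0 H].
    have eta2 : 0 < eta / 2 by rewrite divr_gt0.
    exists (ball r (eta / 2), [set x | x < eta / 2]).
      split => /=; first exact: nbhsx_ballx.
      by apply: nbhs_right_lt.
    move=> [r1 x] /= [[_ rr1] xeta] r' r1r'.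
    have b1 : ball (F r) (e / 4) (F r1).
      apply: H; split => // i j; rewrite ord1; apply: lt_trans (rr1 ord0 j) _; lra.
    have b2 : ball (F r) (e / 4) (F r').
      apply: H; split => // i j; rewrite ord1 /ball/=.
      have h1 := rr1 ord0 j; have h2 := r1r' j; rewrite /ball/= in h1.
      rewrite -(subrKA (r1 ord0 j)) (le_lt_trans (ler_normD _ _))//; lra.
    rewrite /ball/= in b1 b2.
    by rewrite -(subrKA (F r)) (le_trans (ler_normD _ _))// (distrC (F r1)); lra.
  move=> dl /= dl0 H.
  exists (dl / 2); first by rewrite divr_gt0.
  move=> r r' ra; apply: (H (dl / 2)).
  - by rewrite /= sub0r normrN gtr0_norm ?divr_gt0//; lra.
  - by rewrite divr_gt0.
  - by move=> j /=; rewrite in_itv/= -ler_norml.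
have sumk0 : 0 <= K / dl ^+ 2 * k%:R by rewrite !mulr_ge0// invr_ge0 sqr_ge0.
have [N N0 NK] : exists2 N, (0 < N)%N & 2 * (K / dl ^+ 2 * k%:R) / N%:R <= e / 2.
  near \oo => N; have N0 : (0 < N)%N by near: N; exact: nbhs_infty_gt.
  exists N => //; rewrite ler_pdivrMr ?ltr0n// [e / 2 * _]mulrC -ler_pdivrMr ?divr_gt0//.
  by near: N; exact: nbhs_infty_ger.
have NR : 0 < N%:R :> R by rewrite ltr0n.
pose s (v : 'cV[R]_k) j := (1 + sin (v j ord0 / M)) / 2.
have s01 v j : 0 <= s v j <= 1.
  have := sin_max (v j ord0 / M); rewrite ler_norml /s => /andP[h1 h2].
  by apply/andP; split; lra.
have W0 v (i : {ffun 'I_k -> 'I_N.+1}) : 0 <= bernstein_weight (s v) i.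
  by apply: bernstein_weight_ge0 => j; exact: s01.
pose node (i : {ffun 'I_k -> 'I_N.+1}) : 'rV[R]_k := \row_j (2 * ((i j)%:R / N%:R) - 1).
exists (fun v => \sum_i F (node i) * bernstein_weight (s v) i); split.
- apply: trigpoly_sum => i; apply: trigpolyZ; apply: trigpoly_prod => j.
  have ts : trigpoly (fun v => s v j).
    pose b : 'cV[R]_k := \col_l (if l == j then M^-1 else 0).
    apply: (trigpoly_ext (trigpolyZ 2^-1 (trigpolyD (trigpoly_cst k 1) (trigpoly_sin b)))) => v.
    rewrite /s [RHS]mulrC; congr (_ * (_ + sin _)).
    rewrite dotvE (bigD1 j)//= mxE eqxx big1 ?addr0 1?mulrC// => l /negbTE lj.
    by rewrite mxE lj mul0r.
  have t1s : trigpoly (fun v => 1 - s v j).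
    by apply: (trigpoly_ext (trigpolyD (trigpoly_cst k 1) (trigpolyZ (-1) ts))) => v; rewrite mulN1r.
  exact: (trigpolyM (trigpolyM (trigpoly_cst k 'C(N, i j)%:R) (trigpolyX (i j) ts)) (trigpolyX (N - i j) t1s)).
- move=> v; rewrite (le_trans (ler_norm_sum _ _ _))//.
  rewrite -[leRHS]mulr1 -(sum_bernstein_weight N (s v)) mulr_sumr ler_sum// => i _.
  rewrite normrM (ger0_norm (W0 _ _)) ler_wpM2r//; exact: fK.
move=> v vL; pose r : 'rV[R]_k := \row_j sin (v j ord0 / M).
have vM j : `|v j ord0 / M| <= pi / 4.
  rewrite normrM (gtr0_norm (_ : 0 < M^-1)) ?invr_gt0// ler_pdivrMr// (le_trans (vL j))//.
  have aux (p l : R) : 0 < p -> p / 4 * (4 * l / p) = l.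
    by move=> p0; field; rewrite gt_eqF.
  by rewrite aux.
have fF : f v = F r.
  rewrite /F; congr f; apply/colP => j; rewrite !mxE sinK.
    by rewrite mulrCA mulfV ?mulr1// gt_eqF.
  by rewrite in_itv/= -ler_norml (le_trans (vM j))//; lra.
have ra j : `|r ord0 j| <= a.
  have := vM j; rewrite mxE !ler_norml => /andP[h1 h2].
  have ltsin : {in `[- (pi / 2), pi / 2] &, {homo @sin R : x y / x < y}}.
    by move=> x y xI yI; rewrite ltr_sin.
  have lesin := le_mono_in ltsin.
  have vI : v j ord0 / M \in `[- (pi / 2), pi / 2].
    by rewrite in_itv/=; apply/andP; split; lra.
  by rewrite /a -sinN !lesin ?h1 ?h2//= in_itv/=; apply/andP; split; lra.
have c0 : 0 <= 2 * K / dl ^+ 2 by rewrite !mulr_ge0// invr_ge0 sqr_ge0.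
(* As in Chebyshev's inequality: near nodes are covered by uniform continuity, and at a far node the
   quadratic term alone exceeds [2 * K]. *)
have key i : `|F r - F (node i)| <=
    e / 2 + 2 * K / dl ^+ 2 * \sum_j (r ord0 j - node i ord0 j) ^+ 2.
  have S0 : 0 <= \sum_j (r ord0 j - node i ord0 j) ^+ 2 by apply: sumr_ge0 => j _; exact: sqr_ge0.
  have [H|] := pselect (forall j, `|r ord0 j - node i ord0 j| < dl).
    by rewrite (le_trans (Fdl _ _ ra H))// lerDl mulr_ge0.
  move=> /existsNP[j /negP]; rewrite -leNgt => H.
  have FK : `|F r - F (node i)| <= 2 * K.
    rewrite (le_trans (ler_normB _ _))// mulr_natl mulr2n lerD//; exact: fK.
  rewrite (le_trans FK)// ler_wpDl ?divr_ge0 ?(ltW e0)//.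
  rewrite -mulrA -[leLHS]mulr1 ler_wpM2l ?mulr_ge0//.
  rewrite ler_pdivlMl ?exprn_gt0// mulr1 (bigD1 j)//= ler_wpDr//.
    by apply: sumr_ge0 => l _; exact: sqr_ge0.
  rewrite -[leRHS]real_normK ?num_real// lerXn2r// nnegrE ltW//.
have W1 := sum_bernstein_weight N (s v).
have -> : f v - \sum_i F (node i) * bernstein_weight (s v) i =
    \sum_i (F r - F (node i)) * bernstein_weight (s v) i.
  under [RHS]eq_bigr do rewrite mulrBl.
  by rewrite sumrB -mulr_sumr W1 mulr1 fF.
rewrite (le_trans (ler_norm_sum _ _ _))//.
apply: (@le_trans _ _ (\sum_i (e / 2 * bernstein_weight (s v) i + 2 * K / dl ^+ 2 *
    \sum_j (r ord0 j - node i ord0 j) ^+ 2 * bernstein_weight (s v) i))).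
  apply: ler_sum => i _.
  rewrite normrM (ger0_norm (W0 _ _)) -mulr_suml mulrA -mulrDl.
  by rewrite ler_wpM2r.
rewrite big_split/= -mulr_sumr W1 mulr1 -mulr_sumr exchange_big/=.
rewrite (@le_trans _ _ (e / 2 + e / 2))//; last lra.
rewrite lerD2l (le_trans _ NK)//.
have -> : 2 * (K / dl ^+ 2 * k%:R) / N%:R = 2 * K / dl ^+ 2 * \sum_(j < k) N%:R^-1.
  rewrite sumr_const card_ord -[_ *+ k]mulr_natl; field.
  by rewrite !gt_eqF.
rewrite ler_wpM2l//; apply: ler_sum => j _.
(* The factor 4 comes from [r = 2 s - 1], which doubles the deviation of the frequency; it cancels
   the bound [s (1 - s) <= 1 / 4]. *)
apply: (@le_trans _ _ (4 * (s v j * (1 - s v j) / N%:R))).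
  rewrite -bernstein_weight_var// mulr_sumr le_eqVlt; apply/orP; left; apply/eqP.
  apply: eq_bigr => i _; rewrite mulrA; congr (_ * _).
  by rewrite !mxE /s; field; rewrite gt_eqF.
rewrite mulrA ler_pdivrMr// mulVf ?gt_eqF//.
have := s01 v j; move: (s v j) => x /andP[x0 x1].
have : 0 <= (2 * x - 1) ^+ 2 by exact: sqr_ge0.
by rewrite sqrrB1; lra.
Unshelve. all: by end_near. Qed.

End approximation.

(** * Continuity theorem for tight sequences *)

Section levy.
Context (R : realType) (k : nat).

Let box (L : R) : set (borelV R k) := [set v : 'cV[R]_k | forall j, `|v j ord0| <= L].

Let mbox L : measurable (box L).
Proof.
rewrite (_ : box L = \bigcap_(j in @setT 'I_k) ((fun v : 'cV[R]_k => `|v j ord0|) @^-1` `]-oo, L])).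
  apply: fin_bigcap_measurable => // j _.
  rewrite -[X in measurable X]setTI; apply: measurableT_comp => //.
  exact: measurable_coord.
by apply/seteqP; split => v /= H j; [move=> _|]; have := H j; rewrite /= in_itv/=; [|exact].
Qed.

Let tight_probability (nu : probability (borelV R k) R) (e : R) : 0 < e ->
  \forall n \near \oo, \int[nu]_v (\1_(~` box n%:R) v) <= e.
Proof.
move=> e0.
have [||||_] := @dominated_convergence_Rintegral _ _ R nu setT measurableT
  (fun n v => \1_(~` box n%:R) v) (cst 0) (cst 1).
- by move=> n; apply: measurable_indic; exact: measurableC.
- move=> v _; apply: cvg_near_cst.
  have : \forall n \near \oo, forall j, `|(v : 'cV[R]_k) j ord0| <= n%:R.
    by apply: filter_forall => l; exact: nbhs_infty_ger.
  by apply: filterS => n H; rewrite indicE memNset//=; apply.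
- exact: (bmfun_integrable nu (bmfun_cst _ 1)).
- by move=> n v _; rewrite indicE; case: (_ \in _); rewrite ?normr1 ?normr0.
rewrite Rintegral_probability_cst => /cvgrPdist_le/(_ _ e0); apply: filterS => n.
by rewrite sub0r normrN; apply: le_trans; exact: ler_norm.
Unshelve. all: by end_near. Qed.

Context d (T : measurableType d) (P : probability T R).
Variables (Y : nat -> T -> 'cV[R]_k) (nu : probability (borelV R k) R).
Hypothesis mY : forall n, measurable_fun setT (Y n : T -> borelV R k).
Hypothesis tightY : forall e : R, 0 < e -> exists L : R,
  \forall n \near \oo, (P [set w | ~ forall j, (`|Y n w j ord0| <= L)%R] <= e%:E)%E.
Hypothesis cosY : forall t, \int[P]_w cos (dotv t (Y n w)) @[n --> \oo] -->
  \int[nu]_v cos (dotv t (v : 'cV[R]_k)).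
Hypothesis sinY : forall t, \int[P]_w sin (dotv t (Y n w)) @[n --> \oo] -->
  \int[nu]_v sin (dotv t (v : 'cV[R]_k)).

Let bYn (g : 'cV[R]_k -> R) n : @bmfun _ (borelV R k) R g -> bmfun (fun w => g (Y n w)).
Proof.
move=> [mg [K gK]]; split; last by exists K => w.
exact: (measurableT_comp mg (mY n)).
Qed.

Let trigpoly_bmfun g : trigpoly g -> @bmfun _ (borelV R k) R g.
Proof. by move=> tg; split; [exact: trigpoly_measurable|exact: trigpoly_bounded]. Qed.

Let trigpoly_cvg g : trigpoly g ->
  \int[P]_w g (Y n w) @[n --> \oo] --> \int[nu]_v g v.
Proof.
elim=> [c|t|t|f h tf IHf th IHh|c f tf IH].
- have -> : \int[nu]_v c = c by exact: Rintegral_probability_cst.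
  have -> : \int[P]_w c = c by exact: Rintegral_probability_cst.
  exact: cvg_cst.
- exact: cosY.
- exact: sinY.
- rewrite RintegralD//; try (by apply: bmfun_integrable; exact: trigpoly_bmfun).
  rewrite (_ : (fun n => \int[P]_w (f (Y n w) + h (Y n w))) = (fun n => \int[P]_w f (Y n w) + \int[P]_w h (Y n w))).
    exact: cvgD.
  apply/funext => n; rewrite RintegralD//; apply: bmfun_integrable.
    exact: (bYn n (trigpoly_bmfun tf)).
  exact: (bYn n (trigpoly_bmfun th)).
- rewrite RintegralZl//; try (by apply: bmfun_integrable; exact: trigpoly_bmfun).
  rewrite (_ : (fun n => \int[P]_w (c * f (Y n w))) = (fun n => c * \int[P]_w f (Y n w))).
    by apply: cvgM => //; exact: cvg_cst.
  apply/funext => n; rewrite RintegralZl//; apply: bmfun_integrable.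
  exact: (bYn n (trigpoly_bmfun tf)).
Qed.

(* Levy's continuity theorem, with tightness as a hypothesis. *)
Lemma cvg_in_distribution_cf : cvg_in_distribution P Y nu.
Proof.
move=> f cf [K fK].
have bf : @bmfun _ (borelV R k) R f.
  by split; [exact: continuous_measurable_borelV|exists K].
have fE n : (\int[P]_w (f (Y n w))%:E)%E = (\int[P]_w f (Y n w))%:E.
  by rewrite fineK//; apply: integrable_fin_num => //; exact: (bmfun_integrable P (bYn n bf)).
have nE : (\int[nu]_v (f v)%:E)%E = (\int[nu]_v f v)%:E.
  by rewrite fineK//; apply: integrable_fin_num => //; exact: (bmfun_integrable nu bf).
rewrite nE; under eq_fun do rewrite fE.
apply: cvg_EFin; first exact: nearW.
apply/cvgrPdist_le => e e0; rewrite /=.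
have K0 : 0 <= K by apply: le_trans (fK 0).
have e8 : 0 < e / 8 by rewrite divr_gt0.
(* The mass allowed outside the box: there [f] and [g] differ by at most [2 * K], so it contributes
   at most [e / 8]. *)
pose dl := e / 8 / (2 * K + 1).
have dl0 : 0 < dl by rewrite divr_gt0// ltr_wpDl// mulr_ge0.
have Kdl : 2 * K * dl <= e / 8.
  have c0 : 0 < 2 * K + 1 by rewrite ltr_wpDl// mulr_ge0.
  rewrite (_ : 2 * K * dl = e / 8 * (2 * K / (2 * K + 1))); last by rewrite /dl; ring.
  rewrite ler_piMr//; first exact: ltW.
  by rewrite ler_pdivrMr// mul1r lerDl.
have [L1 PL1] := tightY dl0.
near \oo => N.
pose L : R := N%:R.
have L0 : 0 < L by rewrite /L ltr0n; near: N; exact: nbhs_infty_gt.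
have L1L : L1 <= L by rewrite /L; near: N; exact: nbhs_infty_ger.
have nuL : \int[nu]_v (\1_(~` box L) v) <= dl by rewrite /L; near: N; exact: tight_probability.
have [g [tg gK fg]] := trigpoly_approx cf fK L0 e8.
have bg := trigpoly_bmfun tg.
have pt (v : 'cV[R]_k) : `|f v - g v| <= e / 8 + 2 * K * \1_(~` box L) (v : borelV R k).
  rewrite indicE; have [vL|/negP vL] := boolP ((v : borelV R k) \in ~` box L).
    rewrite mulr1 (le_trans (ler_normB _ _))// (ler_wpDl (ltW e8))// mulr_natl mulr2n.
    by rewrite lerD.
  rewrite mulr0 addr0; apply: fg; apply: contrapT => H; apply: vL.
  by rewrite inE.
have bb : @bmfun _ (borelV R k) R (\1_(~` box L)).
  by apply: bmfun_indic; exact: measurableC.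
have bd : @bmfun _ (borelV R k) R (fun v => e / 8 + 2 * K * \1_(~` box L) v).
  by apply: bmfunD; [exact: bmfun_cst|exact: bmfunZ].
(* Stated for an arbitrary random vector, in order to be applied both to [nu] with the identity and
   to [P] with [Y n]. *)
have gen d' (T' : measurableType d') (P' : probability T' R) (Z : T' -> borelV R k) :
    measurable_fun setT Z -> \int[P']_w (\1_(~` box L) (Z w)) <= dl ->
    `|\int[P']_w f (Z w) - \int[P']_w g (Z w)| <= e / 8 + e / 8.
  move=> mZ PZ.
  have bZ (h : borelV R k -> R) : bmfun h -> P'.-integrable setT (EFin \o (fun w => h (Z w))).
    move=> [mh [C hC]]; apply: bmfun_integrable; split; last by exists C => w.
    exact: measurableT_comp.
  rewrite -RintegralB//; [|exact: bZ bf|exact: bZ bg].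
  have ifg : P'.-integrable setT (EFin \o (fun w => f (Z w) - g (Z w))).
    by apply: integrable_EFinB => //; [exact: bZ bf|exact: bZ bg].
  rewrite (le_trans (le_normr_Rintegral _ ifg))//.
  have := le_Rintegral measurableT (integrable_norm ifg) (bZ _ bd) (fun w _ => pt (Z w)).
  move=> /le_trans; apply.
  rewrite RintegralD//; [|exact: (bmfun_integrable P' (bmfun_cst _ _))|]; last first.
    by apply: integrable_EFinZ => //; exact: bZ bb.
  rewrite Rintegral_probability_cst lerD2l RintegralZl//; last exact: bZ bb.
  by rewrite (le_trans _ Kdl)// ler_wpM2l ?mulr_ge0.
have nufg := gen _ _ nu id (@measurable_id _ _ _) nuL.
near=> n.
have PY : \int[P]_w (\1_(~` box L) (Y n w)) <= dl.
  have : (P [set w | ~ forall j, (`|Y n w j ord0| <= L1)%R] <= dl%:E)%E.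
    by near: n; exact: PL1.
  move=> PL.
  pose A M : set T := Y n @^-1` (~` box M).
  have mA M : measurable (A M).
    by rewrite -[X in measurable X]setTI; apply: mY => //; exact: measurableC.
  have -> : \int[P]_w (\1_(~` box L) (Y n w)) = fine (P (A L)).
    have -> : (fun w => \1_(~` box L) (Y n w)) = \1_(A L) :> (T -> R).
      by apply/funext => w; rewrite !indicE.
    by rewrite /Rintegral integral_indic// setIT.
  rewrite -lee_fin fineK ?fin_num_measure//; apply: le_trans PL.
  apply: le_measure; [exact: mem_set (mA L)|exact: mem_set (mA L1)|].
  by move=> w /= H H1; apply: H => j; rewrite (le_trans (H1 j)).
have Pfg := gen _ _ P (Y n) (mY n) PY.
have gg : `|\int[nu]_v g v - \int[P]_w g (Y n w)| <= e / 8.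
  by near: n; move/cvgrPdist_le : (trigpoly_cvg tg) => /(_ _ e8).
move: nufg Pfg gg.
set a := \int[nu]_v f v; set b := \int[nu]_v g v.
set a' := \int[P]_w f (Y n w); set b' := \int[P]_w g (Y n w) => h1 h2 h3.
rewrite (_ : a - a' = (a - b) + (b - b') - (a' - b')); last by ring.
rewrite (le_trans (ler_normB _ _))// (le_trans (lerD (ler_normD _ _) (lexx _)))//.
rewrite (le_trans (lerD (lerD h1 h3) h2))//.
have e2 (x : R) : 0 < x -> x / 8 + x / 8 + x / 8 + (x / 8 + x / 8) <= x.
  by move=> x0; lra.
exact: e2.
Unshelve. all: by end_near. Qed.

End levy.

(** * Moments of the Dirichlet-multinomial law *)

Section beta_integral.
Context (R : realType).
Local Notation mu := (@lebesgue_measure R).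
Local Notation D := (`]0, 1[%classic : set R).
Implicit Types a b t : R.

(** The beta integrand may be singular at both ends of ]0, 1[. Starting from [1 / 3] makes every
    interval [[eps n, 1 - eps n]] nondegenerate. *)
Let eps (n : nat) : R := n.+3%:R^-1.

Let eps_gt0 n : 0 < eps n. Proof. by rewrite invr_gt0. Qed.

Let eps_lt n : eps n < 1 - eps n.
Proof.
have : eps n <= 3^-1 by rewrite /eps lef_pV2 ?posrE// ler_nat.
by have := eps_gt0 n; lra.
Qed.

Let eps_sub n : `[eps n, 1 - eps n] `<=` D.
Proof.
move=> t /=; rewrite !in_itv/= => /andP[t0 t1]; apply/andP; split.
  exact: lt_le_trans t0.
by rewrite (le_lt_trans t1)// ltrBlDr ltrDl.
Qed.

Let eps_nested n : `[eps n, 1 - eps n] `<=` `[eps n.+1, 1 - eps n.+1].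
Proof.
have h : eps n.+1 <= eps n by rewrite /eps lef_pV2 ?posrE// ler_nat.
by move=> t /=; rewrite !in_itv/= => /andP[t0 t1]; apply/andP; split; lra.
Qed.

Let eps_small c : 0 < c -> \forall n \near \oo, eps n <= c.
Proof.
move=> c0; near=> n; rewrite /eps -[leRHS]invrK lef_pV2 ?posrE ?invr_gt0//.
rewrite (@le_trans _ _ n%:R)//; last by rewrite ler_nat -addn3 leq_addr.
by near: n; exact: nbhs_infty_ger.
Unshelve. all: by end_near. Qed.

Let eps_cover t : D t -> \forall n \near \oo, t \in `[eps n, 1 - eps n].
Proof.
rewrite /= in_itv/= => /andP[t0 t1]; near=> n; rewrite in_itv/=.
have h1 : eps n <= t by near: n; exact: eps_small.
have h2 : eps n <= 1 - t by near: n; apply: eps_small; rewrite subr_gt0.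
by apply/andP; split; lra.
Unshelve. all: by end_near. Qed.

Let derive_pow a t : 0 < t -> is_derive t 1 (fun t => t `^ a) (a * t `^ (a - 1)).
Proof. by move=> t0; exact: is_derive1_powR. Qed.

Let derive_pow1 b t : t < 1 ->
  is_derive t 1 (fun t => (1 - t) `^ b) (- (b * (1 - t) `^ (b - 1))).
Proof.
move=> t1; have d1 : is_derive t 1 (fun t => 1 - t) (-1).
  by apply: is_derive_eq; rewrite /GRing.scale/=; ring.
have t10 : 0 < 1 - t by rewrite subr_gt0.
have := @is_derive1_comp _ (fun x => x `^ b) (fun t => 1 - t) t _ _ (derive_pow b t10) d1.
by rewrite mulrN1.
Qed.

Let derive_continuous (f : R -> R) t c : is_derive t 1 f c -> {for t, continuous f}.
Proof.
by move=> [df _]; apply: differentiable_continuous; apply/derivable1_diffP.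
Qed.

Let continuous_pow a t : 0 < t -> {for t, continuous (fun t => t `^ a)}.
Proof. by move=> t0; exact: derive_continuous (derive_pow a t0). Qed.

Let continuous_pow1 b t : t < 1 -> {for t, continuous (fun t => (1 - t) `^ b)}.
Proof. by move=> t1; exact: derive_continuous (derive_pow1 b t1). Qed.

Let measurable_pow a : measurable_fun D (fun t => t `^ a).
Proof. by apply: measurable_funTS; exact: measurable_powR. Qed.

Let measurable_pow1 b : measurable_fun D (fun t => (1 - t) `^ b).
Proof.
apply: measurable_funTS; apply: (measurableT_comp (measurable_powR b)).
exact: measurable_funB.
Qed.

Let mD : measurable D. Proof. exact: measurable_itv. Qed.

Let pow_le1 a t : 0 <= a -> 0 <= t <= 1 -> t `^ a <= 1.
Proof.
move=> a0 /andP[t0 t1]; have := ge0_ler_powR a0.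
by move=> /(_ t 1 t0 ler01 t1); rewrite powR1.
Qed.

Let integrable_pow a : 0 < a -> mu.-integrable D (EFin \o (fun t => t `^ (a - 1))).
Proof.
move=> a0.
apply: (@ge0_integrable_exhaustion _ D eps (fun n => 1 - eps n)
   (fun t => a^-1 * t `^ a) _ a^-1) => //.
- by move=> t; rewrite inE/= in_itv/= => /andP[t0 _]; exact: continuous_pow.
- by move=> t _; exact: powR_ge0.
- move=> t; rewrite /= in_itv/= => /andP[t0 _]; have := derive_pow a t0 => d1.
  apply: is_derive_eq; rewrite /GRing.scale/=; field; rewrite gt_eqF//.
- move=> n; rewrite -mulrBr ler_piMr// ?invr_ge0 ?(ltW a0)//.
  have := powR_ge0 (eps n) a; have : (1 - eps n) `^ a <= 1; last lra.
  by apply: pow_le1; [exact: ltW|have := eps_lt n; have := eps_gt0 n => ? ?; apply/andP; split; lra].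
Qed.

Let integrable_pow1 b : 0 < b -> mu.-integrable D (EFin \o (fun t => (1 - t) `^ (b - 1))).
Proof.
move=> b0.
apply: (@ge0_integrable_exhaustion _ D eps (fun n => 1 - eps n)
   (fun t => - b^-1 * (1 - t) `^ b) _ b^-1) => //.
- by move=> t; rewrite inE/= in_itv/= => /andP[_ t1]; exact: continuous_pow1.
- by move=> t _; exact: powR_ge0.
- move=> t; rewrite /= in_itv/= => /andP[_ t1]; have := derive_pow1 b t1 => d1.
  apply: is_derive_eq; rewrite /GRing.scale/=; field; rewrite gt_eqF//.
- move=> n; rewrite -mulrBr mulNr -mulrN ler_piMr// ?invr_ge0 ?(ltW b0)//.
  have := powR_ge0 (1 - (1 - eps n)) b; have : (1 - eps n) `^ b <= 1; last lra.
  by apply: pow_le1; [exact: ltW|have := eps_lt n; have := eps_gt0 n => ? ?; apply/andP; split; lra].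
Qed.

Lemma powRS t c : 0 < t -> t `^ (c + 1) = t `^ c * t.
Proof. by move=> t0; rewrite powRD ?powRr1 ?(ltW t0)// (gt_eqF t0) implybT. Qed.

Lemma measurable_dirichlet_fun a b : measurable_fun D (dirichlet_fun a b).
Proof. exact: measurable_funM. Qed.

Lemma dirichlet_fun_ge0 a b t : 0 <= dirichlet_fun a b t.
Proof. by rewrite mulr_ge0// powR_ge0. Qed.

Lemma dirichlet_funSl a b t : D t -> dirichlet_fun (a + 1) b t = t * dirichlet_fun a b t.
Proof.
rewrite /= in_itv/= => /andP[t0 _]; rewrite /dirichlet_fun.
by rewrite (_ : a + 1 - 1 = a - 1 + 1) ?powRS//; ring.
Qed.

Lemma dirichlet_funSr a b t : D t -> dirichlet_fun a (b + 1) t = (1 - t) * dirichlet_fun a b t.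
Proof.
rewrite /= in_itv/= => /andP[_ t1]; rewrite /dirichlet_fun.
by rewrite (_ : b + 1 - 1 = b - 1 + 1) ?powRS ?subr_gt0//; ring.
Qed.

(** Multiplying by [1 = (1 - t) + t] splits the integrand into two parts, each of which is singular
    at one endpoint at most. *)
Lemma integrable_dirichlet_fun a b : 0 < a -> 0 < b ->
  mu.-integrable D (EFin \o dirichlet_fun a b).
Proof.
move=> a0 b0; apply: (@integrable_dominated _ _ _ mu _ mD _
  (fun t => t `^ (a - 1) + (1 - t) `^ (b - 1))).
- exact: measurable_dirichlet_fun.
- by apply: integrable_EFinD => //; [exact: integrable_pow|exact: integrable_pow1].
- move=> t Dt; rewrite ger0_norm ?dirichlet_fun_ge0//.
  have -> : dirichlet_fun a b t = dirichlet_fun a (b + 1) t + dirichlet_fun (a + 1) b t.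
    by rewrite dirichlet_funSl// dirichlet_funSr//; ring.
  move: Dt; rewrite /= in_itv/= => /andP[t0 t1]; rewrite /dirichlet_fun !addrK.
  apply: lerD.
    by rewrite ler_piMr ?powR_ge0//; apply: pow_le1; [exact: ltW|apply/andP; split; lra].
  by rewrite ler_piMl ?powR_ge0//; apply: pow_le1; [exact: ltW|apply/andP; split; lra].
Qed.

Definition beta_integral a b : R := Rintegral mu D (dirichlet_fun a b).

Lemma beta_integral_gt0 a b : 0 < a -> 0 < b -> 0 < beta_integral a b.
Proof.
move=> a0 b0; rewrite lt_def; apply/andP; split; last first.
  by apply: Rintegral_ge0 => t _; exact: dirichlet_fun_ge0.
apply/negP => /eqP B0.
have ifun := integrable_dirichlet_fun a0 b0.
have mf : measurable_fun D (EFin \o dirichlet_fun a b) by case/integrableP: ifun.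
have I0 : (\int[mu]_(t in D) `|(EFin \o dirichlet_fun a b) t| = 0)%E.
  transitivity (\int[mu]_(t in D) (EFin \o dirichlet_fun a b) t)%E.
    apply: eq_integral => t _ /=; rewrite ger0_norm// dirichlet_fun_ge0//.
  rewrite -[LHS]fineK; last exact: integrable_fin_num.
  by rewrite -[fine _]/(beta_integral a b) B0.
have [N [mN N0 DN]] := (ae_eq_integral_abs mu mD mf).1 I0.
have : (mu D <= mu N)%E.
  apply: le_measure; rewrite ?inE//.
  move=> t Dt; apply: DN => /= /(_ Dt) [] /eqP.
  move: Dt; rewrite /= in_itv/= => /andP[t0 t1].
  by rewrite mulf_eq0 !gt_eqF// powR_gt0// subr_gt0.
by rewrite N0 lebesgue_measure_itv/= lte01 oppr0 adde0 lee_fin ler10.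
Qed.

Lemma beta_integralD a b : 0 < a -> 0 < b ->
  beta_integral (a + 1) b + beta_integral a (b + 1) = beta_integral a b.
Proof.
move=> a0 b0; rewrite /beta_integral -RintegralD//; last 2 first.
  by apply: integrable_dirichlet_fun => //; rewrite addr_gt0.
  by apply: integrable_dirichlet_fun => //; rewrite addr_gt0.
have E t : D t -> dirichlet_fun (a + 1) b t + dirichlet_fun a (b + 1) t = dirichlet_fun a b t.
  by move=> Dt; rewrite dirichlet_funSl// dirichlet_funSr//; ring.
by apply: eq_Rintegral => t /set_mem; exact: E.
Qed.

Let eps_pow_cvg0 a (g : nat -> R) : 0 < a -> (forall n, 0 <= g n <= eps n `^ a) ->
  g n @[n --> \oo] --> (0 : R).
Proof.
move=> a0 g01; apply/cvgrPdist_le => e e0; near=> n.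
have /andP[g0 g1] := g01 n.
rewrite sub0r normrN ger0_norm// (le_trans g1)//.
have h : eps n <= e `^ a^-1 by near: n; apply: eps_small; exact: powR_gt0.
have := ge0_ler_powR (ltW a0); move=> /(_ (eps n) (e `^ a^-1)).
rewrite !nnegrE powR_ge0 (ltW (eps_gt0 n)) => /(_ isT isT h).
by rewrite -powRrM mulVf ?gt_eqF// powRr1// ltW.
Unshelve. all: by end_near. Qed.

(** The difference of the integrands is the derivative of t^a (1 - t)^b, which tends to 0 at both
    ends. Together with [beta_integralD] this is a linear system that determines the two shifted
    integrals. *)
Lemma beta_integral_ibp a b : 0 < a -> 0 < b ->
  a * beta_integral a (b + 1) = b * beta_integral (a + 1) b.
Proof.
move=> a0 b0; apply/eqP; rewrite -subr_eq0; apply/eqP.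
have i1 : mu.-integrable D (EFin \o dirichlet_fun a (b + 1)).
  by apply: integrable_dirichlet_fun => //; rewrite addr_gt0.
have i2 : mu.-integrable D (EFin \o dirichlet_fun (a + 1) b).
  by apply: integrable_dirichlet_fun => //; rewrite addr_gt0.
rewrite /beta_integral -RintegralZl// -RintegralZl// -RintegralB//; last 2 first.
  exact: integrable_EFinZ.
  exact: integrable_EFinZ.
have Bound n : 0 <= eps n <= 1 /\ 0 <= 1 - eps n <= 1.
  by have := eps_lt n; have := eps_gt0 n => h1 h2; split; apply/andP; split; lra.
apply: (@Rintegral_exhaustion _ D eps (fun n => 1 - eps n) (fun t => t `^ a * (1 - t) `^ b)) => //.
- move=> t; rewrite inE/= in_itv/= => /andP[t0 t1].
  rewrite /dirichlet_fun; apply: cvgB; apply: cvgM; try exact: cvg_cst.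
    by apply: cvgM; [exact: continuous_pow|exact: continuous_pow1].
  by apply: cvgM; [exact: continuous_pow|exact: continuous_pow1].
- move=> t; rewrite /= in_itv/= => /andP[t0 t1].
  have := derive_pow a t0; have := derive_pow1 b t1 => d1 d2.
  by apply: is_derive_eq; rewrite /GRing.scale/= /dirichlet_fun !addrK; ring.
- by apply: integrable_EFinB => //; exact: integrable_EFinZ.
- rewrite -[X in _ --> X](subrr (0 : R)); apply: cvgB.
    apply: (eps_pow_cvg0 b0) => n; have [h1 h2] := Bound n.
    rewrite mulr_ge0 ?powR_ge0//= (_ : 1 - (1 - eps n) = eps n); last by ring.
    by rewrite ler_piMl ?powR_ge0//; apply: pow_le1 => //; exact: ltW.
  apply: (eps_pow_cvg0 a0) => n; have [h1 h2] := Bound n.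
  rewrite mulr_ge0 ?powR_ge0//=.
  by rewrite ler_piMr ?powR_ge0//; apply: pow_le1 => //; exact: ltW.
Qed.

Lemma beta_integralSl a b : 0 < a -> 0 < b ->
  beta_integral (a + 1) b = a / (a + b) * beta_integral a b.
Proof.
move=> a0 b0; have := beta_integral_ibp a0 b0; have := beta_integralD a0 b0.
set x := beta_integral (a + 1) b; set y := beta_integral a (b + 1) => <- h.
have ab : a + b != 0 by rewrite gt_eqF// addr_gt0.
apply: (mulfI ab); rewrite mulrA mulrCA mulfV// mulr1 mulrDr h; ring.
Qed.

Lemma beta_integralSr a b : 0 < a -> 0 < b ->
  beta_integral a (b + 1) = b / (a + b) * beta_integral a b.
Proof.
move=> a0 b0; have := beta_integral_ibp a0 b0; have := beta_integralD a0 b0.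
set x := beta_integral (a + 1) b; set y := beta_integral a (b + 1) => <- h.
have ab : a + b != 0 by rewrite gt_eqF// addr_gt0.
apply: (mulfI ab); rewrite mulrA mulrCA mulfV// mulr1 mulrDr -h; ring.
Qed.

(** The Pochhammer symbol, in which shifts of a beta integral by integers are expressed. *)
Definition rising (a : R) (k : nat) : R := \prod_(i < k) (a + i%:R).

Lemma beta_integral_rising a b k l : 0 < a -> 0 < b ->
  beta_integral (a + k%:R) (b + l%:R) =
  rising a k * rising b l / rising (a + b) (k + l) * beta_integral a b.
Proof.
move=> a0 b0.
have r0 c n : 0 < c -> rising c n != 0.
  by move=> c0; rewrite gt_eqF// prodr_gt0// => i _; rewrite ltr_wpDr.
elim: l => [|l IH].
  elim: k => [|k IH].
    by rewrite /rising !big_ord0 !addr0 divr1 !mul1r.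
  rewrite -natr1 addrA beta_integralSl ?ltr_wpDr// IH addn0 !addn0.
  rewrite /rising !big_ord_recr/= !big_ord0 -!/(rising _ _).
  have h1 := r0 (a + b) k (addr_gt0 a0 b0).
  have h2 : a + b + k%:R != 0 by rewrite gt_eqF// ltr_wpDr// addr_gt0.
  by field; rewrite h1 h2.
rewrite -natr1 addrA beta_integralSr ?ltr_wpDr// IH addnS.
rewrite /rising !big_ord_recr/= -!/(rising _ _) natrD.
have h1 := r0 (a + b) (k + l)%N (addr_gt0 a0 b0).
have h2 : a + b + (k%:R + l%:R) != 0 by rewrite gt_eqF// ltr_wpDr ?addr_gt0// addr_ge0.
by field; rewrite h1 h2.
Qed.

End beta_integral.

(** * Closed form and means of the Dirichlet-multinomial law *)

Section dirichlet_multinomial.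
Context (R : realType).
Local Notation mu := (@lebesgue_measure R).
Local Notation D := (`]0, 1[%classic : set R).
Variables (m : nat) (a b : R).
Hypotheses (a0 : 0 < a) (b0 : 0 < b).
Local Notation pmf k := (dirichlet_multinomial_pmf m a b k (m - k)).

Let iZ c (f : R -> R) : mu.-integrable D (EFin \o f) ->
  mu.-integrable D (EFin \o (fun t => c * f t)).
Proof. by move=> fi; exact: integrable_EFinZ. Qed.

Lemma dirichlet_funDn k l t : D t ->
  t ^+ k * (1 - t) ^+ l * dirichlet_fun a b t = dirichlet_fun (a + k%:R) (b + l%:R) t.
Proof.
move=> Dt; elim: l => [|l IH].
  elim: k => [|k IH]; first by rewrite !addr0 expr0 !mul1r.
  by rewrite -natr1 addrA dirichlet_funSl// -IH exprS; ring.
by rewrite -natr1 addrA dirichlet_funSr// -IH exprS; ring.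
Qed.

Let pdf_int k l : mu.-integrable D (EFin \o (fun t => t ^+ k * (1 - t) ^+ l * dirichlet_pdf a b t)) /\
  Rintegral mu D (fun t => t ^+ k * (1 - t) ^+ l * dirichlet_pdf a b t) =
  beta_integral (a + k%:R) (b + l%:R) / beta_integral a b.
Proof.
have i1 : mu.-integrable D (EFin \o dirichlet_fun (a + k%:R) (b + l%:R)).
  by apply: integrable_dirichlet_fun; rewrite ltr_wpDr.
have E t : D t -> t ^+ k * (1 - t) ^+ l * dirichlet_pdf a b t =
    (beta_integral a b)^-1 * dirichlet_fun (a + k%:R) (b + l%:R) t.
  move=> Dt; rewrite -dirichlet_funDn// /dirichlet_pdf -/(beta_integral a b).
  ring.
split.
  have i2 := iZ (beta_integral a b)^-1 i1.
  apply: eq_integrable i2 => // t /set_mem Dt.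
  by rewrite /= E.
rewrite [RHS]mulrC -RintegralZl//.
by apply: eq_Rintegral => t /set_mem; exact: E.
Qed.

(** This integral-free form makes the probability of a vote count a rational expression in the
    parameters, hence measurable in the feature vector. *)
Lemma dirichlet_multinomial_pmfE k : (k <= m)%N ->
  pmf k = 'C(m, k)%:R * (rising a k * rising b (m - k) / rising (a + b) m).
Proof.
move=> km; have [i1 e1] := pdf_int k (m - k).
have B0 : beta_integral a b != 0 by rewrite gt_eqF// beta_integral_gt0.
rewrite /dirichlet_multinomial_pmf.
transitivity ('C(m, k)%:R * Rintegral mu D (fun t => t ^+ k * (1 - t) ^+ (m - k) * dirichlet_pdf a b t)).
  rewrite -RintegralZl//; apply: eq_Rintegral => t _.
  by rewrite /multinomial_pmf subnKC// eqxx; ring.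
by rewrite e1 beta_integral_rising// subnKC// mulfK.
Qed.

Lemma dirichlet_multinomial_pmf_ge0 k : 0 <= pmf k.
Proof.
apply: Rintegral_ge0 => t; rewrite /= in_itv/= => /andP[t0 t1].
rewrite mulr_ge0//.
  rewrite /multinomial_pmf; case: ifP => // _.
  by rewrite !mulr_ge0// exprn_ge0 ?subr_ge0// ltW.
rewrite mulr_ge0 ?dirichlet_fun_ge0// invr_ge0.
by apply: Rintegral_ge0 => x _; exact: dirichlet_fun_ge0.
Qed.

Lemma dirichlet_multinomial_pmf_eq0 k1 k0 : (k1 + k0 != m)%N ->
  dirichlet_multinomial_pmf m a b k1 k0 = 0.
Proof.
move=> /negbTE h; rewrite /dirichlet_multinomial_pmf.
transitivity (Rintegral mu D (cst 0)); last by rewrite Rintegral_cst// mul0r.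
by apply: eq_Rintegral => t _; rewrite /multinomial_pmf h mul0r.
Qed.

(** Given the Dirichlet variable [t], the count is binomial, so its mean under [h] is the integral
    of the polynomial [binomial_mean m t h]. The two fractions are the first and second moments of
    [t]. *)
Lemma dirichlet_multinomial_mean (h : nat -> R) (c0 c1 c2 : R) :
  (forall t, binomial_mean m t h = c0 + c1 * t + c2 * t ^+ 2) ->
  \sum_(k < m.+1) h k * pmf k =
  c0 + c1 * (a / (a + b)) + c2 * (a * (a + 1) / ((a + b) * (a + b + 1))).
Proof.
move=> hE.
have B0 : beta_integral a b != 0 by rewrite gt_eqF// beta_integral_gt0.
have iD k : mu.-integrable D (EFin \o (fun t => h k * 'C(m, k)%:R * (t ^+ k * (1 - t) ^+ (m - k) * dirichlet_pdf a b t))).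
  by apply: integrable_EFinZ => //; exact: (pdf_int _ _).1.
transitivity (\sum_(k < m.+1) Rintegral mu D (fun t => h k * 'C(m, k)%:R * (t ^+ k * (1 - t) ^+ (m - k) * dirichlet_pdf a b t))).
  apply: eq_bigr => k _; rewrite RintegralZl//; last exact: (pdf_int _ _).1.
  rewrite -mulrA; congr (_ * _).
  rewrite -RintegralZl//; last exact: (pdf_int _ _).1.
  apply: eq_Rintegral => t _.
  by rewrite /multinomial_pmf subnKC ?eqxx -1?ltnS//; ring.
rewrite -(@Rintegral_sum _ _ _ mu D (measurable_itv _) _ (index_enum 'I_m.+1) xpredT
  (fun k t => h k * 'C(m, k)%:R * (t ^+ k * (1 - t) ^+ (m - k) * dirichlet_pdf a b t)) (fun k _ => iD k)).2.
have [i0 e0] := pdf_int 0 0; have [i1 e1] := pdf_int 1 0; have [i2 e2] := pdf_int 2 0.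
transitivity (Rintegral mu D (fun t => c0 * (t ^+ 0 * (1 - t) ^+ 0 * dirichlet_pdf a b t) +
   c1 * (t ^+ 1 * (1 - t) ^+ 0 * dirichlet_pdf a b t) +
   c2 * (t ^+ 2 * (1 - t) ^+ 0 * dirichlet_pdf a b t))).
  apply: eq_Rintegral => t _.
  transitivity (binomial_mean m t h * dirichlet_pdf a b t); last by rewrite hE; ring.
  by rewrite /binomial_mean mulr_suml; apply: eq_bigr => k _; ring.
have j0 := iZ c0 i0; have j1 := iZ c1 i1.
have j2 := iZ c2 i2.
rewrite RintegralD//; last exact: integrable_EFinD.
rewrite RintegralD// !RintegralZl// e0 e1 e2.
rewrite !beta_integral_rising// /rising !big_ord_recr !big_ord0/=.
have ab : a + b != 0 by rewrite gt_eqF// addr_gt0.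
have ab1 : a + b + 1 != 0 by rewrite gt_eqF// !addr_gt0.
rewrite !addr0.
by field; rewrite ?ab ?ab1 ?B0.
Qed.

End dirichlet_multinomial.

Section vote_moments.
Context (R : realType) (m : nat) (alpha0 p : R).
Hypotheses (alpha0_gt0 : 0 < alpha0) (p01 : 0 < p < 1).
Local Notation pmf k :=
  (dirichlet_multinomial_pmf m (alpha0 * p) (alpha0 * (1 - p)) k (m - k)).

Let ap : 0 < alpha0 * p. Proof. by case/andP: p01 => p0 _; rewrite mulr_gt0. Qed.

Let aq : 0 < alpha0 * (1 - p).
Proof. by case/andP: p01 => _ p1; rewrite mulr_gt0// subr_gt0. Qed.

Let apq : alpha0 * p + alpha0 * (1 - p) = alpha0. Proof. ring. Qed.

Lemma votes_total : \sum_(k < m.+1) pmf k = 1.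
Proof.
have := @dirichlet_multinomial_mean R m _ _ ap aq (fun=> 1) 1 0 0.
under eq_bigr do rewrite mul1r; rewrite !mul0r !addr0; apply => t.
by rewrite binomial_mean1; ring.
Qed.

Lemma votes_mean : \sum_(k < m.+1) (k%:R - m%:R * p) * pmf k = 0.
Proof.
rewrite (@dirichlet_multinomial_mean R m _ _ ap aq (fun k => k%:R - m%:R * p) (- (m%:R * p)) m%:R 0).
  by rewrite apq mul0r addr0; field; rewrite gt_eqF.
move=> t.
transitivity (binomial_mean m t (fun k => k%:R + (- (m%:R * p)) * 1)).
  by apply: eq_bigr => k _; rewrite mulr1.
by rewrite binomial_meanD binomial_meanZ binomial_mean1 binomial_mean_id; ring.
Qed.

(** Overdispersion multiplies the binomial variance [m p (1 - p)] by [(m + alpha0) / (1 + alpha0)],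
    and the dependence on [p] stays that of the Fisher information. *)
Lemma votes_variance : \sum_(k < m.+1) (k%:R - m%:R * p) ^+ 2 * pmf k =
  (m%:R * (m%:R + alpha0) / (1 + alpha0)) * (p * (1 - p)).
Proof.
rewrite (@dirichlet_multinomial_mean R m _ _ ap aq (fun k => (k%:R - m%:R * p) ^+ 2)
  ((m%:R * p) ^+ 2) (m%:R - 2 * (m%:R * p) * m%:R) (m%:R ^+ 2 - m%:R)).
  rewrite apq; field; rewrite !gt_eqF// ?addr_gt0//.
move=> t.
transitivity (binomial_mean m t (fun k => k%:R ^+ 2 + ((- 2 * (m%:R * p)) * k%:R + (m%:R * p) ^+ 2 * 1))).
  by apply: eq_bigr => k _; congr (_ * _); ring.
rewrite binomial_meanD binomial_meanD binomial_mean_sqr !binomial_meanZ.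
by rewrite binomial_mean1 binomial_mean_id; ring.
Qed.

End vote_moments.

(** * Expectations under a conditional law *)

Section conditional_probability.
Context d d' (T : measurableType d) (U : measurableType d') (R : realType).
Variables (P : probability T R) (X : T -> U) (E : set T) (q : U -> R).
Hypotheses (mX : measurable_fun setT X) (mE : measurable E).
Hypotheses (mq : measurable_fun setT q) (q01 : forall u, 0 <= q u <= 1).
Hypothesis condE : forall B, measurable B ->
  P (X @^-1` B `&` E) = (\int[P]_(w in X @^-1` B) (q (X w))%:E)%E.

Let bq : bmfun (fun w => q (X w)).
Proof.
split; first exact: measurableT_comp.
by exists 1 => w; have /andP[? ?] := q01 (X w); rewrite ger0_norm.
Qed.

Let b1 : bmfun (\1_E : T -> R). Proof. exact: bmfun_indic. Qed.

Let bX (G : U -> R) : bmfun G -> bmfun (fun w => G (X w)).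
Proof. by move=> [mG [K GK]]; split; [exact: measurableT_comp|exists K => w]. Qed.

Let cond_bounded (G : U -> R) : bmfun G ->
  \int[P]_w (G (X w) * \1_E w) = \int[P]_w (G (X w) * q (X w)).
Proof.
move=> bG; apply/eqP; rewrite -subr_eq0; apply/eqP.
pose Phi G := \int[P]_w (G (X w) * \1_E w) - \int[P]_w (G (X w) * q (X w)).
have i1 H : bmfun H -> P.-integrable setT (EFin \o (fun w => H (X w) * \1_E w)).
  by move=> bH; apply: bmfun_integrable; apply: bmfunM => //; exact: bX.
have i2 H : bmfun H -> P.-integrable setT (EFin \o (fun w => H (X w) * q (X w))).
  by move=> bH; apply: bmfun_integrable; apply: bmfunM => //; exact: bX.
apply: (@bmfun_functional_eq0 _ _ R Phi (1 + 1) _ _ _ G bG) => {G bG}.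
- move=> a b f g bf bg; rewrite /Phi.
  have -> : (fun w => (a * f (X w) + b * g (X w)) * \1_E w) =
      (fun w => a * (f (X w) * \1_E w) + b * (g (X w) * \1_E w)).
    by apply/funext => x; ring.
  have -> : (fun w => (a * f (X w) + b * g (X w)) * q (X w)) =
      (fun w => a * (f (X w) * q (X w)) + b * (g (X w) * q (X w))).
    by apply/funext => x; ring.
  rewrite RintegralD//; [|exact: integrable_EFinZ (i1 _ bf)|exact: integrable_EFinZ (i1 _ bg)].
  rewrite RintegralD//; [|exact: integrable_EFinZ (i2 _ bf)|exact: integrable_EFinZ (i2 _ bg)].
  rewrite !RintegralZl//; try exact: i1; try exact: i2.
  ring.
- move=> f bf f01; rewrite /Phi (le_trans (ler_normB _ _))// lerD//.
    apply: bmfun_Rintegral_le; first exact: (bmfunM (bX bf) b1).1.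
    move=> w; have /andP[f0 f1] := f01 (X w).
    rewrite normrM (ger0_norm f0) indicE; case: (_ \in _); rewrite ?normr1 ?normr0 ?mulr1 ?mulr0//.
  apply: bmfun_Rintegral_le; first exact: (bmfunM (bX bf) bq).1.
  move=> w; have /andP[f0 f1] := f01 (X w); have /andP[q0 q1] := q01 (X w).
  by rewrite ger0_norm ?mulr_ge0// mulr_ile1.
- move=> B mB; rewrite /Phi; apply/eqP; rewrite subr_eq0; apply/eqP.
  have mXB : measurable (X @^-1` B) by rewrite -[X in measurable X]setTI; exact: mX.
  transitivity (fine (P (X @^-1` B `&` E))).
    rewrite /Rintegral -(setIT (_ `&` E)) -integral_indic//; last exact: measurableI.
    by congr fine; apply: eq_integral => w _; rewrite indicI.
  rewrite condE//.
  rewrite -[LHS]/(Rintegral P (X @^-1` B) (fun w => q (X w))) Rintegral_mkcond.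
  congr Rintegral; apply/funext => w; rewrite /patch indicE.
  rewrite -[w \in X @^-1` B]/(X w \in B).
  by case: (X w \in B); rewrite ?mul1r ?mul0r.
Qed.

(** The function [q] is a version of the conditional probability of [E] given [X]. From bounded [G]
    the identity extends by truncation: monotone convergence for the absolute value gives
    integrability, and domination then gives the equality. *)
Lemma conditional_Rintegral (G : U -> R) : measurable_fun setT G ->
  P.-integrable setT (EFin \o (fun w => G (X w) * q (X w))) ->
  P.-integrable setT (EFin \o (fun w => G (X w) * \1_E w)) /\
  \int[P]_w (G (X w) * \1_E w) = \int[P]_w (G (X w) * q (X w)).
Proof.
move=> mG iGq.
have mGX : measurable_fun setT (fun w => G (X w)) by exact: measurableT_comp.
have mGq : measurable_fun setT (fun w => G (X w) * q (X w)).
  by apply: measurable_funM => //; exact: bq.1.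
have mGE : measurable_fun setT (fun w => G (X w) * \1_E w).
  by apply: measurable_funM => //; exact: b1.1.
have bt N : bmfun (fun u => trunc N (G u)).
  have [mt [K tK]] := trunc_bmfun R N.
  by split; [exact: measurableT_comp|exists K => u; exact: tK].
have bat N : bmfun (fun u => `|trunc N (G u)|).
  have [mt [K tK]] := bt N.
  by split; [exact: measurableT_comp|exists K => u; rewrite normr_id; exact: tK].
have iab : P.-integrable setT (EFin \o (fun w => `|G (X w)| * \1_E w)).
  apply: (@integrable_nondecreasing _ _ _ P setT measurableT
    (fun N w => `|trunc N (G (X w))| * \1_E w) _ (\int[P]_w `|G (X w) * q (X w)|)).
  - by move=> N; exact: (bmfunM (bX (bat N)) b1).1.
  - by move=> N w _; rewrite mulr_ge0// indicE.
  - move=> N w _; rewrite ler_wpM2r ?indicE//.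
    rewrite /trunc !normrM ler_wpM2l// !indicE.
    have [/set_mem/= h|_] := boolP (G (X w) \in _); last by rewrite normr0.
    by rewrite mem_set//= (le_trans h)// ler_nat.
  - move=> w _; apply: cvgM; last exact: cvg_cst.
    by apply: cvg_norm; exact: trunc_cvg.
  - move=> N; rewrite -[leLHS]fineK; last first.
      apply: integrable_fin_num => //.
      apply: (@bmfun_integrable _ _ _ P (fun w => `|trunc N (G (X w))| * \1_E w)).
      by apply: bmfunM => //; exact: (bX (bat N)).
    rewrite lee_fin.
    rewrite -[leLHS]/(\int[P]_w (`|trunc N (G (X w))| * \1_E w)).
    rewrite (cond_bounded (bat N)); apply: le_Rintegral => //.
    + by apply: bmfun_integrable; apply: bmfunM => //; exact: (bX (bat N)).
    + exact: integrable_norm.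
    + move=> w _; have /andP[q0 q1] := q01 (X w).
      by rewrite [leRHS]normrM (ger0_norm q0) ler_wpM2r// trunc_le.
have iGE : P.-integrable setT (EFin \o (fun w => G (X w) * \1_E w)).
  apply: (integrable_dominated measurableT mGE iab) => w _.
  by rewrite normrM (@ger0_norm _ (\1_E w))// indicE.
split => //.
have c1 : \int[P]_w (trunc N (G (X w)) * \1_E w) @[N --> \oo] --> \int[P]_w (G (X w) * \1_E w).
  apply: (proj2 (@dominated_convergence_Rintegral _ _ _ P setT measurableT
    (fun N w => trunc N (G (X w)) * \1_E w) _ (fun w => `|G (X w)| * \1_E w) _ _ _ _)) => //.
  - by move=> N; exact: (bmfunM (bX (bt N)) b1).1.
  - by move=> w _; apply: cvgM; [exact: trunc_cvg|exact: cvg_cst].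
  - by move=> N w _; rewrite normrM (@ger0_norm _ (\1_E w)) ?ler_wpM2r ?indicE//; exact: trunc_le.
have c2 : \int[P]_w (trunc N (G (X w)) * q (X w)) @[N --> \oo] --> \int[P]_w (G (X w) * q (X w)).
  apply: (proj2 (@dominated_convergence_Rintegral _ _ _ P setT measurableT
    (fun N w => trunc N (G (X w)) * q (X w)) _ (fun w => `|G (X w) * q (X w)|) _ _ _ _)) => //.
  - by move=> N; exact: (bmfunM (bX (bt N)) bq).1.
  - by move=> w _; apply: cvgM; [exact: trunc_cvg|exact: cvg_cst].
  - exact: integrable_norm.
  - by move=> N w _; rewrite normrM [leRHS]normrM ler_wpM2r//; exact: trunc_le.
rewrite -(cvg_lim (@Rhausdorff R) c1) -(cvg_lim (@Rhausdorff R) c2).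
by congr (limn _); apply/funext => N; exact: (cond_bounded (bt N)).
Qed.

End conditional_probability.

Section ae_Rintegral.
Context d (T : measurableType d) (R : realType) (mu : {measure set T -> \bar R}).

Lemma ae_integrable_Rintegral (N : set T) (f g : T -> R) :
  measurable N -> mu N = 0%E -> measurable_fun setT f ->
  (forall w, ~ N w -> f w = g w) -> mu.-integrable setT (EFin \o g) ->
  mu.-integrable setT (EFin \o f) /\ Rintegral mu setT f = Rintegral mu setT g.
Proof.
move=> mN N0 mf fg ig.
have mfE : measurable_fun setT (EFin \o f) by exact/measurable_EFinP.
have mgE : measurable_fun setT (EFin \o g) by case/integrableP: ig.
split.
  apply/(negligible_integrable mN measurableT mfE N0).
  move/(negligible_integrable mN measurableT mgE N0) : ig.
  apply: eq_integrable; first exact: measurableD.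
  by move=> w /set_mem[_ Nw] /=; rewrite fg.
rewrite /Rintegral; congr fine; apply: ae_eq_integral => //.
exists N; split => // w /= H; apply: contrapT => Nw; apply: H => _ /=.
by rewrite fg.
Qed.

End ae_Rintegral.

Section vote_counts.
Context d d' (T : measurableType d) (U : measurableType d') (R : realType).
Variables (P : probability T R) (X : T -> U) (S1 S0 : T -> nat) (m : nat).
Variable q : nat -> U -> R.
Hypotheses (mX : measurable_fun setT X) (mS1 : measurable_fun setT S1)
  (mS0 : measurable_fun setT S0) (mq : forall k, measurable_fun setT (q k)).
Hypothesis q01 : forall k u, 0 <= q k u <= 1.
Hypothesis law : forall (B : set U) (k1 k0 : nat), measurable B ->
  P (X @^-1` B `&` S1 @^-1` [set k1] `&` S0 @^-1` [set k0]) =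
  (\int[P]_(w in X @^-1` B) (if (k1 + k0 == m)%N then q k1 (X w) else 0)%:E)%E.

(** The law is given for the pair of counts, so the event that [S1] is [k] is taken together with
    the matching value of [S0]. *)
Let E (k : nat) : set T := S1 @^-1` [set k] `&` S0 @^-1` [set (m - k)%N].

Let mS (S : T -> nat) k : measurable_fun setT S -> measurable (S @^-1` [set k]).
Proof. by move=> mS; rewrite -[X in measurable X]setTI; exact: mS. Qed.

Let mE k : measurable (E k). Proof. by apply: measurableI; exact: mS. Qed.

Let N : set T := [set w | (S1 w + S0 w != m)%N].

Let NE : N = \bigcup_k1 \bigcup_k0 (if (k1 + k0 == m)%N then set0
  else S1 @^-1` [set k1] `&` S0 @^-1` [set k0]).
Proof.
apply/seteqP; split => w; rewrite /N /=.
  by move=> h; exists (S1 w) => //; exists (S0 w) => //; rewrite (negbTE h).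
by move=> [k1 _ [k0 _]]; case: ifPn => //= h [-> ->].
Qed.

Let mN : measurable N.
Proof.
rewrite NE; apply: bigcupT_measurable => k1; apply: bigcupT_measurable => k0.
by case: ifP => _ //; apply: measurableI; exact: mS.
Qed.

Let PN : P N = 0%E.
Proof.
suff : P.-negligible N by move=> /(negligibleP _ mN).
rewrite NE; apply: negligible_bigcup => k1; apply: negligible_bigcup => k0.
case: ifPn => h; first exact: negligible_set0.
apply/negligibleP; first by apply: measurableI; exact: mS.
have := @law setT k1 k0 measurableT.
by rewrite preimage_setT setTI (negbTE h) integral0.
Qed.

Lemma measurable_fun_votes (F : U -> nat -> R) :
  (forall k, measurable_fun setT (F ^~ k)) ->
  measurable_fun setT (fun w => F (X w) (S1 w)).
Proof.
move=> mF _ B mB; rewrite setTI.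
have -> : (fun w => F (X w) (S1 w)) @^-1` B =
    \bigcup_k ((fun w => F (X w) k) @^-1` B `&` S1 @^-1` [set k]).
  apply/seteqP; split => w /=; first by move=> h; exists (S1 w).
  by move=> [k _ [h ->]].
apply: bigcupT_measurable => k; apply: measurableI; last exact: mS.
rewrite -[X in measurable X]setTI.
by apply: (measurableT_comp (mF k) mX).
Qed.

(** The hypothesis [law] makes [N], the event that the counts do not add up to [m], negligible. Off
    [N], exactly one [E k] with [k <= m] occurs, so the integrand is a finite sum to which the
    conditional formula applies. *)
Lemma Rintegral_votes (F : U -> nat -> R) :
  (forall k, measurable_fun setT (F ^~ k)) ->
  (forall k, P.-integrable setT (EFin \o (fun w => F (X w) k * q k (X w)))) ->
  P.-integrable setT (EFin \o (fun w => F (X w) (S1 w))) /\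
  \int[P]_w F (X w) (S1 w) =
    \sum_(k < m.+1) \int[P]_w (F (X w) k * q k (X w)).
Proof.
move=> mF iF.
have cond (k : 'I_m.+1) : P.-integrable setT (EFin \o (fun w => F (X w) k * \1_(E k) w)) /\
    \int[P]_w (F (X w) k * \1_(E k) w) = \int[P]_w (F (X w) k * q k (X w)).
  apply: (@conditional_Rintegral _ _ _ _ _ P X (E k) (q k) mX (mE k) (mq k) (q01 k) _ (F ^~ k)) => //.
  move=> B mB; rewrite setIA law//; apply: eq_integral => w _.
  by rewrite subnKC ?eqxx// -ltnS.
have [isum esum] := @Rintegral_sum _ _ _ P setT measurableT _ (index_enum 'I_m.+1) xpredT
  (fun k w => F (X w) k * \1_(E k) w) (fun k _ => (cond k).1).
have [|iFS eFS] := @ae_integrable_Rintegral _ _ _ P N (fun w => F (X w) (S1 w)) _ mN PN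
  (measurable_fun_votes mF) _ isum; last first.
  by split => //; rewrite eFS esum; apply: eq_bigr => k _; exact: (cond k).2.
move=> w /negP; rewrite negbK => /eqP Sw.
have Sm : (S1 w < m.+1)%N by rewrite ltnS -Sw leq_addr.
rewrite (bigD1 (Ordinal Sm))//= indicE mem_set ?mulr1; last by split => //=; rewrite -Sw addKn.
rewrite big1 ?addr0// => k kS; rewrite indicE memNset ?mulr0//.
by move=> [/= Sk _]; move/eqP: kS; apply; apply: val_inj => /=.
Qed.

End vote_counts.

(** * Taylor expansion of the logistic log-likelihood *)

Section logistic_calculus.
Context (R : realType) (m : nat).
Implicit Types t h x y : R.

(** Convertible with [logistic v b] at [t = dotv b v], which reduces the calculus to one real
    variable. *)
Definition sigmoid t : R := (1 + expR (- t))^-1.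

Let den0 t : 0 < 1 + expR (- t).
Proof. by rewrite ltr_wpDr// expR_ge0. Qed.

Lemma sigmoid_gt0 t : 0 < sigmoid t.
Proof. by rewrite invr_gt0. Qed.

Lemma sigmoid_lt1 t : sigmoid t < 1.
Proof. by rewrite invf_lt1// ltrDl expR_gt0. Qed.

Let den0' t : 1 + expR t != 0.
Proof. by rewrite gt_eqF// ltr_wpDr// expR_ge0. Qed.

Let sigmoidE t : sigmoid t = expR t / (1 + expR t).
Proof.
have e0 : expR t != 0 by rewrite gt_eqF// expR_gt0.
rewrite /sigmoid expRN (_ : 1 + (expR t)^-1 = (1 + expR t) / expR t) ?invf_div//.
by rewrite mulrDl mul1r mulfV// addrC.
Qed.

Lemma sigmoid_nondecreasing x y : x <= y -> sigmoid x <= sigmoid y.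
Proof.
by move=> xy; rewrite /sigmoid lef_pV2 ?posrE// lerD2l ler_expR lerN2.
Qed.

Lemma is_derive_sigmoid t : is_derive t 1 sigmoid (sigmoid t * (1 - sigmoid t)).
Proof.
have d1 : is_derive t 1 (fun t => 1 + expR (- t)) (- expR (- t)).
  have d2 : is_derive t 1 (fun t => - t) (-1) by apply: is_derive_eq.
  have d3 := @is_derive1_comp _ (@expR R) (fun t => - t) t _ _ _ d2.
  have d4 : is_derive t 1 (fun t => expR (- t)) (expR (- t) * -1) by exact: d3.
  by apply: is_derive_eq; rewrite /GRing.scale/=; ring.
have d0 : 1 + expR (- t) != 0 by rewrite gt_eqF.
have [dg eg] := d1.
apply: DeriveDef; first exact: derivableV.
rewrite deriveV// eg /GRing.scale/= -/(sigmoid t).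
rewrite -exprVn -/(sigmoid t) mulrNN; set s := sigmoid t.
have <- : s * (1 + expR (- t)) = 1 by rewrite mulVf.
ring.
Qed.

Local Notation phi := (phi (R := R) m).

Definition dphi t : R := m%:R * sigmoid t.
Definition d2phi t : R := m%:R * (sigmoid t * (1 - sigmoid t)).
Definition d3phi t : R := m%:R * (sigmoid t * (1 - sigmoid t) * (1 - 2 * sigmoid t)).

Lemma is_derive_phi t : is_derive t 1 phi (dphi t).
Proof.
have d1 : is_derive t 1 (fun t => 1 + expR t) (expR t).
  by apply: is_derive_eq; rewrite /GRing.scale/=; ring.
have p0 : 0 < 1 + expR t by rewrite ltr_wpDr// expR_ge0.
have d2 := @is_derive1_comp _ (@ln R) (fun t => 1 + expR t) t _ _ (is_derive1_ln p0) d1.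
have d3 : is_derive t 1 (fun t => ln (1 + expR t)) ((1 + expR t)^-1 * expR t) by exact: d2.
rewrite /Defs.phi; apply: is_derive_eq; rewrite /GRing.scale/= /dphi sigmoidE; ring.
Qed.

Lemma is_derive_dphi t : is_derive t 1 dphi (d2phi t).
Proof.
have d1 := is_derive_sigmoid t.
by rewrite /dphi; apply: is_derive_eq; rewrite /GRing.scale/= /d2phi; ring.
Qed.

Lemma is_derive_d2phi t : is_derive t 1 d2phi (d3phi t).
Proof.
have d1 := is_derive_sigmoid t.
by rewrite /d2phi; apply: is_derive_eq; rewrite /GRing.scale/= /d3phi; ring.
Qed.

Lemma derive1n_phi3 : phi^`(3)%classic = d3phi.
Proof.
have e1 : phi^`()%classic = dphi.
  by apply/funext => t; rewrite derive1E; have [_ ->] := is_derive_phi t.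
have e2 : dphi^`()%classic = d2phi.
  by apply/funext => t; rewrite derive1E; have [_ ->] := is_derive_dphi t.
have e3 : d2phi^`()%classic = d3phi.
  by apply/funext => t; rewrite derive1E; have [_ ->] := is_derive_d2phi t.
by rewrite !derive1nS derive1n0 e1 e2 e3.
Qed.

(** The mean value bound is applied three times, starting from [d2phi]. The bound on [d3phi] is
    asked only along the segment, because (A2) supplies it only for parameters near [bstar]. *)
Lemma phi_taylor t h (B : R) :
  (forall s, 0 <= s <= 1 -> `|d3phi (t + s * h)| <= B) ->
  `|phi (t + h) - phi t - dphi t * h - d2phi t * h ^+ 2 / 2| <= B * `|h| ^+ 3.
Proof.
move=> hB; have B0 : 0 <= B by rewrite (le_trans _ (hB 0 _))// lexx ler01.
have is_shift (f g : R -> R) : (forall x, is_derive x 1 f (g x)) ->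
    forall y, is_derive y 1 (fun y => f (t + y)) (g (t + y)).
  move=> fg y; have d1 : is_derive y 1 (fun y => t + y) 1.
    by apply: is_derive_eq; rewrite /GRing.scale/=; ring.
  by have := @is_derive1_comp _ f (fun y => t + y) y _ _ (fg _) d1; rewrite mulr1.
have scale s s' : 0 <= s <= 1 -> 0 <= s' <= 1 -> 0 <= s' * s <= 1.
  by move=> /andP[? ?] /andP[? ?]; rewrite mulr_ge0//= mulr_ile1.
have nrm s : 0 <= s <= 1 -> `|s * h| <= `|h|.
  by move=> /andP[s0 s1]; rewrite normrM ger0_norm// ler_piMl.
have h2 s : 0 <= s <= 1 -> `|d2phi (t + s * h) - d2phi t| <= B * `|h|.
  move=> s01; apply: (@le_trans _ _ (B * `|s * h|)); last by rewrite ler_wpM2l// nrm.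
  apply: (mvt_bound is_derive_d2phi) => s' s'01.
  by rewrite mulrA; apply: hB; exact: scale.
have d1 y : is_derive y 1 (fun y => dphi (t + y) - dphi t - d2phi t * y) (d2phi (t + y) - d2phi t).
  have := is_shift _ _ is_derive_dphi y => d.
  by apply: is_derive_eq; rewrite /GRing.scale/=; ring.
have h1 s : 0 <= s <= 1 -> `|dphi (t + s * h) - dphi t - d2phi t * (s * h)| <= B * `|h| ^+ 2.
  move=> s01; apply: (@le_trans _ _ (B * `|h| * `|s * h|)); last first.
    by rewrite expr2 mulrA ler_wpM2l ?mulr_ge0// nrm.
  have := @mvt_bound _ (fun y => dphi (t + y) - dphi t - d2phi t * y) _ 0 (s * h) (B * `|h|) d1.
  rewrite !add0r addr0 mulr0 subr0 subrr subr0; apply => s' s'01.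
  by rewrite add0r mulrA; apply: h2; exact: scale.
have d0 y : is_derive y 1 (fun y => phi (t + y) - phi t - dphi t * y - d2phi t * y ^+ 2 / 2)
    (dphi (t + y) - dphi t - d2phi t * y).
  have := is_shift _ _ is_derive_phi y => d.
  by apply: is_derive_eq; rewrite /GRing.scale/=; field.
have -> : B * `|h| ^+ 3 = B * `|h| ^+ 2 * `|h| by ring.
have := @mvt_bound _ (fun y => phi (t + y) - phi t - dphi t * y - d2phi t * y ^+ 2 / 2) _ 0 h
  (B * `|h| ^+ 2) d0.
rewrite !add0r addr0 expr0n/= !mulr0 mul0r !subr0 subrr subr0; apply => s s01.
by rewrite add0r; exact: h1.
Qed.

Lemma phi_tangent x y : phi x + dphi x * (y - x) <= phi y.
Proof.
have cphi z : {for z, continuous phi}.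
  apply: differentiable_continuous; apply/derivable1_diffP.
  by have [] := is_derive_phi z.
have dmono u v : u <= v -> dphi u <= dphi v.
  by move=> uv; rewrite ler_wpM2l// sigmoid_nondecreasing.
have [xy|yx] := leP x y.
  have [c] := @MVT_segment R phi dphi x y xy (fun z _ => is_derive_phi z)
    (continuous_subspaceT cphi).
  rewrite in_itv/= => /andP[xc cy] e.
  by rewrite -lerBrDl e ler_wpM2r ?subr_ge0// dmono.
have [c] := @MVT_segment R phi dphi y x (ltW yx) (fun z _ => is_derive_phi z)
  (continuous_subspaceT cphi).
rewrite in_itv/= => /andP[yc cx] e.
have h : dphi c * (x - y) <= dphi x * (x - y).
  by rewrite ler_wpM2r ?subr_ge0 ?(ltW yx)// dmono.
rewrite (_ : dphi x * (y - x) = - (dphi x * (x - y))); last by ring.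
by move: e h; lra.
Qed.

(** The tangent at the intermediate point [z] lies below [phi] at [x] and at [y]; averaging the two
    inequalities cancels the slope. *)
Lemma phi_convex x y s : 0 <= s <= 1 ->
  phi (s * x + (1 - s) * y) <= s * phi x + (1 - s) * phi y.
Proof.
move=> /andP[s0 s1]; set z := s * x + _.
have hx := phi_tangent z x; have hy := phi_tangent z y.
have -> : phi z = s * (phi z + dphi z * (x - z)) + (1 - s) * (phi z + dphi z * (y - z)).
  by rewrite /z; ring.
by rewrite lerD// ler_wpM2l// subr_ge0.
Qed.

End logistic_calculus.

(** * Penalized minimization of a nearly quadratic convex function *)

Section l1_norm.
Context (R : realType) (d : nat).
Implicit Types (u v w : 'cV[R]_d) (a s : R).

Definition l1 u : R := \sum_j `|u j ord0|.

Lemma l1_ge0 u : 0 <= l1 u. Proof. exact: sumr_ge0. Qed.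

Lemma l1_coord u j : `|u j ord0| <= l1 u.
Proof. by rewrite /l1 (bigD1 j)//= lerDl sumr_ge0. Qed.

Lemma l1D u v : l1 (u + v) <= l1 u + l1 v.
Proof.
by rewrite /l1 -big_split/=; apply: ler_sum => j _; rewrite mxE ler_normD.
Qed.

Lemma l1Z a u : l1 (a *: u) = `|a| * l1 u.
Proof. by rewrite /l1 mulr_sumr; apply: eq_bigr => j _; rewrite mxE normrM. Qed.

Lemma l1N u : l1 (- u) = l1 u.
Proof. by rewrite -scaleN1r l1Z normrN1 mul1r. Qed.

Lemma dotvDr u v w : dotv u (v + w) = dotv u v + dotv u w.
Proof. by rewrite /dotv mulmxDr mxE. Qed.

Lemma dotvDl u v w : dotv (u + v) w = dotv u w + dotv v w.
Proof. by rewrite !dotvE -big_split; apply: eq_bigr => j _; rewrite mxE mulrDl. Qed.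

Lemma dotvZr a u v : dotv u (a *: v) = a * dotv u v.
Proof. by rewrite /dotv -scalemxAr mxE. Qed.

Lemma dotvC u v : dotv u v = dotv v u.
Proof. by rewrite !dotvE; apply: eq_bigr => j _; rewrite mulrC. Qed.

Lemma dotvZl a u v : dotv (a *: u) v = a * dotv u v.
Proof. by rewrite dotvC dotvZr dotvC. Qed.

Lemma dotvBr u v w : dotv u (v - w) = dotv u v - dotv u w.
Proof. by rewrite dotvDr -scaleN1r dotvZr mulN1r. Qed.

Lemma dotv0 u : dotv u 0 = 0.
Proof. by rewrite -(scale0r 0) dotvZr mul0r. Qed.

Lemma dotv_le_l1 K u v : (forall j, `|u j ord0| <= K) -> `|dotv u v| <= K * l1 v.
Proof.
move=> uK; rewrite dotvE (le_trans (ler_norm_sum _ _ _))// /l1 mulr_sumr.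
by apply: ler_sum => j _; rewrite normrM ler_wpM2r.
Qed.

Lemma dotv_mulmx_sym (J : 'M[R]_d) u v : J^T = J -> dotv u (J *m v) = dotv v (J *m u).
Proof.
move=> sJ; rewrite dotvC /dotv trmx_mul sJ.
by rewrite -mulmxA.
Qed.

End l1_norm.

(* [D] is the increment of the loss and [Q] its quadratic approximation, [kap j]
   is the slope of the penalty in coordinate [j] around the true value [bb],
   [dead j] says that the weight of [j] is infinite, and [us] minimizes [Q] over
   the vectors supported in [A]. *)
Section lasso_deterministic.
Context (R : realType) (d : nat).
Variables (D : 'cV[R]_d -> R) (W bb u us : 'cV[R]_d) (J : 'M[R]_d).
Variables (A : {set 'I_d}) (kap : 'I_d -> R) (dead : pred 'I_d).
Variables (c K Jb eta eta' r C e : R).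
Let Q (v : 'cV[R]_d) := dotv v (J *m v) / 2 - dotv W v.
Hypothesis D_convex : forall x y s, 0 <= s <= 1 ->
  D (s *: x + (1 - s) *: y) <= s * D x + (1 - s) * D y.
Hypothesis D0 : D 0 = 0.
Hypothesis D_quad : forall v, l1 v <= 2 * C -> `|D v - Q v| <= eta.
Hypothesis J_sym : J^T = J.
Hypothesis J_lb : forall v, c * l1 v ^+ 2 <= dotv v (J *m v).
Hypothesis J_ub : forall v, dotv v (J *m v) <= Jb * l1 v ^+ 2.
Hypothesis W_le : forall j, `|W j ord0| <= K.
Hypothesis kap_ge0 : forall j, 0 <= kap j.
Hypothesis bb_supp : forall j, j \notin A -> bb j ord0 = 0.
Hypothesis kap_A : \sum_(j in A) kap j <= eta'.
Hypothesis kap_notA : forall j, j \notin A -> ~~ dead j -> r <= kap j.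
Hypothesis dead_notA : forall j, dead j -> j \notin A.
Hypothesis dead_u : forall j, dead j -> u j ord0 = 0.
Let pen (v : 'cV[R]_d) := \sum_j kap j * `|bb j ord0 + v j ord0|.
Hypothesis u_min : forall v : 'cV[R]_d, (forall j, dead j -> v j ord0 = 0) ->
  D u + pen u <= D v + pen v.
Hypothesis us_supp : forall j, j \notin A -> us j ord0 = 0.
Hypothesis us_stationary : forall v : 'cV[R]_d, (forall j, j \notin A -> v j ord0 = 0) ->
  dotv v (J *m us) = dotv W v.
Hypothesis us_le : l1 us <= C.
Hypotheses (K_ge0 : 0 <= K) (Jb_ge0 : 0 <= Jb) (C_gt0 : 0 < C) (c_gt0 : 0 < c) (eta_le1 : eta <= 1).
Hypotheses (eta'_le1 : eta' <= 1) (e_ge0 : 0 <= e).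
Hypothesis C_large : (K + 1) * C + 1 < c / 2 * C ^+ 2.
Hypothesis r_large : 2 * (K * (2 * C) + Jb / 2 * (2 * C) ^+ 2 + 1) / C < r.
Hypothesis e_large : 4 * eta + 4 * C * eta' <= c * e ^+ 2.

Let pen_A (v : 'cV[R]_d) : (forall j, j \notin A -> v j ord0 = 0) ->
  pen v = \sum_(j in A) kap j * `|bb j ord0 + v j ord0|.
Proof.
move=> vA; rewrite /pen [LHS](bigID (mem A))/= [X in _ + X]big1 ?addr0// => j jA.
by rewrite bb_supp// vA// addr0 normr0 mulr0.
Qed.

Let eta'_ge0 : 0 <= eta'.
Proof. by apply: le_trans kap_A; exact: sumr_ge0. Qed.

Let kap_sum (v : 'cV[R]_d) : \sum_(j in A) kap j * `|v j ord0| <= eta' * l1 v.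
Proof.
apply: (@le_trans _ _ (\sum_(j in A) kap j * l1 v)).
  by apply: ler_sum => j _; rewrite ler_wpM2l// l1_coord.
by rewrite -mulr_suml ler_wpM2r// l1_ge0.
Qed.

Let D_lb v : l1 v <= 2 * C -> c / 2 * l1 v ^+ 2 - K * l1 v - eta <= D v.
Proof.
move=> vC; have := D_quad vC; rewrite ler_norml => /andP[h _].
have hW : dotv W v <= K * l1 v by apply: (le_trans (ler_norm _)); exact: dotv_le_l1.
have hJ : c / 2 * l1 v ^+ 2 <= dotv v (J *m v) / 2.
  by rewrite mulrAC ler_wpM2r// invr_ge0.
by move: h; rewrite /Q; lra.
Qed.

Let D_abs v : l1 v <= 2 * C -> `|D v| <= K * (2 * C) + Jb / 2 * (2 * C) ^+ 2 + 1.
Proof.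
move=> vC; have := D_quad vC; rewrite ler_norml => /andP[h1 h2].
have hW : `|dotv W v| <= K * (2 * C).
  by rewrite (le_trans (dotv_le_l1 v W_le))// ler_wpM2l.
have hl : l1 v ^+ 2 <= (2 * C) ^+ 2.
  by rewrite lerXn2r// nnegrE ?l1_ge0// mulr_ge0// ltW.
have hJ : dotv v (J *m v) / 2 <= Jb / 2 * (2 * C) ^+ 2.
  rewrite mulrAC ler_wpM2r ?invr_ge0// (le_trans (J_ub v))//.
  by rewrite ler_wpM2l.
have hJ0 : 0 <= dotv v (J *m v) / 2.
  rewrite divr_ge0// (le_trans _ (J_lb v))// mulr_ge0 ?(ltW c_gt0)//.
  exact: sqr_ge0.
move: hW; rewrite !ler_norml => /andP[h3 h4]; move: h1 h2; rewrite /Q => h1 h2.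
by apply/andP; split; move: h1 h2 h3 h4 hJ hJ0 eta_le1; lra.
Qed.

Let pen_convex (s : R) : 0 <= s <= 1 -> pen (s *: u) <= s * pen u + (1 - s) * pen 0.
Proof.
move=> /andP[s0 s1]; rewrite /pen !mulr_sumr -big_split; apply: ler_sum => j _ /=.
rewrite !mxE mulrCA [(1 - s) * _]mulrCA -mulrDr ler_wpM2l// addr0.
rewrite -[in X in X * `|_| + _](ger0_norm s0).
have s10 : 0 <= 1 - s by rewrite subr_ge0.
rewrite -[in X in _ + X * `|_|](ger0_norm s10) -!normrM.
rewrite (_ : bb j ord0 + s * u j ord0 =
  s * (bb j ord0 + u j ord0) + (1 - s) * bb j ord0); last by ring.
exact: ler_normD.
Qed.

(** If [u] were outside, the point of the segment from 0 to [u] at radius [C] would, by convexity,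
    have an objective at most that of 0. But there the quadratic growth exceeds the score term, the
    approximation error and the possible decrease of the penalty on [A], which is what [C_large]
    says. *)
Lemma lasso_bounded : l1 u <= C.
Proof.
rewrite leNgt; apply/negP => Cu.
have u0 : 0 < l1 u by apply: lt_trans Cu.
pose s := C / l1 u.
have s01 : 0 <= s <= 1.
  by rewrite divr_ge0 ?(ltW C_gt0) ?(ltW u0)//= ler_pdivrMr// mul1r ltW.
have lsu : l1 (s *: u) = C.
  by case/andP: s01 => s0 _; rewrite l1Z ger0_norm// divfK// gt_eqF.
have CC : C <= 2 * C by move: C_gt0; lra.
have Dlb : c / 2 * C ^+ 2 - K * C - eta <= D (s *: u).
  by have := @D_lb (s *: u); rewrite lsu; apply.
have Ds : D (s *: u) <= s * D u.
  by have := D_convex u 0 s01; rewrite scaler0 addr0 D0 mulr0 addr0.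
have ps := pen_convex s01.
have um : D u + pen u <= pen 0.
  by have := u_min (v := 0); rewrite D0 add0r; apply => j _; rewrite mxE.
have plb : pen 0 - eta' * C <= pen (s *: u).
  have hA : \sum_(j in A) kap j * `|bb j ord0| - eta' * C <=
      \sum_(j in A) kap j * `|bb j ord0 + (s *: u) j ord0|.
    rewrite lerBlDr -[X in eta' * X]lsu.
    rewrite (le_trans _ (lerD (lexx _) (kap_sum (s *: u))))//.
    rewrite -big_split/=; apply: ler_sum => j _.
    rewrite -mulrDr ler_wpM2l//.
    by rewrite -{1}(addrK ((s *: u) j ord0) (bb j ord0)) ler_normB.
  rewrite pen_A; last by move=> j _; rewrite mxE.
  under eq_bigr do rewrite mxE addr0.
  rewrite (le_trans hA)// /pen [leRHS](bigID (mem A))/= lerDl.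
  by apply: sumr_ge0 => j _; rewrite mulr_ge0.
have hs : s * (D u + pen u) <= s * pen 0 by case/andP: s01 => s0 _; rewrite ler_wpM2l.
have e'C : eta' * C <= C by rewrite ler_piMl// ltW.
by move: Dlb Ds ps plb hs C_large eta_le1 e'C; lra.
Qed.

Let drop (v : 'cV[R]_d) : 'cV[R]_d := \col_j (if j \in A then v j ord0 else 0).

(* A convex function bounded by [B] on the ball of radius [2 C] is Lipschitz with
   constant [2 B / C] on the ball of radius [C], so deleting the coordinates
   outside [A] gains more penalty than it loses in [D]. *)
Lemma lasso_sparse j : j \notin A -> u j ord0 = 0.
Proof.
pose l := \sum_(j | j \notin A) `|u j ord0|.
have l0 : 0 <= l by exact: sumr_ge0.
suff l_eq0 : l <= 0.
  move=> jA; apply/eqP; rewrite -normr_le0 (le_trans _ l_eq0)//.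
  by rewrite /l (bigD1 j)//= lerDl sumr_ge0.
rewrite leNgt; apply/negP => lpos.
pose v := drop u.
have vu : l1 (v - u) = l.
  rewrite /l1 (bigID (mem A))/= big1 ?add0r; last first.
    by move=> i iA; rewrite !mxE iA subrr normr0.
  by apply: eq_bigr => i iA; rewrite !mxE (negbTE iA) sub0r normrN.
have lv : l1 v <= l1 u.
  by apply: ler_sum => i _; rewrite mxE; case: ifP; rewrite ?normr0.
have uC := lasso_bounded.
(* The point on the ray from [u] through [v] at distance [C] beyond [v], still in the ball where [D]
   is controlled; [v] is a convex combination of [u] and [z]. *)
pose z := v + (C / l) *: (v - u).
have zC : l1 z <= 2 * C.
  rewrite (le_trans (l1D _ _))// l1Z vu ger0_norm ?divr_ge0 ?(ltW C_gt0)//.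
  by rewrite divfK ?gt_eqF//; move: lv uC; lra.
have u2C : l1 u <= 2 * C by move: uC C_gt0; lra.
have Cl : 0 < C + l by rewrite addr_gt0.
pose t := C / (C + l).
have t01 : 0 <= t <= 1.
  by rewrite divr_ge0 ?(ltW C_gt0) ?(ltW Cl)//= ler_pdivrMr// mul1r lerDl.
have vE : v = t *: u + (1 - t) *: z.
  apply/colP => i; rewrite !mxE; set a := (if _ then _ else _); rewrite /t; field.
  by rewrite !gt_eqF.
have Dv := D_convex u z t01; rewrite -vE in Dv.
have rB := r_large; set B := K * (2 * C) + Jb / 2 * (2 * C) ^+ 2 + 1 in rB.
have Du := D_abs u2C; have Dz := D_abs zC; rewrite -/B in Du Dz.
have um : D u + pen u <= D v + pen v.
  by apply: u_min => i di; rewrite mxE (negbTE (dead_notA di)).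
have pE : pen u = pen v + \sum_(j | j \notin A) kap j * `|u j ord0|.
  rewrite [in RHS]pen_A; last by move=> i iA; rewrite mxE (negbTE iA).
  rewrite /pen [LHS](bigID (mem A))/=; congr (_ + _).
    by apply: eq_bigr => i iA; rewrite mxE iA.
  by apply: eq_bigr => i iA; rewrite bb_supp// add0r.
have rl : r * l <= \sum_(j | j \notin A) kap j * `|u j ord0|.
  rewrite /l mulr_sumr; apply: ler_sum => i iA.
  have [di|ndi] := boolP (dead i); first by rewrite dead_u// normr0 !mulr0.
  by rewrite ler_wpM2r// kap_notA.
have B0 : 0 <= B by apply: le_trans Du.
have h1 : r * l <= (1 - t) * (2 * B).
  have : (1 - t) * (D z - D u) <= (1 - t) * (2 * B).
    rewrite ler_wpM2l ?subr_ge0//; first by case/andP: t01.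
    by move: Du Dz; rewrite !ler_norml => /andP[? ?] /andP[? ?]; lra.
  by move: Dv um rl; rewrite pE; lra.
have h2 : (1 - t) * (2 * B) <= l / C * (2 * B).
  rewrite ler_wpM2r ?mulr_ge0// /t (_ : 1 - C / (C + l) = l / (C + l)); last first.
    by field; rewrite gt_eqF.
  by rewrite ler_wpM2l// lef_pV2 ?posrE// lerDl.
have h3 : l / C * (2 * B) = l * (2 * B / C) by ring.
have h4 : r <= 2 * B / C.
  by rewrite -(ler_pM2l lpos) -h3 mulrC (le_trans h1).
by move: rB; rewrite ltNge h4.
Qed.

(** Once [u] is supported in [A], stationarity of [us] makes [Q u - Q us] equal to half the
    quadratic form at [u - us]. Minimality of [u] bounds this difference by two approximation errors
    and one penalty difference, and [e_large] is the resulting inequality. *)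
Lemma lasso_close : l1 (u - us) <= e.
Proof.
have uA := lasso_sparse; have uC := lasso_bounded.
have u2C : l1 u <= 2 * C by move: uC C_gt0; lra.
have us2C : l1 us <= 2 * C by move: us_le C_gt0; lra.
have um : D u + pen u <= D us + pen us.
  by apply: u_min => j /dead_notA; exact: us_supp.
have uusA j : j \notin A -> (u - us) j ord0 = 0.
  by move=> jA; rewrite !mxE uA// us_supp// subrr.
have l2 : l1 (u - us) <= 2 * C.
  by rewrite (le_trans (l1D _ _))// l1N; move: uC us_le; lra.
have pd : pen us - pen u <= eta' * (2 * C).
  rewrite (pen_A us_supp) (pen_A uA).
  rewrite -sumrB (@le_trans _ _ (\sum_(j in A) kap j * `|(u - us) j ord0|))//.
    apply: ler_sum => j _; rewrite -mulrBr ler_wpM2l//.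
    rewrite (le_trans (lerB_dist _ _))// distrC !mxE.
    by rewrite (_ : _ - _ = u j ord0 - us j ord0)//; ring.
  by rewrite (le_trans (kap_sum _))// ler_wpM2l.
have QE : Q u - Q us = dotv (u - us) (J *m (u - us)) / 2.
  have := us_stationary uusA; have : u = us + (u - us) by rewrite addrC subrK.
  move: (u - us) => h -> st.
  rewrite /Q mulmxDr !dotvDr !dotvDl (dotv_mulmx_sym us h J_sym) st.
  by field.
have h1 := D_quad u2C; have h2 := D_quad us2C.
have hJ := J_lb (u - us).
have hq : c * l1 (u - us) ^+ 2 <= c * e ^+ 2.
  apply: le_trans e_large; apply: (le_trans hJ).
  move: h1 h2; rewrite !ler_norml => /andP[? ?] /andP[? ?].
  by move: QE um pd; lra.
rewrite ler_pM2l// in hq.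
by rewrite -(ler_pXn2r (_ : (0 < 2)%N)) ?nnegrE ?l1_ge0.
Qed.

End lasso_deterministic.

(** * Positive definite matrices *)

Section positive_definite.
Context (R : realType).

(* Schur complement: the congruence below clears the first row and column. *)
Lemma posdefmx_congruent1 n (M : 'M[R]_n) : M^T = M -> posdefmx M ->
  exists B : 'M[R]_n, B *m M *m B^T = 1%:M.
Proof.
elim: n M => [|n IH] M sM pM; first by exists 1%:M; apply/matrixP => -[].
move: M sM pM; rewrite -[n.+1]/(1 + n)%N => M sM pM.
pose a := ulsubmx M ord0 ord0; pose r := ursubmx M; pose N := drsubmx M.
have ME : M = block_mx a%:M r r^T N.
  rewrite -[LHS]submxK -/r -/N; congr (block_mx _ _ _ _); first exact: mx11_scalar.
  by rewrite /r trmx_ursub sM.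
have sN : N^T = N by rewrite /N trmx_drsub sM.
have a0 : 0 < a.
  have := pM (col_mx 1%:M 0); have -> : col_mx 1%:M 0 != 0 :> 'cV[R]_(1 + n).
    apply/negP => /eqP /(congr1 usubmx); rewrite col_mxKu linear0 => /matrixP/(_ ord0 ord0).
    by rewrite !mxE => /eqP; rewrite oner_eq0.
  move=> /(_ isT); rewrite /dotv ME mul_block_col tr_col_mx mul_row_col.
  by rewrite !mulmx0 !addr0 trmx0 mul0mx addr0 trmx1 mul1mx mulmx1 mxE.
pose S := N - a^-1 *: (r^T *m r).
have an0 : a != 0 by rewrite gt_eqF.
have sS : S^T = S by rewrite /S linearB linearZ/= trmx_mul trmxK sN.
have pS : posdefmx S.
  move=> u u0; pose v := col_mx (- a^-1 *: (r *m u)) u.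
  have v0 : v != 0.
    by apply: contra u0 => /eqP /(congr1 dsubmx); rewrite col_mxKd linear0 => ->.
  have := pM v v0; rewrite /dotv ME mul_block_col.
  have -> : a%:M *m (- a^-1 *: (r *m u)) + r *m u = 0.
    by rewrite mul_scalar_mx scalerA mulrN mulfV// scaleN1r addNr.
  have -> : r^T *m (- a^-1 *: (r *m u)) + N *m u = S *m u.
    by rewrite /S mulmxBl -scalemxAr scaleNr addrC -scalemxAl mulmxA.
  by rewrite tr_col_mx mul_row_col mulmx0 add0r.
have [B BS] := IH S sS pS.
pose s := (Num.sqrt a)^-1.
exists (block_mx s%:M 0 (- a^-1 *: (B *m r^T)) B).
rewrite ME mulmx_block tr_block_mx mulmx_block.
rewrite !(mul0mx, mulmx0, addr0, add0r, trmx0).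
have -> : (- a^-1 *: (B *m r^T)) *m a%:M + B *m r^T = 0.
  by rewrite mul_mx_scalar scalerA mulrN mulfV// scaleN1r addNr.
have -> : (- a^-1 *: (B *m r^T)) *m r + B *m N = B *m S.
  by rewrite /S mulmxBr -scalemxAr -scalemxAl scaleNr addrC mulmxA.
rewrite !(mul0mx, mulmx0, addr0, add0r) BS tr_scalar_mx.
have -> : s%:M *m a%:M *m (- a^-1 *: (B *m r^T))^T + s%:M *m r *m B^T = 0.
  rewrite linearZ/= trmx_mul trmxK -scalar_mxM !mul_scalar_mx scalerA -scalemxAl.
  by rewrite mulrN mulfK// scaleNr addNr.
rewrite -!scalar_mxM (_ : s * a * s = 1) -?scalar_mx_block//.
by rewrite mulrAC /s -expr2 exprVn sqr_sqrtr ?mulVf// ltW.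
Qed.

Section congruence.
Variables (n : nat) (M B : 'M[R]_n).
Hypothesis BM : B *m M *m B^T = 1%:M.

Let B_unit : B \in unitmx.
Proof. by case/mulmx1_unit: (etrans (mulmxA _ _ _) BM). Qed.

Let BT_unit : B^T \in unitmx. Proof. by rewrite unitmx_tr. Qed.

Lemma congruent1_inv : invmx M = B^T *m B.
Proof.
have ME : M = invmx B *m invmx B^T.
  by rewrite -[LHS](mulKmx B_unit) -[X in _ *m X](mulmxK BT_unit) BM mul1mx.
have h : (B^T *m B) *m M = 1%:M.
  by rewrite ME mulmxA -(mulmxA _ B) mulmxV// mulmx1 mulmxV.
have Mu : M \in unitmx by case/mulmx1_unit: h.
by rewrite -[RHS](mulmxK Mu) h mul1mx.
Qed.

(** In the coordinates [y] with [v = B^T *m y] the form is a sum of squares, which dominates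
    [l1 y ^+ 2 / n]; and [l1 v] is at most the sum of the entries of [B] in absolute value times
    [l1 y]. *)
Lemma congruent1_lower_bound : exists2 c : R, 0 < c &
  forall v : 'cV[R]_n, c * l1 v ^+ 2 <= dotv v (M *m v).
Proof.
pose b := \sum_i \sum_j `|B i j|.
have b0 : 0 <= b by apply: sumr_ge0 => i _; exact: sumr_ge0.
(* The added 1 keeps the inverse positive in dimension 0. *)
have k0 : 0 < b ^+ 2 * n%:R + 1 by rewrite ltr_wpDl// mulr_ge0// sqr_ge0.
exists (b ^+ 2 * n%:R + 1)^-1; first by rewrite invr_gt0.
move=> v; pose y := invmx B^T *m v.
have vE : v = B^T *m y by rewrite mulKVmx.
have qE : dotv v (M *m v) = \sum_j y j ord0 ^+ 2.
  rewrite {1 2}vE /dotv trmx_mul trmxK !mulmxA -(mulmxA _ B) -(mulmxA _ _ B^T) BM mulmx1.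
  by rewrite -mulmxA -[LHS]/(dotv y y) dotvE; apply: eq_bigr => j _; rewrite expr2.
rewrite mulrC ler_pdivrMr// qE.
have h1 : l1 v <= b * l1 y.
  rewrite vE /l1 (@le_trans _ _ (\sum_j \sum_i `|B i j| * `|y i ord0|))//.
    apply: ler_sum => j _; rewrite mxE (le_trans (ler_norm_sum _ _ _))//.
    by apply: ler_sum => i _; rewrite mxE normrM.
  rewrite exchange_big/= /b mulr_suml; apply: ler_sum => i _.
  rewrite -mulr_suml ler_wpM2l ?sumr_ge0//; exact: l1_coord.
have h2 : l1 y ^+ 2 <= n%:R * \sum_j y j ord0 ^+ 2.
  rewrite expr2 {1}/l1 mulr_suml (@le_trans _ _ (\sum_i \sum_j (y i ord0 ^+ 2 + y j ord0 ^+ 2) / 2))//.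
    apply: ler_sum => i _; rewrite /l1 mulr_sumr; apply: ler_sum => j _.
    rewrite ler_pdivlMr// -[y i ord0 ^+ 2]real_normK ?num_real// -[y j ord0 ^+ 2]real_normK ?num_real//.
    have : 0 <= (`|y i ord0| - `|y j ord0|) ^+ 2 by exact: sqr_ge0.
    by rewrite sqrrB; lra.
  under eq_bigr do rewrite -mulr_suml big_split/= sumr_const card_ord.
  rewrite -mulr_suml big_split/= sumr_const card_ord -sumrMnl ler_pdivrMr// mulr_natl.
  by rewrite sumrMnl -mulr2n -[_ *+ 2]mulr_natr.
have s0 : 0 <= \sum_j y j ord0 ^+ 2 by apply: sumr_ge0 => j _; exact: sqr_ge0.
apply: (@le_trans _ _ ((b * l1 y) ^+ 2)).
  by rewrite lerXn2r// nnegrE ?l1_ge0// mulr_ge0// l1_ge0.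
rewrite exprMn mulrC [leRHS]mulrDr mulr1 ler_wpDr//.
rewrite [leRHS]mulrCA [leRHS]mulrC ler_wpM2r ?sqr_ge0// (le_trans h2)//.
by rewrite mulrC.
Qed.

End congruence.

Lemma posdefmx_unitmx n (M : 'M[R]_n) : M^T = M -> posdefmx M -> M \in unitmx.
Proof.
move=> sM pM; have [B /mulmx1_unit[BMu _]] := posdefmx_congruent1 sM pM.
by move: BMu; rewrite unitmx_mul => /andP[].
Qed.

Lemma quadratic_upper_bound n (M : 'M[R]_n) (v : 'cV[R]_n) (eps : R) :
  (forall i j, `|M i j| <= eps) -> `|dotv v (M *m v)| <= eps * l1 v ^+ 2.
Proof.
move=> Me; rewrite dotvC expr2 mulrA; apply: dotv_le_l1 => i.
rewrite mxE (le_trans (ler_norm_sum _ _ _))// /l1 mulr_sumr.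
by apply: ler_sum => j _; rewrite normrM ler_wpM2r.
Qed.

End positive_definite.

(** * Restriction to the support as matrix algebra *)

Section selection.
Context (R : realType) (d : nat) (A : {set 'I_d}).
Implicit Types (v : 'cV[R]_d) (M : 'M[R]_d).

(** Multiplying by it selects the coordinates in [A], and its transpose pads a short vector with
    zeros. *)
Definition selmx : 'M[R]_(#|A|, d) := rowsub (@enum_val _ (mem A)) 1%:M.

Lemma subvE v : subv A v = selmx *m v.
Proof. by rewrite /subv /selmx mul_rowsub_mx mul1mx. Qed.

Lemma selmx_mulmx_tr : selmx *m selmx^T = 1%:M.
Proof.
apply/matrixP => i j; rewrite mxE (bigD1 (enum_val i))//= !mxE eqxx mul1r.
rewrite big1 ?addr0; last by move=> l /negbTE li; rewrite !mxE eq_sym li mul0r.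
by rewrite (inj_eq (@enum_val_inj _ _)) eq_sym.
Qed.

Lemma submatE M : submat A M = selmx *m M *m selmx^T.
Proof.
apply/matrixP => i j; rewrite !mxE (bigD1 (enum_val j))//= [X in _ + X]big1 ?addr0; last first.
  by move=> l /negbTE lj; rewrite !mxE eq_sym lj mulr0.
rewrite !mxE eqxx mulr1 (bigD1 (enum_val i))//= !mxE eqxx mul1r big1 ?addr0//.
by move=> l /negbTE li; rewrite !mxE eq_sym li mul0r.
Qed.

Lemma selmx_tr_supp (w : 'cV[R]_#|A|) j : j \notin A -> (selmx^T *m w) j ord0 = 0.
Proof.
move=> jA; rewrite mxE big1// => i _; rewrite !mxE.
by case: eqVneq => [ij|_]; [rewrite -ij enum_valP in jA|rewrite mul0r].
Qed.

Lemma selmx_tr_subv v : (forall j, j \notin A -> v j ord0 = 0) ->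
  selmx^T *m subv A v = v.
Proof.
move=> vA; apply/colP => j; have [jA|jA] := boolP (j \in A); last first.
  by rewrite selmx_tr_supp// vA.
rewrite mxE (bigD1 (enum_rank_in jA j))//= !mxE enum_rankK_in// eqxx mul1r.
rewrite big1 ?addr0// => i ij; rewrite !mxE.
case: eqVneq => [E|_]; last by rewrite mul0r.
by exfalso; move/eqP: ij; apply; apply: enum_val_inj; rewrite enum_rankK_in.
Qed.

Lemma posdefmx_submat M : posdefmx M -> posdefmx (submat A M).
Proof.
move=> pM u u0; have w0 : selmx^T *m u != 0.
  by apply: contra u0 => /eqP w0; rewrite -[u]mul1mx -selmx_mulmx_tr -mulmxA w0 mulmx0.
have := pM _ w0; rewrite submatE /dotv trmx_mul trmxK.
by rewrite !mulmxA.
Qed.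

Lemma submat_sym M : M^T = M -> (submat A M)^T = submat A M.
Proof. by move=> sM; rewrite submatE !trmx_mul trmxK sM mulmxA. Qed.

End selection.

(** * Score and information of the vote model *)

Section model.
Context (R : realType) (disp : measure_display) (T : measurableType disp).
Variables (P : probability T R) (d m : nat) (alpha0 : R) (bstar : 'cV[R]_d).
Variable Q : probability (borelV R d) R.
Variables (x : nat -> {RV P >-> borelV R d}) (S1 S0 : nat -> {RV P >-> nat}).
Hypothesis alpha0_gt0 : 0 < alpha0.
Hypothesis x_law : forall i (B : set (borelV R d)), measurable B ->
  P (x i @^-1` B) = Q B.
Hypothesis votes_law : forall i (B : set (borelV R d)) (k1 k0 : nat), measurable B ->
  P (x i @^-1` B `&` S1 i @^-1` [set k1] `&` S0 i @^-1` [set k0]) =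
  (\int[P]_(w in x i @^-1` B)
    (dirichlet_multinomial_pmf m (alpha0 * logistic (x i w) bstar)
      (alpha0 * (1 - logistic (x i w) bstar)) k1 k0)%:E)%E.
Hypothesis indep : mutually_independent P (fun i w => (x i w, S1 i w, S0 i w)).

Local Notation p := (fun v : 'cV[R]_d => logistic v bstar).

Let mx i : measurable_fun setT (x i). Proof. exact: measurable_funPT. Qed.
Let mS1 i : measurable_fun setT (S1 i). Proof. exact: measurable_funPT. Qed.
Let mS0 i : measurable_fun setT (S0 i). Proof. exact: measurable_funPT. Qed.

Let p01 v : 0 < p v < 1.
Proof. by apply/andP; split; [exact: sigmoid_gt0|exact: sigmoid_lt1]. Qed.

Let measurable_sigmoid : measurable_fun setT (@sigmoid R).
Proof.
apply: continuous_measurable_fun => t; apply: differentiable_continuous.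
by apply/derivable1_diffP; have [] := is_derive_sigmoid t.
Qed.

Let measurable_logistic : measurable_fun (setT : set (borelV R d)) p.
Proof. exact: (measurableT_comp measurable_sigmoid (measurable_dotv bstar)). Qed.

Definition vote_pmf (k : nat) (v : 'cV[R]_d) : R :=
  dirichlet_multinomial_pmf m (alpha0 * p v) (alpha0 * (1 - p v)) k (m - k).

Let ap v : 0 < alpha0 * p v. Proof. by have /andP[h _] := p01 v; rewrite mulr_gt0. Qed.
Let aq v : 0 < alpha0 * (1 - p v).
Proof. by have /andP[_ h] := p01 v; rewrite mulr_gt0// subr_gt0. Qed.

(** The subtraction [m - k] is truncated at 0, so the two counts add up to [k] and not to [m]. *)
Lemma vote_pmf_out k v : (m < k)%N -> vote_pmf k v = 0.
Proof.
move=> mk; rewrite /vote_pmf dirichlet_multinomial_pmf_eq0//.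
by rewrite (eqP (ltnW mk : _ - _ == 0)%N) addn0 gtn_eqF.
Qed.

Let pmf01 k v : 0 <= vote_pmf k v <= 1.
Proof.
rewrite dirichlet_multinomial_pmf_ge0/=.
have [km|mk] := ltnP k m.+1; last by rewrite vote_pmf_out.
rewrite -(votes_total m alpha0_gt0 (p01 v)) (bigD1 (Ordinal km))//= lerDl.
by apply: sumr_ge0 => j _; exact: dirichlet_multinomial_pmf_ge0.
Qed.

Let mpmf k : measurable_fun (setT : set (borelV R d)) (vote_pmf k).
Proof.
have [km|mk] := leqP k m; last first.
  by rewrite (_ : vote_pmf k = cst 0)//; apply/funext => v; exact: vote_pmf_out.
have mrising (f : borelV R d -> R) n : measurable_fun setT f ->
    measurable_fun setT (fun v => rising (f v) n).
  by move=> mf; apply: measurable_prod => i _; exact: measurable_funD.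
have -> : vote_pmf k = fun v => 'C(m, k)%:R *
    (rising (alpha0 * p v) k * rising (alpha0 * (1 - p v)) (m - k) / rising alpha0 m).
  apply/funext => v; rewrite /vote_pmf dirichlet_multinomial_pmfE//.
  by rewrite (_ : alpha0 * p v + alpha0 * (1 - p v) = alpha0)//; ring.
apply: measurable_funM => //; apply: measurable_funM => //; apply: measurable_funM.
  by apply: mrising; exact: measurable_funM.
by apply: mrising; apply: measurable_funM => //; exact: measurable_funB.
Qed.

Lemma Rintegral_feature i (g : borelV R d -> R) : measurable_fun setT g ->
  Q.-integrable setT (EFin \o g) ->
  P.-integrable setT (EFin \o (fun w => g (x i w))) /\
  \int[P]_w g (x i w) = \int[Q]_v g v.
Proof.
move=> mg ig.
exact: (@integrable_same_law _ _ _ _ _ _ R P Q (x i) id (mx i) (@measurable_id _ _ _)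
  (x_law i) g mg ig).
Qed.

Lemma Rintegral_vote i (F : borelV R d -> nat -> R) :
  (forall k, measurable_fun setT (F ^~ k)) ->
  (forall k, Q.-integrable setT (EFin \o (fun v => F v k * vote_pmf k v))) ->
  P.-integrable setT (EFin \o (fun w => F (x i w) (S1 i w))) /\
  \int[P]_w F (x i w) (S1 i w) =
    \sum_(k < m.+1) \int[Q]_v (F v k * vote_pmf k v).
Proof.
move=> mF iF.
have tr k := @Rintegral_feature i (fun v => F v k * vote_pmf k v)
  (measurable_funM (mF k) (mpmf k)) (iF k).
have [|i1 e1] := @Rintegral_votes _ _ _ _ R P (x i) (S1 i) (S0 i) m vote_pmf (mx i)
  (mS1 i) (mS0 i) mpmf pmf01 _ F mF (fun k => (tr k).1).
  move=> B k1 k0 mB; rewrite votes_law//; apply: eq_integral => w _.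
  case: eqP => [E|/eqP h]; first by rewrite /vote_pmf -E addKn.
  by rewrite dirichlet_multinomial_pmf_eq0.
by split => //; rewrite e1; apply: eq_bigr => k _; exact: (tr k).2.
Qed.

(** Independence is the hypothesis [indep] read through a measurable function of the triple.
    Identical distribution is derived: [PE] expresses each probability through [Q] and [vote_pmf],
    which do not involve the index. *)
Lemma iid_votes (F : borelV R d -> nat -> R) :
  (forall k, measurable_fun setT (F ^~ k)) ->
  iid P (fun i w => F (x i w) (S1 i w)).
Proof.
move=> mF.
have mFi i : measurable_fun setT (fun w => F (x i w) (S1 i w)).
  exact: measurable_fun_votes.
split => // [n B mB|i B mB].
- pose h (u : borelV R d * nat * nat) := F u.1.1 u.1.2.
  have mh : measurable_fun setT h.
    apply: (@measurable_fun_votes _ _ (borelV R d * nat * nat)%type (borelV R d) R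
      (fun u => u.1.1) (fun u => u.1.2)); last exact: mF.
      exact: (measurableT_comp measurable_fst measurable_fst).
    exact: (measurableT_comp measurable_snd measurable_fst).
  pose J := [fset i in iota 0 n]%fset.
  have := indep J (B := fun i => h @^-1` B i).
  have -> : \bigcap_(i in [set` J]) ((fun w => (x i w, S1 i w, S0 i w)) @^-1` (h @^-1` B i)) =
      \bigcap_(i in `I_n) ((fun w => F (x i w) (S1 i w)) @^-1` B i).
    apply/seteqP; split => w H i /= iJ.
      by apply: (H i); rewrite /= /J !inE/= mem_iota.
    by apply: H; move: iJ; rewrite /J !inE/= mem_iota.
  move=> ->; last first.
    by move=> i; rewrite -[X in measurable X]setTI; exact: mh.
  rewrite (perm_big (iota 0 n)); last first.
    apply: uniq_perm; [exact: fset_uniq|exact: iota_uniq|].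
    by move=> i; rewrite /J !inE/=.
  by rewrite -{1}[n]subn0 -/(index_iota 0 n) big_mkord.
- have PE j : P ((fun w => F (x j w) (S1 j w)) @^-1` B) =
      (\sum_(k < m.+1) \int[Q]_v (\1_B (F v k) * vote_pmf k v))%:E.
    have mj : measurable ((fun w => F (x j w) (S1 j w)) @^-1` B).
      by rewrite -[X in measurable X]setTI; exact: mFi.
    have m1 k : measurable_fun setT (fun v => \1_B (F v k) : R).
      by apply: (measurableT_comp _ (mF k)); exact: measurable_indic.
    have iI k : Q.-integrable setT (EFin \o (fun v => \1_B (F v k) * vote_pmf k v)).
      apply: bmfun_integrable; apply: bmfunM.
        split; first exact: m1.
        by exists 1 => v; rewrite indicE; case: (_ \in _); rewrite ?normr1 ?normr0.
      by split => //; exists 1 => v; have /andP[? ?] := pmf01 k v; rewrite ger0_norm.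
    have [_ <-] := @Rintegral_vote j (fun v k => \1_B (F v k)) m1 iI.
    rewrite /Rintegral -[LHS]fineK ?fin_num_measure//; congr (fine _)%:E.
    by rewrite -[RHS]/(\int[P]_w (\1_((fun w => F (x j w) (S1 j w)) @^-1` B) w)%:E)%E integral_indic// setIT.
  by rewrite !PE.
Qed.

Lemma iid_features (g : borelV R d -> R) : measurable_fun setT g ->
  iid P (fun i w => g (x i w)).
Proof. by move=> mg; exact: (@iid_votes (fun v _ => g v)). Qed.

Hypothesis A1 : fisher_assumption Q bstar.

Let I := fisher Q bstar.

Lemma fisher_sym : I^T = I.
Proof.
apply/matrixP => j k; rewrite !mxE; congr Rintegral; apply/funext => v.
by rewrite /fisher_integrand (mulrC (v k ord0)).
Qed.

Lemma fisher_quadratic (theta : 'cV[R]_d) :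
  Q.-integrable setT (EFin \o (fun v => dotv theta v ^+ 2 * (p v * (1 - p v)))) /\
  \int[Q]_v (dotv theta v ^+ 2 * (p v * (1 - p v))) = dotv theta (I *m theta).
Proof.
pose h j k (v : 'cV[R]_d) := theta j ord0 * theta k ord0 * fisher_integrand bstar j k v.
have ih j k : Q.-integrable setT (EFin \o (h j k : borelV R d -> R)).
  by apply: integrable_EFinZ => //; exact: A1.1.
have row j := @Rintegral_sum _ _ _ Q setT measurableT _ (index_enum 'I_d) xpredT (h j)
  (fun k _ => ih j k).
have [isum esum] := @Rintegral_sum _ _ _ Q setT measurableT _ (index_enum 'I_d) xpredT
  (fun j v => \sum_k h j k v) (fun j _ => (row j).1).
have E v : dotv theta v ^+ 2 * (p v * (1 - p v)) = \sum_j \sum_k h j k v.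
  rewrite expr2 dotvE !mulr_suml; apply: eq_bigr => j _.
  rewrite mulr_sumr mulr_suml; apply: eq_bigr => k _.
  by rewrite /h /fisher_integrand; ring.
have EF : (fun v => dotv theta v ^+ 2 * (p v * (1 - p v))) = fun v => \sum_j \sum_k h j k v.
  exact/funext.
rewrite EF; split => //; rewrite esum dotvE; apply: eq_bigr => j _.
rewrite (row j).2 mxE mulr_sumr; apply: eq_bigr => k _.
rewrite /h RintegralZl//; last exact: A1.1.
by rewrite mxE; ring.
Qed.

Let kappa : R := m%:R * (m%:R + alpha0) / (1 + alpha0).

(** The derivative at [bstar], in the direction [theta], of the log-likelihood of [k] votes for a
    feature vector [v]. *)
Definition score (theta v : 'cV[R]_d) (k : nat) : R := (k%:R - m%:R * p v) * dotv theta v.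

Let measurable_score theta k : measurable_fun (setT : set (borelV R d)) (fun v => score theta v k).
Proof.
apply: measurable_funM; last exact: measurable_dotv.
by apply: measurable_funB => //; exact: measurable_funM.
Qed.

Let score_sqr_sum theta v : \sum_(k < m.+1) score theta v k ^+ 2 * vote_pmf k v =
  kappa * (dotv theta v ^+ 2 * (p v * (1 - p v))).
Proof.
rewrite [RHS](_ : _ = dotv theta v ^+ 2 * (kappa * (p v * (1 - p v)))); last by ring.
rewrite -(votes_variance m alpha0_gt0 (p01 v)) mulr_sumr; apply: eq_bigr => k _.
rewrite /score exprMn -/(vote_pmf k v); ring.
Qed.

(** A single term is at most the whole conditional second moment, a multiple of the integrand of the
    Fisher information; this is how (A1) makes the score square integrable. *)
Let score_sqr_term theta (k : nat) v : 0 <= score theta v k ^+ 2 * vote_pmf k v <=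
  kappa * (dotv theta v ^+ 2 * (p v * (1 - p v))).
Proof.
have t0 j : 0 <= score theta v j ^+ 2 * vote_pmf j v.
  by rewrite mulr_ge0 ?sqr_ge0//; have /andP[] := pmf01 j v.
rewrite t0/= -score_sqr_sum; have [km|mk] := ltnP k m.+1.
  by rewrite (bigD1 (Ordinal km))//= lerDl; exact: sumr_ge0.
by rewrite vote_pmf_out// mulr0; exact: sumr_ge0.
Qed.

Let integrable_score_sqr_pmf theta k :
  Q.-integrable setT (EFin \o (fun v => score theta v k ^+ 2 * vote_pmf k v)).
Proof.
apply: (@integrable_dominated _ _ _ Q _ measurableT _
    (fun v => kappa * (dotv theta v ^+ 2 * (p v * (1 - p v))))).
- by apply: measurable_funM => //; apply: measurable_funX.
- by apply: integrable_EFinZ => //; exact: (fisher_quadratic theta).1.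
- by move=> v _; have /andP[h1 h2] := score_sqr_term theta k v; rewrite ger0_norm.
Qed.

Let integrable_score_pmf theta k :
  Q.-integrable setT (EFin \o (fun v => score theta v k * vote_pmf k v)).
Proof.
apply: (@integrable_dominated _ _ _ Q _ measurableT _
    (fun v => 1 + score theta v k ^+ 2 * vote_pmf k v)).
- exact: measurable_funM.
- exact: (integrable_EFinD measurableT (bmfun_integrable Q (bmfun_cst _ 1))
    (integrable_score_sqr_pmf theta k)).
move=> v _; have /andP[q0 q1] := pmf01 k v; rewrite normrM (ger0_norm q0).
have : 0 <= (`|score theta v k| - 1) ^+ 2 by exact: sqr_ge0.
rewrite -[X in 1 + X * _]real_normK ?num_real//.
have : 0 <= `|score theta v k| by [].
by move: (`|_|) (vote_pmf k v) q0 q1 => s q q0 q1; nra.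
Qed.

Lemma score_moments theta i :
  [/\ P.-integrable setT (EFin \o (fun w => score theta (x i w) (S1 i w))),
      \int[P]_w score theta (x i w) (S1 i w) = 0,
      P.-integrable setT (EFin \o (fun w => score theta (x i w) (S1 i w) ^+ 2)) &
      \int[P]_w (score theta (x i w) (S1 i w) ^+ 2) = kappa * dotv theta (I *m theta)].
Proof.
have [i1 e1] := @Rintegral_vote i (score theta) (measurable_score theta)
  (integrable_score_pmf theta).
have msqr k : measurable_fun (setT : set (borelV R d)) (fun v => score theta v k ^+ 2).
  by apply: measurable_funX.
have [i2 e2] := @Rintegral_vote i (fun v k => score theta v k ^+ 2) msqr
  (integrable_score_sqr_pmf theta).
split => //.
- rewrite e1.
  have [_ <-] := @Rintegral_sum _ _ _ Q setT measurableT _ (index_enum 'I_m.+1) xpredT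
    (fun (k : 'I_m.+1) v => score theta v k * vote_pmf k v)
    (fun (k : 'I_m.+1) _ => integrable_score_pmf theta k).
  rewrite -[RHS](Rintegral_probability_cst Q 0); congr Rintegral; apply/funext => v.
  transitivity (dotv theta v * 0); last by rewrite mulr0.
  rewrite -[X in _ = _ * X](votes_mean m alpha0_gt0 (p01 v)) mulr_sumr.
  by apply: eq_bigr => k _; rewrite /score /vote_pmf; ring.
- rewrite e2.
  have [_ <-] := @Rintegral_sum _ _ _ Q setT measurableT _ (index_enum 'I_m.+1) xpredT
    (fun (k : 'I_m.+1) v => score theta v k ^+ 2 * vote_pmf k v)
    (fun (k : 'I_m.+1) _ => integrable_score_sqr_pmf theta k).
  rewrite -(fisher_quadratic theta).2 -RintegralZl//; last exact: (fisher_quadratic theta).1.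
  by congr Rintegral; apply/funext => v; rewrite score_sqr_sum.
Qed.

Let iid_score theta : iid P (fun i w => score theta (x i w) (S1 i w)).
Proof. exact: iid_votes. Qed.

Definition scaled_score (n : nat) (w : T) : 'cV[R]_d :=
  (Num.sqrt n%:R)^-1 *: \sum_(i < n) ((S1 i w)%:R - m%:R * p (x i w)) *: (x i w : 'cV[R]_d).

Lemma dotv_scaled_score theta n w : dotv theta (scaled_score n w) =
  (Num.sqrt n%:R)^-1 * \sum_(i < n) score theta (x i w) (S1 i w).
Proof.
rewrite dotvZr; congr (_ * _); elim/big_ind2: _ => [|u a v b <- <-|i _].
- exact: dotv0.
- exact: dotvDr.
- by rewrite dotvZr.
Qed.

Lemma measurable_scaled_score theta n :
  measurable_fun setT (fun w => dotv theta (scaled_score n w)).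
Proof.
under eq_fun do rewrite dotv_scaled_score.
apply: measurable_funM => //; apply: measurable_sum => i; exact: measurable_fun_votes.
Qed.

(** Cramer-Wold reduction: in a fixed direction the scaled score is a normalized sum of centred real
    variables, covered by [central_limit_cf]. *)
Lemma scaled_score_cf theta :
  \int[P]_w cos (dotv theta (scaled_score n w)) @[n --> \oo] -->
    expR (- (kappa * dotv theta (I *m theta) / 2)) /\
  \int[P]_w sin (dotv theta (scaled_score n w)) @[n --> \oo] --> 0.
Proof.
have [mX indX lawX] := iid_score theta.
have [i0 m0 i2 <-] := score_moments theta 0.
have same (f : R -> R) i : bmfun f ->
    \int[P]_w f (score theta (x i w) (S1 i w)) = \int[P]_w f (score theta (x 0 w) (S1 0 w)).
  move=> [mf [K fK]]; apply: (@iid_integrable _ _ _ _ _ (iid_score theta) f i mf _).2.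
  apply: bmfun_integrable; split; first exact: (measurableT_comp mf (mX 0)).
  by exists K => w; exact: fK.
have bscale (g : R -> R) (t : R) : bmfun g -> bmfun (fun y : R => g (t * y)).
  by move=> [mg [K gK]]; split; [exact: measurableT_comp|exists K => y; exact: gK].
have cosX i t : \int[P]_w cos (t * score theta (x i w) (S1 i w)) =
    \int[P]_w cos (t * score theta (x 0 w) (S1 0 w)).
  exact: (same (fun y : R => cos (t * y)) i (bscale _ _ (bmfun_cos R))).
have sinX i t : \int[P]_w sin (t * score theta (x i w) (S1 i w)) =
    \int[P]_w sin (t * score theta (x 0 w) (S1 0 w)).
  exact: (same (fun y : R => sin (t * y)) i (bscale _ _ (bmfun_sin R))).
have [h1 h2] := central_limit_cf mX indX cosX sinX i0 i2 m0.
by split; under eq_fun do under eq_Rintegral do rewrite dotv_scaled_score.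
Qed.

(** Chebyshev's inequality: after scaling, the second moment of a coordinate is the same for all
    [n > 0]. *)
Lemma scaled_score_tight (e : R) j : 0 < e -> exists2 K, 0 < K &
  \forall n \near \oo, measurable [set w | K < `|scaled_score n w j ord0|] /\
    (P [set w | K < `|scaled_score n w j ord0|]%R <= e%:E)%E.
Proof.
move=> e0; pose theta : 'cV[R]_d := delta_mx j ord0.
have thetaE v : dotv theta v = v j ord0.
  rewrite dotvE (bigD1 j)//= mxE !eqxx mul1r big1 ?addr0// => k kj.
  by rewrite mxE (negbTE kj) mul0r.
have [_ m0 i2 s2] := score_moments theta 0.
pose v2 := kappa * dotv theta (I *m theta).
have v20 : 0 <= v2 by rewrite /v2 -s2; apply: Rintegral_ge0 => w _; exact: sqr_ge0.
(* This gives [v2 / K ^+ 2 <= e]; the added 1 keeps [K] positive when the variance [v2] is 0. *)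
pose K := Num.sqrt ((v2 + 1) / e).
have Ke : 0 < (v2 + 1) / e by rewrite divr_gt0// ltr_wpDl.
have K0 : 0 < K by rewrite sqrtr_gt0.
exists K => //; near=> n.
have n0 : 0 < n%:R :> R by rewrite ltr0n; near: n; exact: nbhs_infty_gt.
have [iZ eZ] := Rintegral_sqr_sum (iid_score theta) i2 m0 n.
have sqrE w : scaled_score n w j ord0 ^+ 2 =
    n%:R^-1 * (\sum_(i < n) score theta (x i w) (S1 i w)) ^+ 2.
  by rewrite -thetaE dotv_scaled_score exprMn exprVn sqr_sqrtr// ltW.
have iW : P.-integrable setT (EFin \o (fun w => scaled_score n w j ord0 ^+ 2)).
  rewrite (_ : (fun w => _) = fun w => n%:R^-1 * (\sum_(i < n) score theta (x i w) (S1 i w)) ^+ 2).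
    exact: integrable_EFinZ.
  exact/funext.
split.
  apply: measurable_norm_gt; under eq_fun do rewrite -thetaE.
  exact: measurable_scaled_score.
have := @markov_Rintegral _ _ _ P (fun w => scaled_score n w j ord0 ^+ 2) (K ^+ 2) _ iW.
rewrite exprn_gt0// => /(_ isT).
have -> : [set w | K ^+ 2 < `|scaled_score n w j ord0 ^+ 2|] =
    [set w | K < `|scaled_score n w j ord0|].
  by apply/seteqP; split => w /=; rewrite normrX ltr_pXn2r// nnegrE ?normr_ge0// (ltW K0).
move=> /le_trans; apply; rewrite lee_fin.
rewrite (_ : (fun w => `|_|) = fun w => n%:R^-1 * (\sum_(i < n) score theta (x i w) (S1 i w)) ^+ 2); last first.
  by apply/funext => w; rewrite ger0_norm ?sqr_ge0// sqrE.
rewrite RintegralZl// eZ s2 mulKf ?gt_eqF// -/v2 sqr_sqrtr ?(ltW Ke)//.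
rewrite invf_div mulrAC ler_pdivrMr ?ltr_wpDl//.
by rewrite ler_wpM2l ?(ltW e0)// lerDl.
Unshelve. all: by end_near. Qed.

Definition empirical_information (n : nat) (w : T) : 'M[R]_d :=
  n%:R^-1 *: \sum_(i < n) (m%:R * (p (x i w) * (1 - p (x i w)))) *:
    ((x i w : 'cV[R]_d) *m (x i w : 'cV[R]_d)^T).

Lemma empirical_information_coord n w j k : empirical_information n w j k =
  n%:R^-1 * \sum_(i < n) (m%:R * fisher_integrand bstar j k (x i w)).
Proof.
rewrite mxE summxE; congr (_ * _); apply: eq_bigr => i _.
by rewrite !mxE big_ord1 mxE /fisher_integrand; ring.
Qed.

Lemma vanishing_mean_prob (Z : nat -> T -> R) (a e : R) : 0 < a -> 0 < e ->
  (forall n, P.-integrable setT (EFin \o Z n)) ->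
  \int[P]_w `|Z n w| @[n --> \oo] --> 0 ->
  \forall n \near \oo, measurable [set w | a < `|Z n w|] /\
    (P [set w | (a < `|Z n w|)%R] <= e%:E)%E.
Proof.
move=> a0 e0 iZ Z0; near=> n; split.
  by apply: measurable_norm_gt; apply/measurable_EFinP; case/integrableP: (iZ n).
apply: (le_trans (markov_Rintegral a0 (iZ n))); rewrite lee_fin.
rewrite mulrC ler_pdivrMr// ltW//; near: n.
have := cvgr_lt 0 Z0 (e * a); apply; exact: mulr_gt0.
Unshelve. all: by end_near. Qed.

Lemma empirical_information_cvg (a e : R) j k : 0 < a -> 0 < e ->
  \forall n \near \oo,
    measurable [set w | a < `|empirical_information n w j k - m%:R * I j k|] /\
    (P [set w | (a < `|empirical_information n w j k - m%:R * I j k|)%R] <= e%:E)%E.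
Proof.
move=> a0 e0; pose g v : R := m%:R * fisher_integrand bstar j k v.
have ig : Q.-integrable setT (EFin \o (g : borelV R d -> R)).
  by apply: integrable_EFinZ => //; exact: A1.1.
have mg : measurable_fun (setT : set (borelV R d)) g.
  by apply/measurable_EFinP; case/integrableP: ig.
have [i0 e0'] := Rintegral_feature 0 mg ig.
have iidg : iid P (fun i w => g (x i w)) by exact: iid_features.
have := weak_law_of_large_numbers iidg i0.
have -> : \int[P]_w g (x 0 w) = m%:R * I j k.
  by rewrite e0' /g RintegralZl//; [rewrite mxE|exact: A1.1].
move=> h; apply: vanishing_mean_prob => //.
- move=> n; under eq_fun do rewrite empirical_information_coord.
  have i1 := (proj1 (@Rintegral_sum _ _ _ P setT measurableT _ (index_enum 'I_n) xpredT
    (fun (i : 'I_n) w => g (x i w)) (fun (i : 'I_n) _ => (Rintegral_feature i mg ig).1))).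
  apply: integrable_EFinB => //; first exact: integrable_EFinZ.
  exact: (bmfun_integrable P (bmfun_cst _ _)).
- by under eq_fun do under eq_Rintegral do rewrite empirical_information_coord.
Qed.

Section remainder.
Variable M : 'cV[R]_d -> R.
Hypothesis M_ge0 : forall v, 0 <= M v.
Hypothesis iM : forall j k l : 'I_d, Q.-integrable setT
  (EFin \o ((fun v : 'cV[R]_d => M v * `|v j ord0 * v k ord0 * v l ord0|) : borelV R d -> R)).

Let g (v : 'cV[R]_d) : R := M v * l1 v ^+ 3.

(** Expanding the cube of the [l1] norm yields the triple sum of the integrands of (A2). *)
Let ig : Q.-integrable setT (EFin \o (g : borelV R d -> R)).
Proof.
pose h j k l (v : 'cV[R]_d) := M v * `|v j ord0 * v k ord0 * v l ord0|.
have -> : g = fun v => \sum_j \sum_k \sum_l h j k l v.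
  apply/funext => v; rewrite /g /l1 !exprS expr0 mulr1 mulr_suml mulr_sumr.
  apply: eq_bigr => j _; rewrite mulr_suml !mulr_sumr; apply: eq_bigr => k _.
  by rewrite !mulr_sumr; apply: eq_bigr => l _; rewrite /h !normrM; ring.
have isum (F : 'I_d -> borelV R d -> R) : (forall j, Q.-integrable setT (EFin \o F j)) ->
    Q.-integrable setT (EFin \o (fun v => \sum_j F j v)).
  by move=> iF; apply: (proj1 (@Rintegral_sum _ _ _ Q setT measurableT _ (index_enum 'I_d) xpredT F _)).
apply: (isum (fun j v => \sum_k \sum_l h j k l v)) => j.
apply: (isum (fun k v => \sum_l h j k l v)) => k.
by apply: (isum (fun l v => h j k l v)) => l; exact: iM.
Qed.

(** The third order Taylor error carries the factor n^(-3/2): one [1 / n] turns the sum into an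
    average with a fixed mean, and the remaining n^(-1/2) sends it to 0. *)
Definition cubic_remainder (n : nat) (w : T) : R :=
  (Num.sqrt n%:R)^-1 * (n%:R^-1 * \sum_(i < n) (M (x i w) * l1 (x i w) ^+ 3)).

Lemma cubic_remainder_cvg (a e : R) : 0 < a -> 0 < e ->
  \forall n \near \oo, measurable [set w | a < `|cubic_remainder n w|] /\
    (P [set w | (a < `|cubic_remainder n w|)%R] <= e%:E)%E.
Proof.
move=> a0 e0; have mg : measurable_fun (setT : set (borelV R d)) g.
  by apply/measurable_EFinP; case/integrableP: ig.
have gx i := Rintegral_feature i mg ig.
have s n := @Rintegral_sum _ _ _ P setT measurableT _ (index_enum 'I_n) xpredT
    (fun (i : 'I_n) w => g (x i w)) (fun (i : 'I_n) _ => (gx i).1).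
have iS n : P.-integrable setT (EFin \o (fun w => n%:R^-1 * \sum_(i < n) g (x i w))).
  by apply: integrable_EFinZ => //; exact: (s n).1.
have g0 v : 0 <= g v by rewrite mulr_ge0// exprn_ge0// l1_ge0.
apply: vanishing_mean_prob => //; first by move=> n; exact: integrable_EFinZ.
have h : (Num.sqrt n%:R)^-1 * \int[Q]_v g v @[n --> \oo] --> 0.
  by rewrite -[X in _ --> X](mul0r (\int[Q]_v g v)); apply: cvgMl; exact: rsqrtn_cvg0.
apply: (cvg_trans _ h); apply: near_eq_cvg; near=> n.
have n0 : 0 < n%:R :> R by rewrite ltr0n; near: n; exact: nbhs_infty_gt.
rewrite (_ : (fun w => `|_|) = fun w => (Num.sqrt n%:R)^-1 * (n%:R^-1 * \sum_(i < n) g (x i w))).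
  rewrite RintegralZl//; congr (_ * _); rewrite RintegralZl//; last exact: (s n).1.
  rewrite (s n).2; rewrite (eq_bigr (fun=> \int[Q]_v g v)); last by move=> i _; exact: (gx i).2.
  by rewrite sumr_const card_ord -[X in _ * X]mulr_natl mulKf// gt_eqF.
apply/funext => w; rewrite ger0_norm// /cubic_remainder.
by rewrite !mulr_ge0 ?invr_ge0 ?sqrtr_ge0 ?(ltW n0)// sumr_ge0// => i _; exact: g0.
Unshelve. all: by end_near. Qed.

End remainder.

End model.

(** * The adaptive LASSO on a fixed sample *)

Section extended_loss.
Context (R : realType) (d n m : nat) (lambda gamma : R).
Variables (b' : 'cV[R]_d) (x : nat -> 'cV[R]_d) (S : nat -> nat).
Hypotheses (lambda_gt0 : 0 < lambda) (gamma_gt0 : 0 < gamma).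

Definition neg_loglik (b : 'cV[R]_d) : R :=
  - \sum_(i < n) ((S i)%:R * dotv b (x i) - phi m (dotv b (x i))).

(* This is [0] when [b' j = 0], but then the coordinate [j] of a minimizer is [0]
   by [adaptive_lasso_dead]. *)
Definition real_weight (j : 'I_d) : R := (`|b' j ord0| `^ gamma)^-1.

Let weight_dead j : b' j ord0 = 0 -> adaptive_weight gamma b' j = +oo%E.
Proof.
move=> bj; rewrite /adaptive_weight bj normr0 powR0 ?gt_eqF//.
by rewrite inve0.
Qed.

Let weight_alive j : b' j ord0 != 0 -> adaptive_weight gamma b' j = (real_weight j)%:E.
Proof.
move=> bj; rewrite /adaptive_weight inver ifF//.
by apply/negbTE; rewrite gt_eqF// powR_gt0// normr_gt0.
Qed.

Let weight_ge0 j : (0 <= adaptive_weight gamma b' j)%E.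
Proof.
have [b0|b0] := eqVneq (b' j ord0) 0; first by rewrite weight_dead.
by rewrite weight_alive// lee_fin invr_ge0 powR_ge0.
Qed.

Lemma loss_finE (b : 'cV[R]_d) : (forall j, b' j ord0 = 0 -> b j ord0 = 0) ->
  loss n m lambda gamma b' x S b =
  (neg_loglik b + lambda * \sum_j real_weight j * `|b j ord0|)%:E.
Proof.
move=> bb; rewrite /loss -/(neg_loglik b) EFinD EFinM -sumEFin.
congr (_ + _ * _)%E; apply: eq_bigr => j _.
have [b0|b0] := eqVneq (b' j ord0) 0; first by rewrite bb// normr0 mulr0 mule0.
by rewrite weight_alive.
Qed.

Lemma loss_pinfty (b : 'cV[R]_d) j : b' j ord0 = 0 -> b j ord0 != 0 ->
  loss n m lambda gamma b' x S b = +oo%E.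
Proof.
move=> b'0 b0; rewrite /loss (bigD1 j)//= weight_dead//.
rewrite gt0_mulye ?lte_fin ?normr_gt0// addye ?gt0_muley ?lte_fin//.
rewrite gt_eqF// (@lt_le_trans _ _ 0%E)// sume_ge0// => k _.
by rewrite mule_ge0// lee_fin.
Qed.

Variable bt : 'cV[R]_d.
Hypothesis bt_min : is_adaptive_lasso n m lambda gamma b' x S bt.

(** The loss is finite at 0, whereas a nonzero coordinate with an infinite weight makes it
    infinite. *)
Lemma adaptive_lasso_dead j : b' j ord0 = 0 -> bt j ord0 = 0.
Proof.
move=> b'0; apply: contrapT => /eqP bj; have := bt_min 0.
rewrite (loss_pinfty b'0 bj) loss_finE; last by move=> k _; rewrite mxE.
by rewrite leye_eq.
Qed.

Lemma adaptive_lasso_min (b : 'cV[R]_d) : (forall j, b' j ord0 = 0 -> b j ord0 = 0) ->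
  neg_loglik bt + lambda * \sum_j real_weight j * `|bt j ord0| <=
  neg_loglik b + lambda * \sum_j real_weight j * `|b j ord0|.
Proof.
by move=> bb; have := bt_min b; rewrite !loss_finE//; exact: adaptive_lasso_dead.
Qed.

End extended_loss.

Section one_sample.
Context (R : realType) (d n m : nat) (lambda gamma : R).
Variables (bstar b' bt : 'cV[R]_d) (x : nat -> 'cV[R]_d) (S : nat -> nat).
Variables (M : 'cV[R]_d -> R) (J : 'M[R]_d).
Hypotheses (lambda_gt0 : 0 < lambda) (gamma_gt0 : 0 < gamma) (n_gt0 : (0 < n)%N).
Hypothesis bt_min : is_adaptive_lasso n m lambda gamma b' x S bt.

Let rt : R := Num.sqrt n%:R.
Let W : 'cV[R]_d := rt^-1 *: \sum_(i < n)
  ((S i)%:R - m%:R * logistic (x i) bstar) *: x i.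
Let H : 'M[R]_d := n%:R^-1 *: \sum_(i < n)
  (m%:R * (logistic (x i) bstar * (1 - logistic (x i) bstar))) *: (x i *m (x i)^T).
Let rem : R := rt^-1 * (n%:R^-1 * \sum_(i < n) (M (x i) * l1 (x i) ^+ 3)).

Let nR : 0 < n%:R :> R. Proof. by rewrite ltr0n. Qed.
Let rt0 : 0 < rt. Proof. by rewrite sqrtr_gt0. Qed.
Let rt2 : rt ^+ 2 = n%:R. Proof. by rewrite sqr_sqrtr// ltW. Qed.

Variables (delta eta0 eta C : R).
Hypothesis M_bound : forall b v : 'cV[R]_d, l1 b <= delta -> `|d3phi m (dotv (bstar + b) v)| <= M v.
Hypothesis H_J : forall j k, `|H j k - J j k| <= eta0.
Hypothesis rem_le : rem <= eta0.
Hypothesis C_gt0 : 0 < C.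
Hypothesis n_large : 2 * C / rt <= delta.
Hypothesis eta_le : eta0 * ((2 * C) ^+ 2 / 2 + (2 * C) ^+ 3) <= eta.

Let f := neg_loglik n m x S.
Let D (v : 'cV[R]_d) : R := f (bstar + rt^-1 *: v) - f bstar.

Let tt i := dotv bstar (x i).
Let hh (v : 'cV[R]_d) i := dotv v (x i) / rt.

Let DE v : D v = \sum_(i < n) (phi m (tt i + hh v i) - phi m (tt i) - (S i)%:R * hh v i).
Proof.
rewrite /D /f /neg_loglik opprK -sumrN addrC -big_split/=; apply: eq_bigr => i _.
rewrite dotvDl dotvZl -/(tt i) (_ : rt^-1 * dotv v (x i) = hh v i); last by rewrite /hh mulrC.
by ring.
Qed.

Let dotvW v : dotv W v = \sum_(i < n) ((S i)%:R - dphi m (tt i)) * hh v i.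
Proof.
rewrite dotvZl (_ : dotv (\sum_(i < n) _) v = \sum_(i < n) ((S i)%:R - dphi m (tt i)) * dotv v (x i)).
  by rewrite mulr_sumr; apply: eq_bigr => i _; rewrite /hh; ring.
elim/big_ind2: _ => [|y a z b <- <-|i _].
- by rewrite dotvC dotv0.
- exact: dotvDl.
- by rewrite dotvZl (dotvC v).
Qed.

Let quadH v : dotv v (H *m v) = \sum_(i < n) d2phi m (tt i) * hh v i ^+ 2.
Proof.
rewrite -scalemxAl dotvZr mulmx_suml.
rewrite (_ : dotv v _ = \sum_(i < n) d2phi m (tt i) * dotv v (x i) ^+ 2).
  by rewrite mulr_sumr; apply: eq_bigr => i _; rewrite /hh exprMn exprVn rt2; ring.
elim/big_ind2: _ => [|y a z b <- <-|i _].
- exact: dotv0.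
- exact: dotvDr.
- rewrite -scalemxAl dotvZr; congr (_ * _).
  by rewrite -mulmxA /dotv mulmxA mxE big_ord1 expr2 -/(dotv v (x i)) -/(dotv (x i) v) (dotvC (x i)).
Qed.

Let M_ge0 z : 0 <= M z.
Proof.
apply: le_trans (M_bound (b := 0) z _) => //.
rewrite (_ : l1 0 = 0); last by rewrite /l1 big1// => j _; rewrite mxE normr0.
by apply: le_trans n_large; rewrite divr_ge0 ?(ltW rt0)// mulr_ge0// ltW.
Qed.

Let D_taylor v : l1 v <= 2 * C ->
  `|D v - (dotv v (H *m v) / 2 - dotv W v)| <= rem * l1 v ^+ 3.
Proof.
move=> vC.
have -> : D v - (dotv v (H *m v) / 2 - dotv W v) = \sum_(i < n)
    (phi m (tt i + hh v i) - phi m (tt i) - dphi m (tt i) * hh v i -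
      d2phi m (tt i) * hh v i ^+ 2 / 2).
  rewrite DE quadH dotvW mulr_suml -!sumrB; apply: eq_bigr => i _; ring.
rewrite (le_trans (ler_norm_sum _ _ _))//.
rewrite /rem -!mulrA [X in _ * (_ * X)]mulr_suml !mulr_sumr.
apply: ler_sum => i _.
have M0 := M_ge0 (x i).
apply: (@le_trans _ _ (M (x i) * `|hh v i| ^+ 3)).
  apply: phi_taylor => s /andP[s0 s1].
  have -> : tt i + s * hh v i = dotv (bstar + (s / rt) *: v) (x i).
    by rewrite dotvDl dotvZl /hh /tt; ring.
  apply: M_bound; rewrite l1Z ger0_norm; last by rewrite divr_ge0// ltW.
  apply: le_trans n_large; rewrite mulrAC ler_pM2r ?invr_gt0//.
  by rewrite (le_trans _ vC)// ler_piMl// l1_ge0.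
have hle : `|hh v i| <= l1 (x i) * l1 v / rt.
  have ri0 : 0 <= rt^-1 by rewrite invr_ge0 ltW.
  rewrite /hh normrM (ger0_norm ri0) ler_wpM2r// dotvC.
  by apply: dotv_le_l1 => j; exact: l1_coord.
apply: (@le_trans _ _ (M (x i) * (l1 (x i) * l1 v / rt) ^+ 3)).
  by rewrite ler_wpM2l// lerXn2r// nnegrE// (le_trans _ hle).
by rewrite -rt2 le_eqVlt; apply/orP; left; apply/eqP; field; rewrite gt_eqF.
Qed.

(** Two errors add up, the replacement of the empirical information [H] by [J] and the cubic
    remainder; [eta_le] bounds their sum on the ball of radius [2 * C]. *)
Let D_quad v : l1 v <= 2 * C -> `|D v - (dotv v (J *m v) / 2 - dotv W v)| <= eta.
Proof.
move=> vC; have l0 := l1_ge0 v; apply: le_trans eta_le.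
have h1 := D_taylor vC.
have h2 : `|dotv v ((H - J) *m v)| <= eta0 * l1 v ^+ 2.
  apply: quadratic_upper_bound => j k.
  by rewrite [(H - J) j k]mxE [(- J) j k]mxE; exact: H_J.
have e0 : 0 <= eta0.
  apply: le_trans rem_le; apply: mulr_ge0; first by rewrite invr_ge0 ltW.
  apply: mulr_ge0; first by rewrite invr_ge0 ltW.
  by apply: sumr_ge0 => i _; apply: mulr_ge0; [exact: M_ge0|rewrite exprn_ge0// l1_ge0].
have h3 : l1 v ^+ 2 <= (2 * C) ^+ 2 by rewrite lerXn2r// nnegrE// (le_trans l0).
have h4 : l1 v ^+ 3 <= (2 * C) ^+ 3 by rewrite lerXn2r// nnegrE// (le_trans l0).
have h5 : rem * l1 v ^+ 3 <= eta0 * (2 * C) ^+ 3.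
  by rewrite (le_trans (ler_wpM2r _ rem_le)) ?exprn_ge0// ler_wpM2l.
have h6 : eta0 * l1 v ^+ 2 <= eta0 * (2 * C) ^+ 2 by rewrite ler_wpM2l.
have h7 : dotv v ((H - J) *m v) = dotv v (H *m v) - dotv v (J *m v).
  by rewrite mulmxBl dotvBr.
rewrite h7 in h2.
rewrite (_ : D v - _ = (D v - (dotv v (H *m v) / 2 - dotv W v)) +
  (dotv v (H *m v) - dotv v (J *m v)) / 2); last by field.
rewrite (le_trans (ler_normD _ _))// mulrDr addrC lerD//; last exact: le_trans h1 h5.
rewrite normrM (ger0_norm (_ : 0 <= 2^-1 :> R)) ?invr_ge0// mulrA ler_wpM2r ?invr_ge0//.
exact: le_trans h2 h6.
Qed.

Let D_convex (y z : 'cV[R]_d) (s : R) : 0 <= s <= 1 ->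
  D (s *: y + (1 - s) *: z) <= s * D y + (1 - s) * D z.
Proof.
move=> s01; rewrite !DE !mulr_sumr -big_split/=; apply: ler_sum => i _.
have hE : hh (s *: y + (1 - s) *: z) i = s * hh y i + (1 - s) * hh z i.
  by rewrite /hh dotvDl !dotvZl; ring.
have := @phi_convex R m (tt i + hh y i) (tt i + hh z i) s s01.
rewrite hE (_ : s * (tt i + hh y i) + _ = tt i + (s * hh y i + (1 - s) * hh z i)); last by ring.
by lra.
Qed.

Variables (c K Jb eta' r e : R).
Hypothesis J_sym : J^T = J.
Hypothesis J_lb : forall v, c * l1 v ^+ 2 <= dotv v (J *m v).
Hypothesis J_ub : forall v, dotv v (J *m v) <= Jb * l1 v ^+ 2.
Hypothesis J_posdef : posdefmx J.
Hypothesis W_le : forall j, `|W j ord0| <= K.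
Let A := supp bstar.
Let us : 'cV[R]_d := (selmx R A)^T *m (invmx (submat A J) *m subv A W).
Let kap j := lambda / rt * real_weight gamma b' j.
Hypothesis kap_A : \sum_(j in A) kap j <= eta'.
Hypothesis kap_notA : forall j, j \notin A -> b' j ord0 != 0 -> r <= kap j.
Hypothesis b'_A : forall j, j \in A -> b' j ord0 != 0.
Hypothesis us_le : l1 us <= C.
Hypotheses (K_ge0 : 0 <= K) (Jb_ge0 : 0 <= Jb) (c_gt0 : 0 < c) (eta_le1 : eta <= 1).
Hypotheses (eta'_le1 : eta' <= 1) (e_ge0 : 0 <= e).
Hypothesis C_large : (K + 1) * C + 1 < c / 2 * C ^+ 2.
Hypothesis r_large : 2 * (K * (2 * C) + Jb / 2 * (2 * C) ^+ 2 + 1) / C < r.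
Hypothesis e_large : 4 * eta + 4 * C * eta' <= c * e ^+ 2.
Hypothesis bstar_large : forall j, j \in A -> C / rt < `|bstar j ord0|.

Let u : 'cV[R]_d := rt *: (bt - bstar).

Let btE : bt = bstar + rt^-1 *: u.
Proof. by rewrite scalerA mulVf ?gt_eqF// scale1r addrC subrK. Qed.

Let bstar_notA j : j \notin A -> bstar j ord0 = 0.
Proof. by rewrite inE negbK => /eqP. Qed.

Let dead_notA j : b' j ord0 == 0 -> j \notin A.
Proof. by move=> bj; apply/negP => /b'_A; rewrite bj. Qed.

Let dead_u j : b' j ord0 == 0 -> u j ord0 = 0.
Proof.
move=> bj; rewrite !mxE (adaptive_lasso_dead lambda_gt0 gamma_gt0 bt_min (eqP bj)).
by rewrite bstar_notA ?dead_notA// subrr mulr0.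
Qed.

Let u_min (v : 'cV[R]_d) : (forall j, b' j ord0 == 0 -> v j ord0 = 0) ->
  D u + \sum_j kap j * `|(rt *: bstar) j ord0 + u j ord0| <=
  D v + \sum_j kap j * `|(rt *: bstar) j ord0 + v j ord0|.
Proof.
move=> v0.
have penE (z : 'cV[R]_d) : \sum_j kap j * `|(rt *: bstar) j ord0 + z j ord0| =
    lambda * \sum_j real_weight gamma b' j * `|(bstar + rt^-1 *: z) j ord0|.
  rewrite mulr_sumr; apply: eq_bigr => j _; rewrite !mxE.
  rewrite (_ : rt * bstar j ord0 + z j ord0 = rt * (bstar j ord0 + rt^-1 * z j ord0)); last first.
    by field; rewrite gt_eqF.
  rewrite normrM (ger0_norm (ltW rt0)) /kap.
  by field; rewrite gt_eqF.
rewrite !penE /D -btE.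
have := adaptive_lasso_min lambda_gt0 gamma_gt0 bt_min (b := bstar + rt^-1 *: v) _.
have h : forall j, b' j ord0 = 0 -> (bstar + rt^-1 *: v) j ord0 = 0.
  by move=> j /eqP bj; rewrite !mxE v0// bstar_notA ?dead_notA// mulr0 addr0.
by move=> /(_ h); rewrite -/f; lra.
Qed.

Let us_stationary (v : 'cV[R]_d) : (forall j, j \notin A -> v j ord0 = 0) ->
  dotv v (J *m us) = dotv W v.
Proof.
move=> vA; rewrite -{1}(selmx_tr_subv vA) /us.
have Ju : submat A J \in unitmx.
  by apply: posdefmx_unitmx; [exact: submat_sym|exact: posdefmx_submat].
rewrite /dotv trmx_mul trmxK.
have -> : (subv A v)^T *m selmx R A *m (J *m ((selmx R A)^T *m (invmx (submat A J) *m subv A W))) =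
  (subv A v)^T *m (submat A J *m (invmx (submat A J) *m subv A W)).
  by rewrite submatE !mulmxA.
rewrite mulKVmx// -/(dotv (subv A v) (subv A W)) dotvC !subvE /dotv trmx_mul -mulmxA.
by rewrite -{2}(selmx_tr_subv vA) subvE.
Qed.

Lemma adaptive_lasso_close : [/\ supp bt = A, l1 u <= C & l1 (u - us) <= e].
Proof.
have bbA j : j \notin A -> (rt *: bstar) j ord0 = 0.
  by move=> jA; rewrite mxE bstar_notA// mulr0.
have kap_ge0 j : 0 <= kap j.
  by rewrite mulr_ge0 ?divr_ge0 ?(ltW lambda_gt0) ?(ltW rt0)// invr_ge0 powR_ge0.
have D0 : D 0 = 0 by rewrite /D scaler0 addr0 subrr.
have us_supp j : j \notin A -> us j ord0 = 0 by exact: selmx_tr_supp.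
have uC : l1 u <= C.
  exact: (lasso_bounded (dead := fun j => b' j ord0 == 0) D_convex D0 D_quad J_lb W_le
    kap_ge0 bbA kap_A u_min C_gt0).
have uA : forall j, j \notin A -> u j ord0 = 0.
  exact: (lasso_sparse (dead := fun j => b' j ord0 == 0) D_convex D0 D_quad J_lb J_ub W_le
    kap_ge0 bbA kap_A kap_notA dead_notA dead_u u_min K_ge0 Jb_ge0 C_gt0).
have close : l1 (u - us) <= e.
  exact: (lasso_close (dead := fun j => b' j ord0 == 0) D_convex D0 D_quad
    J_sym J_lb J_ub W_le
    kap_ge0 bbA kap_A kap_notA dead_notA dead_u u_min us_supp us_stationary).
have bt_coord j : bt j ord0 = bstar j ord0 + rt^-1 * u j ord0.
  by rewrite !mxE; field; rewrite gt_eqF.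
split => //; apply/setP => j; rewrite inE; have [jA|jA] := boolP (j \in A); last first.
  by rewrite bt_coord uA// bstar_notA// mulr0 addr0 eqxx.
(* If a coordinate of the support vanished in [bt], the rescaled error there would exceed [C]. *)
apply/eqP => b0; have := bstar_large jA.
rewrite ltNge => /negP; apply.
have -> : bstar j ord0 = - (rt^-1 * u j ord0) by move: b0; rewrite bt_coord; lra.
rewrite mulrC normrN normrM (ger0_norm (_ : 0 <= rt^-1)) ?invr_ge0 ?(ltW rt0)//.
by rewrite ler_pM2r ?invr_gt0// (le_trans (l1_coord _ _)).
Qed.

End one_sample.

(** * Asymptotics of the estimator *)

Section weights.
Context (R : realType) (n : nat) (lambda gamma K1 : R).
Hypotheses (n_gt0 : (0 < n)%N) (lambda_gt0 : 0 < lambda) (gamma_gt0 : 0 < gamma)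
  (K1_gt0 : 0 < K1).
Let rt : R := Num.sqrt n%:R.

Let rt0 : 0 < rt. Proof. by rewrite sqrtr_gt0 ltr0n. Qed.

Lemma sqrt_powR : rt `^ gamma / rt = n%:R `^ ((gamma - 1) / 2).
Proof.
have nR : n%:R != 0 :> R by rewrite pnatr_eq0 -lt0n.
rewrite /rt -powR12_sqrt// -powRrM -powRB; last by rewrite nR implybT.
by congr (_ `^ _); field.
Qed.

(** On the support the initial estimate stays above half of the smallest true coefficient, so the
    weight is bounded and the slope is of the order of [lambda / sqrt n]. *)
Lemma alive_weight_le (d : nat) (b' : 'cV[R]_d) j (b b0 : R) : 0 < b0 -> b0 <= `|b| ->
  `|b' j ord0 - b| <= K1 / rt -> K1 / rt <= b0 / 2 ->
  b' j ord0 != 0 /\ lambda / rt * real_weight gamma b' j <= lambda / rt * ((b0 / 2) `^ gamma)^-1.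
Proof.
move=> b00 b0b b'b Kb.
have h : b0 / 2 <= `|b' j ord0|.
  have := ler_normB (b' j ord0) (b' j ord0 - b).
  rewrite subKr => h; have := le_trans b0b h.
  by move: (`|b' j ord0|) b'b Kb => y; lra.
have b20 : 0 < b0 / 2 by rewrite divr_gt0.
have b'0 : 0 < `|b' j ord0| by exact: lt_le_trans h.
split; first by rewrite -normr_gt0.
rewrite ler_wpM2l ?divr_ge0 ?(ltW lambda_gt0) ?(ltW rt0)// lef_pV2 ?posrE ?powR_gt0//.
by rewrite ge0_ler_powR// ?nnegrE ltW.
Qed.

(** Off the support the initial estimate is at most [K1 / rt], so its weight is at least the power
    [gamma] of [rt / K1]; by [sqrt_powR] the slope then contains the quantity assumed to diverge. *)
Lemma null_weight_ge (d : nat) (b' : 'cV[R]_d) j (r : R) : b' j ord0 != 0 ->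
  `|b' j ord0| <= K1 / rt -> r * K1 `^ gamma <= lambda * n%:R `^ ((gamma - 1) / 2) ->
  r <= lambda / rt * real_weight gamma b' j.
Proof.
move=> b'0 b'K hr; have b'p : 0 < `|b' j ord0| by rewrite normr_gt0.
have Kr : 0 < K1 / rt by rewrite divr_gt0.
have Kg : 0 < K1 `^ gamma by rewrite powR_gt0.
apply: (@le_trans _ _ (lambda / rt * ((K1 / rt) `^ gamma)^-1)); last first.
  rewrite ler_wpM2l ?divr_ge0 ?(ltW lambda_gt0) ?(ltW rt0)// lef_pV2 ?posrE ?powR_gt0//.
  by rewrite ge0_ler_powR// ?nnegrE ltW.
rewrite powRM ?(ltW K1_gt0) ?invr_ge0 ?(ltW rt0)//.
have -> : rt^-1 `^ gamma = (rt `^ gamma)^-1.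
  by rewrite -powR_inv1 ?(ltW rt0)// -powRrM mulN1r powRN.
have rg : 0 < rt `^ gamma by rewrite powR_gt0.
rewrite (_ : lambda / rt * _ = lambda * (rt `^ gamma / rt) / K1 `^ gamma); last first.
  by field; rewrite !gt_eqF.
by rewrite sqrt_powR ler_pdivlMr.
Qed.

End weights.

Lemma norm_coord_le_norm2 (R : realType) (d : nat) (b : 'cV[R]_d) j : `|b j ord0| <= norm2 b.
Proof.
rewrite -sqrtr_sqr ler_wsqrtr// (bigD1 j)//= lerDl.
by apply: sumr_ge0 => k _; exact: sqr_ge0.
Qed.

Lemma supp_lower_bound (R : realType) (d : nat) (b : 'cV[R]_d) :
  exists2 b0 : R, 0 < b0 & forall j, j \in supp b -> b0 <= `|b j ord0|.
Proof.
(* The neutral value 1 provides a positive bound when the support is empty. *)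
pose b0 := \big[Num.min/1]_(j in supp b) `|b j ord0|.
exists b0; last by move=> j jA; rewrite /b0 (bigD1 j)//= ge_min lexx.
rewrite /b0; elim/big_ind: _ => // [y z y0 z0|j]; first by rewrite lt_min y0.
by rewrite inE normr_gt0.
Qed.

Lemma open_l1_ball (R : realType) (d : nat) (O : set 'cV[R]_d) (b : 'cV[R]_d) :
  open O -> O b -> exists2 delta : R, 0 < delta & forall v, l1 v <= delta -> O (b + v).
Proof.
move=> oO Ob; have /nbhs_ballP[e /= e0 eO] : nbhs b O by exact: open_nbhs_nbhs.
exists (e / 2); first by rewrite divr_gt0.
move=> v ve; apply: eO; split => // i j; rewrite /ball/= mxE opprD addrA subrr sub0r normrN.
rewrite (ord1 j) (le_lt_trans (l1_coord _ _))// (le_lt_trans ve)//.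
by rewrite ltr_pdivrMr// ltr_pMr// ltr1n.
Qed.

Section localization.
Context (R : realType) (disp : measure_display) (T : measurableType disp).
Variables (P : probability T R) (d m : nat) (alpha0 gamma : R).
Hypotheses (m_ge1 : (1 <= m)%N) (alpha0_gt0 : 0 < alpha0) (gamma_gt0 : 0 < gamma).
Variables (bstar : 'cV[R]_d) (Q : probability (borelV R d) R).
Variables (x : nat -> {RV P >-> borelV R d}) (S1 S0 : nat -> {RV P >-> nat}).
Hypothesis x_law : forall i (B : set (borelV R d)), measurable B ->
  P (x i @^-1` B) = Q B.
Hypothesis votes_law : forall i (B : set (borelV R d)) (k1 k0 : nat), measurable B ->
  P (x i @^-1` B `&` S1 i @^-1` [set k1] `&` S0 i @^-1` [set k0]) =
  (\int[P]_(w in x i @^-1` B)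
    (dirichlet_multinomial_pmf m (alpha0 * logistic (x i w) bstar)
      (alpha0 * (1 - logistic (x i w) bstar)) k1 k0)%:E)%E.
Hypothesis indep : mutually_independent P (fun i w => (x i w, S1 i w, S0 i w)).
Variable binit : nat -> {RV P >-> borelV R d}.
Hypothesis binit_consistent :
  bigO_P P (fun n w => norm2 ((binit n w : 'cV[R]_d) - bstar))
    (fun n => (Num.sqrt n%:R)^-1).
Variable lambda : nat -> R.
Hypothesis lambda_small : lambda n / Num.sqrt n%:R @[n --> \oo] --> (0 : R).
Hypothesis lambda_large : lambda n * n%:R `^ ((gamma - 1) / 2) @[n --> \oo] --> +oo.
Variable bt : nat -> {RV P >-> borelV R d}.
Hypothesis bt_min : forall n w, (0 < n)%N ->
  is_adaptive_lasso n m (lambda n) gamma (binit n w)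
    (fun i => x i w) (fun i => S1 i w) (bt n w).
Hypothesis A1 : fisher_assumption Q bstar.
Hypothesis A2 : third_derivative_assumption Q m bstar.

Let A := supp bstar.
Let J : 'M[R]_d := m%:R *: fisher Q bstar.
Let W := scaled_score m bstar x S1.

Definition rescaled_error (n : nat) (w : T) : 'cV[R]_d :=
  Num.sqrt n%:R *: ((bt n w : 'cV[R]_d) - bstar).

(* The minimizer of [dotv u (J *m u) / 2 - dotv (W n w) u] over the vectors [u]
   supported in [A]. *)
Definition linearized_error (n : nat) (w : T) : 'cV[R]_d :=
  (selmx R A)^T *m (invmx (submat A J) *m subv A (W n w)).

Let mR : 0 < m%:R :> R. Proof. by rewrite ltr0n. Qed.

Let J_sym : J^T = J. Proof. by rewrite /J linearZ/= fisher_sym. Qed.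

Let J_posdef : posdefmx J.
Proof. by move=> v v0; rewrite /J -scalemxAl dotvZr mulr_gt0// A1.2. Qed.

Let initial_close (e : R) : 0 < e -> exists2 K1 : R, 0 < K1 & \forall n \near \oo,
  measurable [set w | K1 / Num.sqrt n%:R < `|norm2 ((binit n w : 'cV[R]_d) - bstar)|] /\
  (P [set w | (K1 / Num.sqrt n%:R < `|norm2 ((binit n w : 'cV[R]_d) - bstar)|)%R] <= e%:E)%E.
Proof.
move=> e0; have [K1 hK1] := binit_consistent e0.
(* The constant supplied by [bigO_P] may be zero or negative. *)
exists (`|K1| + 1); first by rewrite ltr_wpDl.
have mb (n : nat) (K : R) : measurable [set w | K < `|norm2 ((binit n w : 'cV[R]_d) - bstar)|].
  apply: measurable_norm_gt; rewrite /norm2.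
  apply: (measurableT_comp (f := @Num.sqrt R)).
    by apply: continuous_measurable_fun; exact: sqrt_continuous.
  apply: measurable_sum => j; apply: measurable_funX.
  under eq_fun do rewrite mxE; apply: measurable_funD => //.
  exact: (measurableT_comp (measurable_coord j) (measurable_funPT (binit n))).
near=> n; split; first exact: mb.
apply: (@le_trans _ _ (P [set w | K1 * `|(Num.sqrt n%:R)^-1| < `|norm2 ((binit n w : 'cV[R]_d) - bstar)|])).
  apply: le_measure; rewrite ?inE; [exact: mb|exact: mb|].
  move=> w /=; apply: le_lt_trans; rewrite ger0_norm ?invr_ge0 ?sqrtr_ge0//.
  by rewrite ler_wpM2r ?invr_ge0 ?sqrtr_ge0// (le_trans (ler_norm _))// lerDl.
by near: n.
Unshelve. all: by end_near. Qed.

Theorem localization (e0 e : R) : 0 < e0 -> 0 < e -> exists C : R,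
  \forall n \near \oo, exists E : set T, [/\ measurable E, (P E <= e0%:E)%E &
    forall w, ~ E w -> [/\ supp (bt n w) = A, l1 (rescaled_error n w) <= C &
      l1 (rescaled_error n w - linearized_error n w) <= e]].
Proof.
move=> e00 e_gt0.
have [c c0 J_lb] : exists2 c : R, 0 < c & forall v : 'cV[R]_d, c * l1 v ^+ 2 <= dotv v (J *m v).
  by have [B BJ] := posdefmx_congruent1 J_sym J_posdef; exact: congruent1_lower_bound BJ.
pose entry_sum (G : 'M[R]_d) : R := \sum_i \sum_j `|G i j|.
have entry_le (G : 'M[R]_d) i j : `|G i j| <= entry_sum G.
  rewrite /entry_sum (bigD1 i)//= (bigD1 j)//= -addrA lerDl addr_ge0//.
    exact: sumr_ge0.
  by apply: sumr_ge0 => k _; exact: sumr_ge0.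
have entry_ge0 G : 0 <= entry_sum G by apply: sumr_ge0 => i _; exact: sumr_ge0.
pose Jb := entry_sum J.
have J_ub v : dotv v (J *m v) <= Jb * l1 v ^+ 2.
  by apply: (le_trans (ler_norm _)); apply: quadratic_upper_bound => i j; exact: entry_le.
pose G := (selmx R A)^T *m invmx (submat A J) *m selmx R A.
have G_l1 K (v : 'cV[R]_d) : (forall j, `|v j ord0| <= K) -> l1 (G *m v) <= entry_sum G * K.
  move=> vK; rewrite /l1 /entry_sum mulr_suml; apply: ler_sum => i _.
  rewrite mxE (le_trans (ler_norm_sum _ _ _))// mulr_suml; apply: ler_sum => j _.
  by rewrite normrM ler_wpM2l.
(* The index type of the bad events: score coordinates, entries of the information matrix, and two
   more for the cubic remainder and the initial estimator. Each receives the share [e1] of the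
   probability [e0]. *)
pose I := ('I_d + 'I_d * 'I_d + bool)%type.
pose e1 := e0 / (#|{: I}|%:R + 1).
have I0 : 0 < #|{: I}|%:R + 1 :> R by rewrite ltr_wpDl.
have e10 : 0 < e1 by rewrite divr_gt0.
have tight (j : 'I_d) : exists K : R, 0 < K /\ \forall n \near \oo,
    measurable [set w | K < `|W n w j ord0|] /\ (P [set w | K < `|W n w j ord0|]%R <= e1%:E)%E.
  have [K K0 h] := scaled_score_tight alpha0_gt0 x_law votes_law indep A1 j e10.
  by exists K.
have [Kf hKf] := choice tight.
pose K := \sum_j Kf j.
have Kf_le j : Kf j <= K.
  by rewrite /K (bigD1 j)//= lerDl; apply: sumr_ge0 => k _; have [/ltW] := hKf k.
have K0 : 0 <= K by apply: sumr_ge0 => k _; have [/ltW] := hKf k.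
have [K1 K10 hK1] := initial_close e10.
(* The first term ensures [C_large], the second bounds the linearized error [G *m W n w], and the
   last makes [C] at least 1. *)
pose C := 2 * (K + 2) / c + entry_sum G * K + 1.
have CK : 2 * (K + 2) / c < C.
  by rewrite /C -addrA ltrDl ltr_wpDl// mulr_ge0.
have C1 : 1 <= C.
  rewrite /C lerDr addr_ge0//; last by rewrite mulr_ge0.
  by rewrite divr_ge0 ?(ltW c0)// mulr_ge0// addr_ge0.
have C0 : 0 < C by exact: lt_le_trans C1.
have C_large : (K + 1) * C + 1 < c / 2 * C ^+ 2.
  move: CK; rewrite ltr_pdivrMr// => CK.
  have h : (K + 2) * C < c / 2 * C ^+ 2.
    by rewrite expr2 mulrA ltr_pM2r//; move: CK; lra.
  by move: h C1; lra.
(* Each of the two terms on the left of [e_large] receives half of [c * e ^+ 2]. *)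
pose eta := Num.min 1 (c * e ^+ 2 / 8).
pose eta' := Num.min 1 (c * e ^+ 2 / (8 * C)).
have ce0 : 0 < c * e ^+ 2 by rewrite mulr_gt0// exprn_gt0.
have eta0' : 0 < eta by rewrite /eta lt_min ltr01 divr_gt0.
have eta'0 : 0 < eta' by rewrite /eta' lt_min ltr01 divr_gt0// mulr_gt0.
have e_large : 4 * eta + 4 * C * eta' <= c * e ^+ 2.
  have h1 : eta <= c * e ^+ 2 / 8 by rewrite /eta ge_min lexx orbT.
  have h2 : C * eta' <= c * e ^+ 2 / 8.
    apply: (@le_trans _ _ (C * (c * e ^+ 2 / (8 * C)))).
      by rewrite ler_wpM2l ?(ltW C0)// /eta' ge_min lexx orbT.
    by rewrite le_eqVlt; apply/orP; left; apply/eqP; field; rewrite gt_eqF.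
  by move: (c * e ^+ 2) h1 h2 => y; lra.
pose poly : R := (2 * C) ^+ 2 / 2 + (2 * C) ^+ 3.
have poly0 : 0 < poly by rewrite addr_gt0 ?divr_gt0 ?exprn_gt0 ?mulr_gt0.
pose eta0 := eta / poly.
have eta00 : 0 < eta0 by rewrite divr_gt0.
(* The threshold in [r_large] plus 1, since that inequality is strict. *)
pose r := 2 * (K * (2 * C) + Jb / 2 * (2 * C) ^+ 2 + 1) / C + 1.
have [U [M [oU Ub hM iM]]] := A2.
have [delta delta0 dU] := open_l1_ball oU Ub.
have M_bound (b v : 'cV[R]_d) : l1 b <= delta -> `|d3phi m (dotv (bstar + b) v)| <= M v.
  by move=> bd; rewrite -derive1n_phi3; apply: hM; exact: dU.
have M_ge0 v : 0 <= M v.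
  apply: le_trans (M_bound 0 v _) => //.
  by rewrite /l1 big1 ?(ltW delta0)// => j _; rewrite mxE normr0.
have [b0 b00 b0A] := supp_lower_bound bstar.
pose H := empirical_information m bstar x.
pose rem := cubic_remainder x M.
pose F (n : nat) (i : I) : set T := match i with
  | inl (inl j) => [set w | Kf j < `|W n w j ord0|]
  | inl (inr jk) => [set w | eta0 < `|H n w jk.1 jk.2 - J jk.1 jk.2|]
  | inr true => [set w | eta0 < `|rem n w|]
  | inr false => [set w | K1 / Num.sqrt n%:R < `|norm2 ((binit n w : 'cV[R]_d) - bstar)|]
  end.
have hF : \forall n \near \oo, forall i, measurable (F n i) /\ (P (F n i) <= e1%:E)%E.
  apply: filter_forall => -[[j|[j k]]|[]].
  - exact: (hKf j).2.
  - have := empirical_information_cvg alpha0_gt0 x_law votes_law indep A1 j k eta00 e10.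
    by apply: filterS => n; rewrite /F/= [J j k]mxE.
  - exact: (cubic_remainder_cvg x_law M_ge0 iM).
  - exact: hK1.
pose wA := (b0 / 2) `^ gamma.
have wA0 : 0 < wA by rewrite powR_gt0// divr_gt0.
have lambda_pos : \forall n \near \oo, 0 < lambda n * n%:R `^ ((gamma - 1) / 2).
  by move/cvgryPgt : lambda_large; apply.
have lambda_null : \forall n \near \oo,
    r * K1 `^ gamma <= lambda n * n%:R `^ ((gamma - 1) / 2).
  by move/cvgryPge : lambda_large; apply.
have lambda_alive : \forall n \near \oo,
    lambda n / Num.sqrt n%:R < eta' / (wA^-1 * #|A|%:R + 1).
  apply: (cvgr_lt 0 lambda_small); rewrite divr_gt0// ltr_wpDl// mulr_ge0//.
  by rewrite invr_ge0 ltW.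
exists C; near=> n.
have n0 : (0 < n)%N by near: n; exact: nbhs_infty_gt.
pose rt : R := Num.sqrt n%:R.
have rt0 : 0 < rt by rewrite sqrtr_gt0 ltr0n.
have hFn : forall i, measurable (F n i) /\ (P (F n i) <= e1%:E)%E by near: n.
have [mE PE] := probability_finite_union (fun i => (hFn i).1) (fun i => (hFn i).2).
exists [set w | exists i, F n i w]; split => //.
  apply: (le_trans PE); rewrite lee_fin /e1 mulrA ler_pdivrMr//.
  by rewrite mulrC ler_wpM2l ?(ltW e00)// lerDl.
move=> w nE.
have notF i : ~ F n i w by move=> Fi; apply: nE; exists i.
have W_le j : `|W n w j ord0| <= K.
  by apply: le_trans (Kf_le j); rewrite leNgt; apply/negP; exact: (notF (inl (inl j))).
have H_J j k : `|H n w j k - J j k| <= eta0.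
  by rewrite leNgt; apply/negP; exact: (notF (inl (inr (j, k)))).
have rem_le : rem n w <= eta0.
  by apply: (le_trans (ler_norm _)); rewrite leNgt; apply/negP; exact: (notF (inr true)).
have b'_le j : `|(binit n w : 'cV[R]_d) j ord0 - bstar j ord0| <= K1 / rt.
  have : norm2 ((binit n w : 'cV[R]_d) - bstar) <= K1 / rt.
    by apply: (le_trans (ler_norm _)); rewrite leNgt; apply/negP; exact: (notF (inr false)).
  by apply: le_trans; have := norm_coord_le_norm2 ((binit n w : 'cV[R]_d) - bstar) j; rewrite !mxE.
(* Positivity of [lambda n] for large [n] is extracted from the divergence in [lambda_large]. *)
have lambda_gt0 : 0 < lambda n.
  have : 0 < lambda n * n%:R `^ ((gamma - 1) / 2) by near: n.
  by rewrite pmulr_lgt0// powR_gt0// ltr0n.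
have rt_ratio (y z : R) : 0 < z -> y / z < rt -> y / rt < z.
  by move=> z0; rewrite ltr_pdivrMr// => h; rewrite ltr_pdivrMr// mulrC.
have Kb : K1 / rt <= b0 / 2.
  by apply/ltW/rt_ratio; [rewrite divr_gt0|rewrite /rt; near: n; exact: sqrtn_gt].
have alive j (jA : j \in A) := alive_weight_le n0 lambda_gt0 gamma_gt0 b00 (b0A j jA) (b'_le j) Kb.
have kap_A : \sum_(j in A) lambda n / rt * real_weight gamma (binit n w) j <= eta'.
  apply: (@le_trans _ _ (\sum_(j in A) lambda n / rt * ((b0 / 2) `^ gamma)^-1)).
    by apply: ler_sum => j jA; have [] := alive j jA.
  rewrite sumr_const -[leLHS]mulr_natr -/wA -(mulrA (lambda n / rt)).
  have h : lambda n / rt < eta' / (wA^-1 * #|A|%:R + 1) by rewrite /rt; near: n.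
  have w0 : 0 <= wA^-1 * #|A|%:R by rewrite mulr_ge0// invr_ge0 ltW.
  have w1 : 0 < wA^-1 * #|A|%:R + 1 by rewrite ltr_wpDl.
  apply: (@le_trans _ _ (eta' / (wA^-1 * #|A|%:R + 1) * (wA^-1 * #|A|%:R))).
    by rewrite ler_wpM2r// ltW.
  by rewrite mulrAC ler_pdivrMr// ler_wpM2l ?(ltW eta'0)// lerDl.
have kap_notA j : j \notin A -> (binit n w : 'cV[R]_d) j ord0 != 0 ->
    r <= lambda n / rt * real_weight gamma (binit n w) j.
  move=> jA b'0; apply: (null_weight_ge n0 lambda_gt0 gamma_gt0 K10) => //.
    have := b'_le j; move: jA; rewrite inE negbK => /eqP ->.
    by rewrite subr0.
  by near: n.
have us_le : l1 (linearized_error n w) <= C.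
  rewrite /linearized_error (_ : _ *m _ = G *m W n w); last by rewrite subvE /G !mulmxA.
  rewrite (le_trans (G_l1 _ _ W_le))// /C -addrA addrC -addrA lerDl addr_ge0//.
  by rewrite divr_ge0 ?(ltW c0)// mulr_ge0// addr_ge0.
apply: (adaptive_lasso_close lambda_gt0 gamma_gt0 n0 (bt_min w n0) M_bound H_J rem_le C0
  _ _ J_sym J_lb J_ub J_posdef W_le kap_A kap_notA (fun j jA => (alive j jA).1) us_le K0
  _ c0 _ _ (ltW e_gt0) C_large _ e_large).
- by apply/ltW/rt_ratio => //; rewrite /rt; near: n; exact: sqrtn_gt.
- by rewrite /eta0 divfK// gt_eqF.
- exact: entry_ge0.
- by rewrite /eta ge_min lexx.
- by rewrite /eta' ge_min lexx.
- by rewrite /r ltrDl.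
- move=> j jA; apply: lt_le_trans (b0A j jA).
  by apply: rt_ratio => //; rewrite /rt; near: n; exact: sqrtn_gt.
Unshelve. all: by end_near. Qed.

End localization.

(** * From the linearized error to the law of the estimator *)

Lemma sin_lipschitz (R : realType) (a b : R) : `|sin a - sin b| <= `|a - b|.
Proof.
have := @mvt_bound R (@sin R) (@cos R) b (a - b) 1 _ _.
by rewrite (addrC b) subrK mul1r; apply => s _; exact: cos_max.
Qed.

Lemma cos_lipschitz (R : realType) (a b : R) : `|cos a - cos b| <= `|a - b|.
Proof.
have := @mvt_bound R (@cos R) (fun y => - sin y) b (a - b) 1 _ _.
by rewrite (addrC b) subrK mul1r; apply => s _; rewrite normrN; exact: sin_max.
Qed.

Lemma Rintegral_close d (T : measurableType d) (R : realType) (P : probability T R)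
    (f h : T -> R) (E : set T) (delta eps : R) : bmfun f -> bmfun h ->
  (forall w, `|f w| <= 1) -> (forall w, `|h w| <= 1) -> 0 <= delta ->
  measurable E -> (P E <= eps%:E)%E -> (forall w, ~ E w -> `|f w - h w| <= delta) ->
  `|\int[P]_w f w - \int[P]_w h w| <= delta + 2 * eps.
Proof.
move=> bf bh f1 h1 d0 mE PE fh.
have [iF iH] := (bmfun_integrable P bf, bmfun_integrable P bh).
have bI : bmfun (fun w => delta + 2 * \1_E w : R).
  by apply: bmfunD; [exact: (bmfun_cst _ delta)|apply: bmfunZ; exact: bmfun_indic].
rewrite -RintegralB// (le_trans (le_normr_Rintegral _ _))//.
  by apply: bmfun_integrable; exact: bmfunB.
apply: (@le_trans _ _ (\int[P]_w (delta + 2 * \1_E w))).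
  apply: le_Rintegral => //.
  - by apply: integrable_norm; apply: bmfun_integrable; exact: bmfunB.
  - exact: bmfun_integrable.
  - move=> w _; rewrite indicE; have [Ew|nE] := boolP (w \in E).
      rewrite mulr1 (le_trans (ler_normB _ _))//.
      by rewrite (le_trans (lerD (f1 w) (h1 w)))// lerDr.
    by rewrite mulr0 addr0 fh// => Ew; rewrite mem_set in nE.
have iE : P.-integrable setT (EFin \o (\1_E : T -> R)).
  by apply: bmfun_integrable; exact: bmfun_indic.
rewrite RintegralD//; last exact: integrable_EFinZ.
  rewrite RintegralZl// (Rintegral_probability_cst P delta) lerD2l ler_wpM2l//.
  rewrite /Rintegral integral_indic// setIT -lee_fin fineK//.
  exact: fin_num_measure.
exact: (bmfun_integrable P (bmfun_cst _ delta)).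
Qed.

Lemma bmfun_le1 d (T : measurableType d) (R : realType) (f : T -> R) :
  measurable_fun setT f -> (forall w, `|f w| <= 1) -> bmfun f.
Proof. by move=> mf f1; split => //; exists 1. Qed.

Lemma l1_subv (R : realType) (d : nat) (A : {set 'I_d}) (v : 'cV[R]_d) : l1 (subv A v) <= l1 v.
Proof.
have -> : l1 (subv A v) = \sum_(j in A) `|v j ord0|.
  by rewrite [RHS]big_enum_val/=; apply: eq_bigr => i _; rewrite mxE.
by rewrite /l1 [leRHS](bigID (mem A))/= lerDl sumr_ge0.
Qed.

Section selected_covariance.
Context (R : realType) (d : nat) (A : {set 'I_d}) (I : 'M[R]_d) (c : R) (t : 'cV[R]_#|A|).
Hypotheses (I_sym : I^T = I) (I_posdef : posdefmx I) (c_gt0 : 0 < c).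

Let theta : 'cV[R]_d := (selmx R A)^T *m ((invmx (submat A (c *: I)))^T *m t).

Lemma dotv_selected (w : 'cV[R]_d) :
  dotv t (subv A ((selmx R A)^T *m (invmx (submat A (c *: I)) *m subv A w))) = dotv theta w.
Proof.
rewrite !subvE mulmxA selmx_mulmx_tr mul1mx /dotv /theta !trmx_mul !trmxK.
by rewrite !mulmxA.
Qed.

(** The sandwich of [I_A] between two inverses of [c I_A] leaves the inverse of [I_A] divided by
    [c ^+ 2]; it is used with [c = m]. *)
Lemma dotv_selected_covariance :
  dotv theta (I *m theta) = c^-2 * dotv t (invmx (submat A I) *m t).
Proof.
have Iu : submat A I \in unitmx.
  by apply: posdefmx_unitmx; [exact: submat_sym|exact: posdefmx_submat].
have cIu : c *: submat A I \in unitmx by rewrite unitmxZ// unitfE gt_eqF.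
have -> : theta = c^-1 *: ((selmx R A)^T *m (invmx (submat A I) *m t)).
  rewrite /theta submatE -scalemxAr -scalemxAl -submatE invmxZ// linearZ/=.
  by rewrite -scalemxAl -scalemxAr trmx_inv (submat_sym A I_sym).
rewrite -scalemxAr dotvZr dotvZl mulrA -expr2 exprVn; congr (_ * _).
rewrite /dotv !trmx_mul trmxK trmx_inv (submat_sym A I_sym).
have -> : t^T *m invmx (submat A I) *m selmx R A *m (I *m ((selmx R A)^T *m (invmx (submat A I) *m t))) =
    t^T *m (invmx (submat A I) *m (submat A I *m (invmx (submat A I) *m t))).
  by rewrite submatE !mulmxA.
by rewrite mulKVmx// mulmxA.
Qed.

End selected_covariance.

Section adaptive_lasso_asymptotics.
Context (R : realType) (disp : measure_display) (T : measurableType disp).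
Variables (P : probability T R) (d : nat) (bstar : 'cV[R]_d).
Variable bt : nat -> {RV P >-> borelV R d}.
Let A := supp bstar.

Let mbt n j : measurable_fun setT (fun w => (bt n w : 'cV[R]_d) j ord0).
Proof. exact: (measurableT_comp (measurable_coord j) (measurable_funPT (bt n))). Qed.

Lemma measurable_selection n : measurable [set w | supp (bt n w : 'cV[R]_d) = A].
Proof.
have -> : [set w | supp (bt n w : 'cV[R]_d) = A] =
    ~` [set w | exists j, ((bt n w : 'cV[R]_d) j ord0 != 0) != (j \in A)].
  apply/seteqP; split => w /=.
    by move=> E [j]; rewrite -E inE eqxx.
  move=> h; apply/setP => j; rewrite inE; apply: contrapT => hj; apply: h; by exists j; apply/eqP.
apply: measurableC.
have mj j : measurable [set w | ((bt n w : 'cV[R]_d) j ord0 != 0) != (j \in A)].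
  have m0 : measurable [set w | (bt n w : 'cV[R]_d) j ord0 = 0].
    rewrite -[X in measurable X]setTI; apply: (mbt n j measurableT (measurable_set1 0)).
  case: (j \in A).
    rewrite (_ : mkset _ = [set w | (bt n w : 'cV[R]_d) j ord0 = 0])//.
    by apply/seteqP; split => w /=; [rewrite eqb_id negbK => /eqP|move=> ->; rewrite eqxx].
  rewrite (_ : mkset _ = ~` [set w | (bt n w : 'cV[R]_d) j ord0 = 0]); first exact: measurableC.
  by apply/seteqP; split => w /=; [rewrite eqbF_neg negbK => /eqP|move=> /eqP; rewrite eqbF_neg negbK].
(* The trivial bound 1 gives access to the measurability half of the lemma on finite unions. *)
exact: (probability_finite_union (P := P) (e := 1) mj (fun j => probability_le1 P (mj j))).1.
Qed.

Lemma selection_consistency :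
  (forall e0 : R, 0 < e0 -> \forall n \near \oo, exists E : set T,
    [/\ measurable E, (P E <= e0%:E)%E & forall w, ~ E w -> supp (bt n w : 'cV[R]_d) = A]) ->
  P [set w | supp (bt n w : 'cV[R]_d) = A] @[n --> \oo] --> 1%E.
Proof.
move=> h; pose G n := [set w | supp (bt n w : 'cV[R]_d) = A].
have mG n : measurable (G n) by exact: measurable_selection.
suff : fine (P (G n)) @[n --> \oo] --> (1 : R).
  move=> h1; have -> : (fun n => P (G n)) = (fun n => (fine (P (G n)))%:E).
    by apply/funext => n; rewrite fineK// fin_num_measure.
  by apply: cvg_EFin; [exact: nearW|exact: h1].
apply/cvgrPdist_le => e e0; near=> n.
have [E [mE PE hE]] : exists E : set T,
    [/\ measurable E, (P E <= e%:E)%E & forall w, ~ E w -> supp (bt n w : 'cV[R]_d) = A].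
  by near: n; exact: h.
have PG : (1 - fine (P (G n)))%:E = P (~` G n).
  by rewrite probability_setC// EFinB fineK// fin_num_measure.
have le1 : (P (~` G n) <= e%:E)%E.
  apply: le_trans PE; apply: le_measure; rewrite ?inE//; first exact: measurableC.
  by move=> w /= nG; apply: contrapT => /hE.
have ge0 : (0%:E <= P (~` G n))%E by exact: measure_ge0.
by rewrite ger0_norm -lee_fin PG.
Unshelve. all: by end_near. Qed.

End adaptive_lasso_asymptotics.

Unset Implicit Arguments.

Theorem theorem1 (R : realType) (disp : measure_display)
  (T : measurableType disp) (P : probability T R)
  (d m : nat) (alpha0 gamma : R)
  (m_ge1 : (1 <= m)%N) (alpha0_gt0 : 0 < alpha0) (gamma_gt0 : 0 < gamma)
  (bstar : 'cV[R]_d) (sparse : (#|supp bstar| < d)%N)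
  (* Q is the law of the generic feature vector *)
  (Q : probability (borelV R d) R)
  (x : nat -> {RV P >-> borelV R d}) (S1 S0 : nat -> {RV P >-> nat})
  (x_law : forall i (B : set (borelV R d)), measurable B ->
     P (x i @^-1` B) = Q B)
  (votes_law : forall i (B : set (borelV R d)) (k1 k0 : nat), measurable B ->
     P (x i @^-1` B `&` S1 i @^-1` [set k1] `&` S0 i @^-1` [set k0]) =
     (\int[P]_(w in x i @^-1` B)
        (dirichlet_multinomial_pmf m (alpha0 * logistic (x i w) bstar)
           (alpha0 * (1 - logistic (x i w) bstar)) k1 k0)%:E)%E)
  (indep : mutually_independent P (fun i w => (x i w, S1 i w, S0 i w)))
  (binit : nat -> {RV P >-> borelV R d})
  (binit_consistent :
     bigO_P P (fun n w => norm2 ((binit n w : 'cV[R]_d) - bstar))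
       (fun n => (Num.sqrt n%:R)^-1))
  (lambda : nat -> R)
  (lambda_small : lambda n / Num.sqrt n%:R @[n --> \oo] --> (0 : R))
  (lambda_large :
     lambda n * n%:R `^ ((gamma - 1) / 2) @[n --> \oo] --> +oo)
  (bt : nat -> {RV P >-> borelV R d})
  (bt_min : forall n w, (0 < n)%N ->
     is_adaptive_lasso n m (lambda n) gamma (binit n w)
       (fun i => x i w) (fun i => S1 i w) (bt n w))
  (A1 : fisher_assumption Q bstar)
  (A2 : third_derivative_assumption Q m bstar) :
  P [set w | supp (bt n w) = supp bstar] @[n --> \oo] --> 1%E /\
  cvg_to_normal P
    (fun n w => Num.sqrt n%:R *:
       (subv (supp bstar) (bt n w) - subv (supp bstar) bstar))
    0
    ((m%:R + alpha0) / (m%:R * (1 + alpha0)) *: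
       invmx (submat (supp bstar) (fisher Q bstar))).
Proof.
have loc := localization m_ge1 alpha0_gt0 gamma_gt0 x_law votes_law indep binit_consistent
  lambda_small lambda_large bt_min A1 A2.
split.
  apply: selection_consistency => e0 e00.
  have [C hC] := loc _ _ e00 (@ltr01 R).
  apply: filterS hC => n [E [mE PE hE]]; exists E; split => // w /hE[].
  by [].
pose A := supp bstar; pose I := fisher Q bstar.
pose c : R := (m%:R + alpha0) / (m%:R * (1 + alpha0)).
have mR : 0 < m%:R :> R by rewrite ltr0n.
have a1 : 0 < 1 + alpha0 by rewrite ltr_wpDl.
have c0 : 0 < c by rewrite divr_gt0 ?mulr_gt0// addr_gt0.
have I_sym : I^T = I by exact: fisher_sym.
have [B BI] := posdefmx_congruent1 (submat_sym A I_sym) (posdefmx_submat (A := A) A1.2).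
(* By [congruent1_inv], [B^T *m B] is the inverse of [I_A], so [F] is a factor of the target
   covariance as [is_normal] requires. *)
pose F := Num.sqrt c *: B^T.
have FE : F *m F^T = c *: invmx (submat A I).
  rewrite /F (congruent1_inv BI) linearZ/= trmxK -scalemxAl -scalemxAr scalerA.
  by rewrite -expr2 sqr_sqrtr// ltW.
have [nu [nuN nucf]] := exists_normal F; rewrite FE in nuN nucf.
exists nu; split; first exact: nuN.
pose u := rescaled_error bstar bt.
have YE n w : Num.sqrt n%:R *: (subv A (bt n w) - subv A bstar) = subv A (u n w).
  by rewrite !subvE /u /rescaled_error -scalemxAr mulmxBr.
have mY n j : measurable_fun setT (fun w =>
    (Num.sqrt n%:R *: (subv A (bt n w) - subv A bstar)) j ord0).
  under eq_fun do rewrite !mxE.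
  apply: measurable_funM => //; apply: measurable_funB => //.
  exact: (measurableT_comp (measurable_coord _) (measurable_funPT (bt n))).
pose V n w := subv A (linearized_error m bstar Q x S1 n w).
pose theta (t : 'cV[R]_#|A|) : 'cV[R]_d :=
  (selmx R A)^T *m ((invmx (submat A (m%:R *: I)))^T *m t).
have VE t n w : dotv t (V n w) = dotv (theta t) (scaled_score m bstar x S1 n w).
  exact: dotv_selected.
have V_cf t : \int[P]_w cos (dotv t (V n w)) @[n --> \oo] -->
      expR (- dotv t (c *: invmx (submat A I) *m t) / 2) /\
    \int[P]_w sin (dotv t (V n w)) @[n --> \oo] --> 0.
  have E (g : R -> R) : (fun n => \int[P]_w g (dotv t (V n w))) =
      (fun n => \int[P]_w g (dotv (theta t) (scaled_score m bstar x S1 n w))).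
    by apply/funext => n; congr Rintegral; apply/funext => w; rewrite VE.
  rewrite (E cos) (E sin).
  have := scaled_score_cf alpha0_gt0 x_law votes_law indep A1 (theta t).
  rewrite (dotv_selected_covariance t I_sym A1.2 mR).
  rewrite -scalemxAl dotvZr.
  (* The variance factor of the score divided by [m ^ 2] is [c]. *)
  rewrite (_ : m%:R * (m%:R + alpha0) / (1 + alpha0) * _ = c * dotv t (invmx (submat A I) *m t)).
    by rewrite mulNr.
  by rewrite /c; field; rewrite !gt_eqF.
have mVt n t : measurable_fun setT (fun w => dotv t (V n w)).
  under eq_fun do rewrite VE.
  exact: measurable_scaled_score.
have mYt n t : measurable_fun setT (fun w =>
    dotv t (Num.sqrt n%:R *: (subv A (bt n w) - subv A bstar))).
  under eq_fun do rewrite dotvE.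
  by apply: measurable_sum => j; apply: measurable_funM.
(* A Slutsky argument for one characteristic function: a 1-Lipschitz [g] bounded by 1 hardly
   distinguishes two vectors that are close outside an event of small probability. *)
have transfer (g : R -> R) t (l : R) : bmfun g -> (forall y, `|g y| <= 1) ->
    (forall a b, `|g a - g b| <= `|a - b|) ->
    \int[P]_w g (dotv t (V n w)) @[n --> \oo] --> l ->
    \int[P]_w g (dotv t (Num.sqrt n%:R *: (subv A (bt n w) - subv A bstar))) @[n --> \oo] --> l.
  move=> bg g1 gl Vl; apply/cvgrPdist_le => e e0.
  have e4 : 0 < e / 8 by rewrite divr_gt0.
  (* The Lipschitz error is then at most [l1 t * e' <= e / 4]; with [e / 2] for the limit and
     [2 * (e / 8)] for the exceptional event the total is [e]. *)
  pose e' := e / (4 * (l1 t + 1)).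
  have l10 : 0 < l1 t + 1 by rewrite ltr_wpDl// l1_ge0.
  have e'0 : 0 < e' by rewrite divr_gt0// mulr_gt0.
  have [C hC] := loc _ _ e4 e'0.
  have Vl2 : \forall n \near \oo, `|l - \int[P]_w g (dotv t (V n w))| <= e / 2.
    by move/cvgrPdist_le : Vl; apply; rewrite divr_gt0.
  near=> n.
  have [E [mE PE hE]] : exists E : set T, [/\ measurable E, (P E <= (e / 8)%:E)%E &
    forall w, ~ E w -> [/\ supp (bt n w) = supp bstar, l1 (u n w) <= C &
      l1 (u n w - linearized_error m bstar Q x S1 n w) <= e']] by near: n; exact: hC.
  have Ve : `|l - \int[P]_w g (dotv t (V n w))| <= e / 2 by near: n.
  have bc (Z : T -> R) : measurable_fun setT Z -> bmfun (fun w => g (Z w)).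
    by move=> mZ; apply: bmfun_le1 => //; exact: (measurableT_comp bg.1 mZ).
  have := @Rintegral_close _ _ _ P _ _ E (e / 4) (e / 8) (bc _ (mVt n t)) (bc _ (mYt n t))
    (fun w => g1 _) (fun w => g1 _) _ mE PE _.
  have h : forall w, ~ E w -> `|g (dotv t (V n w)) -
      g (dotv t (Num.sqrt n%:R *: (subv A (bt n w) - subv A bstar)))| <= e / 4.
    move=> w /hE[_ _ h]; apply: (le_trans (gl _ _)); rewrite YE -dotvBr.
    rewrite (_ : V n w - subv A (u n w) =
      subv A (linearized_error m bstar Q x S1 n w - u n w)); last by rewrite /V !subvE mulmxBr.
    rewrite (le_trans (dotv_le_l1 _ (l1_coord t)))//.
    apply: (@le_trans _ _ (l1 t * e')).
      by rewrite ler_wpM2l ?l1_ge0// (le_trans (l1_subv _ _))// -l1N opprB.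
    rewrite /e' mulrA ler_pdivrMr ?mulr_gt0//.
    rewrite (_ : e / 4 * (4 * (l1 t + 1)) = (l1 t + 1) * e); last by field.
    by rewrite ler_wpM2r ?(ltW e0)// lerDl.
  have e40 : 0 <= e / 4 by rewrite divr_ge0// ltW.
  move=> /(_ e40 h) hh; apply: (le_trans (ler_distD (\int[P]_w g (dotv t (V n w))) _ _)).
  apply: (le_trans (lerD Ve hh)); rewrite le_eqVlt; apply/orP; left; apply/eqP.
  by field.
pose Y n w := Num.sqrt n%:R *: (subv A (bt n w) - subv A bstar).
refine (@cvg_in_distribution_cf R #|A| _ _ P Y nu _ _ _ _).
- by move=> n; apply: measurable_borelV; exact: mY.
(* Tightness comes from the radius [C] in [localization], whose accuracy parameter is set to 1
   here. *)
- move=> e e0; have [C hC] := loc _ _ e0 (@ltr01 R).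
  exists C; apply: filterS hC => n [E [mE PE hE]]; apply: le_trans PE; apply: le_measure.
  + rewrite inE (_ : mkset _ = [set w | exists j, C <
      `|(Num.sqrt n%:R *: (subv A (bt n w) - subv A bstar)) j ord0|]).
      have mF j := measurable_norm_gt C (mY n j).
      exact: (probability_finite_union (P := P) (e := 1) mF (fun j => probability_le1 P (mF j))).1.
    apply/seteqP; split => w /=.
      by move=> /existsNP[j /negP]; rewrite -ltNge; exists j.
    by move=> [j h] /(_ j); rewrite leNgt h.
  + by rewrite inE.
  + move=> w /= H; apply: contrapT => /hE[_ uC _]; apply: H => j.
    rewrite /Y YE; apply: le_trans uC; apply: le_trans (l1_subv _ _); exact: l1_coord.
- move=> t; rewrite (nucf t).1; apply: transfer (V_cf t).1.
  + exact: bmfun_cos.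
  + by move=> y; exact: cos_max.
  + exact: cos_lipschitz.
- move=> t; rewrite (nucf t).2; apply: transfer (V_cf t).2.
  + exact: bmfun_sin.
  + by move=> y; exact: sin_max.
  + exact: sin_lipschitz.
Unshelve. all: by end_near. Qed.
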